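(* Let $G$ be a finite group, and let $V,V_c,B,E\subseteq \mathrm{Aut}_{Hopf}(DG)$ be the subgroups and $R\subseteq R_t$ the sets of reflections and twisted reflections defined in the context. (i) The group $\mathrm{Aut}_{Hopf}(DG)$ is generated by the subgroups $V$, $V_c$, $B$, $E$ and the set of reflections $R$. (ii) For every $\phi\in \mathrm{Aut}_{Hopf}(DG)$ there is a twisted reflection $r=r_{(H,C,\delta,\nu)}\in R_t$ such that $\phi$ is an element of the double coset $$[(V_c\rtimes V)\ltimes B]\cdot r\cdot[(V_c\rtimes V)\ltimes E].$$ (iii) For two reflections $r=r_{(H,C,\delta)}$ and $r'=r_{(H',C',\delta')}$ in $R$, the double cosets $[(V_c\rtimes V)\ltimes B]\cdot r\cdot[(V_c\rtimes V)\ltimes E]$ and $[(V_c\rtimes V)\ltimes B]\cdot r'\cdot[(V_c\rtimes V)\ltimes E]$ are equal if and only if $C\simeq C'$. (iv) For every $\phi\in \mathrm{Aut}_{Hopf}(DG)$ there is a reflection $r=r_{(H,C,\delta)}\in R$ such that $\phi$ is an element of $$r\cdot[\,B\,((V_c\rtimes V)\ltimes E)\,].$$ (v) For every $\phi\in \mathrm{Aut}_{Hopf}(DG)$ there is a reflection $r=r_{(H,C,\delta)}\in R$ such that $\phi$ is an element of $$[\,((V_c\rtimes V)\ltimes B)\,E\,]\cdot r.$$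
   Context: Throughout, $k$ is an algebraically closed field of characteristic zero, $G$ is a finite group, $kG$ is its group algebra, and $k^G=\mathrm{Hom}(kG,k)$ is the dual Hopf algebra with basis $e_x$ ($x\in G$), $e_x(y)=\delta_{x,y}$. For a group $A$, $\hat A$ is the group of one-dimensional characters of $A$. $G_{ab}=G/[G,G]$ and $Z(G)$ is the center. The Drinfeld double $DG$ is the Hopf algebra with underlying vector space $k^G\otimes kG$, basis $e_x\times y$ ($x,y\in G$), and $$(e_x\times y)(e_{x'}\times y')=e_x(yx'y^{-1})\,(e_x\times yy'),\qquad \Delta(e_x\times y)=\sum_{x_1x_2=x}(e_{x_1}\times y)\otimes(e_{x_2}\times y),$$ unit $\sum_x e_x\times 1_G$, counit $\epsilon(e_x\times y)=\delta_{x,1_G}$, antipode $S(e_x\times y)=e_{y^{-1}x^{-1}y}\times y^{-1}$. $\mathrm{Aut}_{Hopf}(DG)$ is its group of Hopf algebra automorphisms. For $f\in k^G$, $g\in G$ write $f\times g$ for the corresponding element of $DG$. Subgroups of $\mathrm{Aut}_{Hopf}(DG)$: - $V$ consists of the automorphisms $e_g\times h\mapsto e_{v(g)}\times v(h)$ for $v\in\mathrm{Aut}(G)$. - $V_c$ consists of the automorphisms $e_g\times h\mapsto e_{v(g)}\times h$ for $v\in\mathrm{Aut}_c(G):=\{v\in\mathrm{Aut}(G)\mid v(g)g^{-1}\in Z(G)\ \forall g\in G\}$. - $B$ consists of the automorphisms $e_g\times h\mapsto b(h)(g)\,e_g\times h$ for $b\in\mathrm{Hom}(G_{ab},\widehat{G_{ab}})$.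 - $E$ consists of the automorphisms $e_g\times h\mapsto\sum_{g_1g_2=g}e_{g_1}\times a(e_{g_2})h$ for $a\in\mathrm{Hom}(\widehat{Z(G)},Z(G))$, where $a$ is regarded as the Hopf algebra map $k^G\to k^{Z(G)}\cong k\widehat{Z(G)}\xrightarrow{a} kZ(G)\subset kG$ (the first arrow is restriction of functions). The expressions $V_c\rtimes V$, $(V_c\rtimes V)\ltimes B$, $(V_c\rtimes V)\ltimes E$ denote the (internal semidirect product) subgroups of $\mathrm{Aut}_{Hopf}(DG)$ generated by the respective subgroups; a juxtaposition of subsets denotes the product set. Twisted reflections: $R_t$ is the set of tuples $(H,C,\delta,\nu)$ where $C$ is an abelian subgroup of $G$, $H$ is a subgroup of $G$, $G=H\times C$ (internal direct product), $\delta:kC\to k^C$ is an isomorphism of Hopf algebras, and $\nu:C\to C$ is a nilpotent group homomorphism (some iterate of $\nu$ is the trivial homomorphism). Using $k^G=k^H\otimes k^C$ and $kG=kH\otimes kC$, such a tuple defines the twisted reflection $r_{(H,C,\delta,\nu)}\in\mathrm{Aut}_{Hopf}(DG)$, $$(f_H\otimes f_C)\times(h,c)\ \mapsto\ (f_H\otimes\delta(c))\times\big(h,\ \delta^{-1}(f_C)\,\nu(c)\big),\qquad f_H\in k^H,\ f_C\in k^C,\ h\in H,\ c\in C.$$ $R\subseteq R_t$ is the subset of those elements for which $\nu$ is the trivial homomorphism $c\mapsto 1$; these are called reflections and written $r_{(H,C,\delta)}$. The tuples are identified with the corresponding automorphisms. The case $C=1$ (giving the identity) is allowed. *)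

(* Defs.v *)
From HB Require Import structures.
From mathcomp Require Import all_boot all_order all_algebra.
From mathcomp Require Import all_fingroup all_solvable all_field.

Set Implicit Arguments.
Unset Strict Implicit.
Unset Printing Implicit Defensive.

Import GRing.Theory.
Local Open Scope ring_scope.

Section Characters.

Variables (k : closedFieldType) (A : finGroupType).

(* Values are automatically nonzero, since f x * f (x^-1) = f 1 = 1. *)
Definition is_char (f : {ffun A -> k}) : bool :=
  (f 1%g == 1) && [forall x, forall y, f (x * y)%g == f x * f y].

Record character := Character {
  char_fun :> {ffun A -> k};
  _ : is_char char_fun
}.

HB.instance Definition _ := [isSub for char_fun].
HB.instance Definition _ := [Choice of character by <:].

Lemma char1 (c : character) : c 1%g = 1.
Proof. by case: c => f /= /andP[/eqP]. Qed.

Lemma charM (c : character) x y : c (x * y)%g = c x * c y.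
Proof. by case: c => f /= /andP[_ /forallP/(_ x)/forallP/(_ y)/eqP]. Qed.

Lemma charP (c d : character) : c =1 d -> c = d.
Proof. by move=> e; apply/val_inj/ffunP. Qed.

Lemma charX (c : character) x n : c (x ^+ n)%g = c x ^+ n.
Proof.
by elim: n => [|n IHn]; rewrite ?expg0 ?char1 // expgS charM IHn exprS.
Qed.

(* k being algebraically closed, the values of a character are listed by the
   roots of 'X^#|A| - 1; hence there are finitely many characters. *)
Definition char_values : seq k :=
  sval (closed_field_poly_normal ('X^#|A| - 1 : {poly k})).

Lemma char_valueP (c : character) x : c x \in char_values.
Proof.
have A0 : (0 < #|A|)%N by apply/card_gt0P; exists 1%g.
have : root ('X^#|A| - 1) (c x).
  rewrite rootE !hornerE -charX.
  have -> : (x ^+ #|A| = 1)%g by rewrite -cardsT; apply/expg_cardG/in_setT.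
  by rewrite char1 subrr.
rewrite /char_values; case: closed_field_poly_normal => r /= {1}->.
by rewrite (monicP (monicXnsubC 1 A0)) scale1r root_prod_XsubC.
Qed.

Definition char_code (c : character) : {ffun A -> seq_sub char_values} :=
  [ffun x => SeqSub (char_valueP c x)].

Definition char_decode (f : {ffun A -> seq_sub char_values}) :
  option character := insub [ffun x => ssval (f x)].

Lemma char_codeK : pcancel char_code char_decode.
Proof.
move=> c; rewrite /char_decode.
have -> : [ffun x => ssval (char_code c x)] = char_fun c.
  by apply/ffunP=> x; rewrite !ffunE.
by rewrite valK.
Qed.

HB.instance Definition _ : isCountable character := PCanIsCountable char_codeK.
HB.instance Definition _ : isFinite character := PCanIsFinite char_codeK.

Lemma char_one_subproof : is_char [ffun=> 1].
Proof.
rewrite /is_char ffunE eqxx; apply/forallP=> x; apply/forallP=> y.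
by rewrite !ffunE mulr1.
Qed.

Lemma char_mul_subproof (c d : character) : is_char [ffun x => c x * d x].
Proof.
rewrite /is_char ffunE !char1 mulr1 eqxx.
apply/forallP=> x; apply/forallP=> y.
by rewrite !ffunE !charM mulrACA.
Qed.

Lemma char_inv_subproof (c : character) : is_char [ffun x => c x^-1%g].
Proof.
rewrite /is_char ffunE invg1 char1 eqxx.
apply/forallP=> x; apply/forallP=> y.
by rewrite !ffunE invMg charM mulrC.
Qed.

Definition char_one := Character char_one_subproof.
Definition char_mul c d := Character (char_mul_subproof c d).
Definition char_inv c := Character (char_inv_subproof c).

Lemma char_mulA : associative char_mul.
Proof. by move=> a b c; apply/charP=> x; rewrite !ffunE mulrA. Qed.

Lemma char_mul1 : left_id char_one char_mul.
Proof. by move=> a; apply/charP=> x; rewrite !ffunE mul1r. Qed.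

Lemma char_mulV : left_inverse char_one char_inv char_mul.
Proof.
by move=> a; apply/charP=> x; rewrite !ffunE -charM mulVg char1.
Qed.

HB.instance Definition _ :=
  Finite_isGroup.Build character char_mulA char_mul1 char_mulV.

End Characters.

Notation vec k I := {ffun I -> k^o}.

Section Hopf.

Variable k : closedFieldType.

Definition delta (I : finType) (i : I) : vec k I := [ffun j => (j == i)%:R].

(* vec k (I * J) stands for the tensor product of vec k I and vec k J. *)
Definition tens (I J : finType) (u : vec k I) (v : vec k J) : vec k (I * J) :=
  [ffun p => u p.1 * v p.2].

Definition linext_fun (I : finType) (W : vectType k) (F : I -> W)
  (u : vec k I) : W := \sum_i u i *: F i.

Lemma linext_fun_linear (I : finType) (W : vectType k) (F : I -> W) :
  linear (linext_fun F).
Proof.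
move=> a v w; rewrite /linext_fun scaler_sumr -big_split /=.
by apply: eq_bigr => i _; rewrite !ffunE scalerDl scalerA.
Qed.

HB.instance Definition _ (I : finType) (W : vectType k) (F : I -> W) :=
  GRing.isLinear.Build k (vec k I) W *:%R (@linext_fun I W F)
    (@linext_fun_linear I W F).

Definition linext (I : finType) (W : vectType k) (F : I -> W) :
  'Hom(vec k I, W) := linfun (linext_fun F).

Lemma linextE (I : finType) (W : vectType k) (F : I -> W) u :
  linext F u = \sum_i u i *: F i.
Proof. by rewrite lfunE. Qed.

Lemma linext_delta (I : finType) (W : vectType k) (F : I -> W) i :
  linext F (delta i) = F i.
Proof.
rewrite linextE (bigD1 i) //= ffunE eqxx scale1r big1 ?addr0 // => j ne_ji.
by rewrite ffunE (negPf ne_ji) scale0r.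
Qed.

(* Structure maps by their values on the basis; no Hopf algebra axiom is part of
   the record, which is only used for the explicit instances below. *)
Record hopf_data (I : finType) := HopfData {
  basis_mul : I -> I -> vec k I;
  hopf_one : vec k I;
  basis_comul : I -> vec k (I * I);
  basis_counit : I -> k^o;
  basis_antipode : I -> vec k I
}.

Definition hopf_mul I (X : hopf_data I) (u v : vec k I) : vec k I :=
  \sum_i \sum_j (u i * v j) *: basis_mul X i j.
Definition hopf_comul I (X : hopf_data I) := linext (basis_comul X).
Definition hopf_counit I (X : hopf_data I) := linext (basis_counit X).
Definition hopf_antipode I (X : hopf_data I) := linext (basis_antipode X).

Definition tens_map (I J : finType) (f : 'Hom(vec k I, vec k J)) :
  'Hom(vec k (I * I), vec k (J * J)) :=
  linext (fun p : I * I => tens (f (delta p.1)) (f (delta p.2))).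

Definition hopf_morphism I J (X : hopf_data I) (Y : hopf_data J)
    (f : 'Hom(vec k I, vec k J)) : Prop :=
  [/\ forall u v, f (hopf_mul X u v) = hopf_mul Y (f u) (f v),
      f (hopf_one X) = hopf_one Y,
      forall u, hopf_comul Y (f u) = tens_map f (hopf_comul X u),
      forall u, hopf_counit Y (f u) = hopf_counit X u
    & forall u, hopf_antipode Y (f u) = f (hopf_antipode X u)].

Definition hopf_isomorphism I J (X : hopf_data I) (Y : hopf_data J)
    (f : 'Hom(vec k I, vec k J)) : Prop :=
  hopf_morphism X Y f /\ bijective f.

Section GroupHopfAlgebras.

Variable A : finGroupType.

(* kA, with delta x the group element x *)
Definition group_alg : hopf_data A := {|
  basis_mul x y := delta (x * y)%g;
  hopf_one := delta 1%g;
  basis_comul x := delta (x, x);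
  basis_counit _ := 1;
  basis_antipode x := delta x^-1%g
|}.

(* k^A, with delta x the function e_x *)
Definition fun_alg : hopf_data A := {|
  basis_mul x y := (x == y)%:R *: delta x;
  hopf_one := \sum_x delta x;
  basis_comul x := \sum_(q : A * A | (q.1 * q.2)%g == x) delta q;
  basis_counit x := (x == 1%g)%:R;
  basis_antipode x := delta x^-1%g
|}.

(* DA, with delta (x, y) the basis element e_x \times y *)
Definition double : hopf_data (A * A)%type := {|
  basis_mul p q :=
    (p.2 * q.1 * p.2^-1 == p.1)%g%:R *: delta (p.1, (p.2 * q.2)%g);
  hopf_one := \sum_x delta (x, 1%g);
  basis_comul p :=
    \sum_(q : A * A | (q.1 * q.2)%g == p.1) delta ((q.1, p.2), (q.2, p.2));
  basis_counit p := (p.1 == 1%g)%:R;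
  basis_antipode p := delta (p.2^-1 * p.1^-1 * p.2, p.2^-1)%g
|}.

End GroupHopfAlgebras.

End Hopf.

Arguments delta {k I} i.
Arguments group_alg {k} A.
Arguments fun_alg {k} A.
Arguments double {k} A.

(* In products of sets of endomorphisms, f times g is f \o g (g acts first). *)

Section Subsets.

Variables (k : closedFieldType) (V : vectType k).

Definition unionE (S T : 'End(V) -> Prop) : 'End(V) -> Prop :=
  fun f => S f \/ T f.

Definition prodE (S T : 'End(V) -> Prop) : 'End(V) -> Prop :=
  fun f => exists g h, [/\ S g, T h & f = (g \o h)%VF].

Definition singE (f : 'End(V)) : 'End(V) -> Prop := fun g => g = f.

(* Only used for sets S of bijective maps, for which ^-1 is the inverse. *)
Inductive gen_subgroup (S : 'End(V) -> Prop) : 'End(V) -> Prop :=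
| gen_mem f : S f -> gen_subgroup S f
| gen_id : gen_subgroup S \1%VF
| gen_comp f g : gen_subgroup S f -> gen_subgroup S g -> gen_subgroup S (f \o g)%VF
| gen_inv f : gen_subgroup S f -> gen_subgroup S (f^-1)%VF.

End Subsets.

Section DoubleAutomorphisms.

Variables (k : closedFieldType) (G : finGroupType).

Local Notation DG := (vec k (G * G)%type).
Local Notation ZG := 'Z([set: G])%g.
Local Notation subgZ := (subg_of 'Z([set: G])%G).
Local Notation Gab := (coset_of [~: [set: G], [set: G]]%G).

Definition hopf_aut (f : 'End(DG)) : Prop :=
  hopf_isomorphism (double G) (double G) f.

Definition V_map (v : {perm G}) : 'End(DG) :=
  linext (fun p : G * G => delta (v p.1, v p.2)).

Definition V_set (f : 'End(DG)) : Prop :=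
  exists2 v : {perm G}, v \in Aut [set: G] & f = V_map v.

Definition central_aut (v : {perm G}) : Prop :=
  v \in Aut [set: G] /\ forall g, (v g * g^-1)%g \in ZG.

Definition Vc_map (v : {perm G}) : 'End(DG) :=
  linext (fun p : G * G => delta (v p.1, p.2)).

Definition Vc_set (f : 'End(DG)) : Prop :=
  exists2 v : {perm G}, central_aut v & f = Vc_map v.

Definition B_map (b : {morphism [set: Gab] >-> character k Gab}) : 'End(DG) :=
  linext (fun p : G * G => b (coset _ p.2) (coset _ p.1) *: delta p).

Definition B_set (f : 'End(DG)) : Prop := exists b, f = B_map b.

(* The canonical map from the group algebra of the dual group of A to k^A; it
   is an isomorphism when A is abelian and k has characteristic 0. *)
Definition char_alg_map (A : finGroupType) :
    'Hom(vec k (character k A), vec k A) :=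
  linext (fun c : character k A => [ffun x => c x : k^o]).

Definition restrict (C : {group G}) : 'Hom(vec k G, vec k (subg_of C)) :=
  linfun (fun f : vec k G => [ffun z => f (sgval z)] : vec k (subg_of C)).

Definition central_map (a : {morphism [set: character k subgZ] >-> subgZ}) :
    'Hom(vec k G, vec k G) :=
  (linext (fun c : character k subgZ => delta (sgval (a c)))
     \o ((char_alg_map subgZ)^-1 \o restrict _))%VF.

Definition E_map (a : {morphism [set: character k subgZ] >-> subgZ}) :
    'End(DG) :=
  linext (fun p : G * G => \sum_(q : G * G | (q.1 * q.2)%g == p.1)
    tens (delta q.1)
         (hopf_mul (group_alg G) (central_map a (delta q.2)) (delta p.2))).

Definition E_set (f : 'End(DG)) : Prop := exists a, f = E_map a.

Section Reflections.

Variables H C : {group G}.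

(* The identifications of k^H \otimes k^C with k^G and of kH \otimes kC with
   kG, both given on coordinates by (u \otimes w)(h c) = u(h) w(c). *)
Definition glue (u : vec k (subg_of H)) (w : vec k (subg_of C)) : vec k G :=
  [ffun x => u (subg H (divgr H C x)) * w (subg C (remgr H C x))].

Definition reflection_map
    (d : 'Hom(vec k (subg_of C), vec k (subg_of C)))
    (nu : {morphism [set: subg_of C] >-> subg_of C}) : 'End(DG) :=
  linext (fun p : G * G =>
    let xH := subg H (divgr H C p.1) in let xC := subg C (remgr H C p.1) in
    let h := subg H (divgr H C p.2) in let c := subg C (remgr H C p.2) in
    tens (glue (delta xH) (d (delta c)))
         (glue (delta h) (hopf_mul (group_alg (subg_of C))
                            ((d^-1)%VF (delta xC)) (delta (nu c))))).

Definition reflection_datum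
    (d : 'Hom(vec k (subg_of C), vec k (subg_of C))) : Prop :=
  [/\ abelian C, (H \x C = [set: G])%g
    & hopf_isomorphism (group_alg (subg_of C)) (fun_alg (subg_of C)) d].

Definition nilpotent_hom (nu : {morphism [set: subg_of C] >-> subg_of C}) :
    Prop :=
  exists n, forall c, iter n nu c = 1%g.

Definition twisted_reflection_datum
    (d : 'Hom(vec k (subg_of C), vec k (subg_of C)))
    (nu : {morphism [set: subg_of C] >-> subg_of C}) : Prop :=
  reflection_datum d /\ nilpotent_hom nu.

Definition untwisted_reflection_map d : 'End(DG) :=
  reflection_map d (triv_morph (subg_of C) [set: subg_of C]).

End Reflections.

Arguments reflection_map H C d nu : clear implicits.
Arguments reflection_datum H C d : clear implicits.
Arguments twisted_reflection_datum H C d nu : clear implicits.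
Arguments untwisted_reflection_map H C d : clear implicits.

Definition R_set (f : 'End(DG)) : Prop :=
  exists (H C : {group G}) d,
    reflection_datum H C d /\ f = untwisted_reflection_map H C d.

Definition VcV := gen_subgroup (unionE Vc_set V_set).
Definition VcVB := gen_subgroup (unionE VcV B_set).
Definition VcVE := gen_subgroup (unionE VcV E_set).

Definition double_coset (r : 'End(DG)) : 'End(DG) -> Prop :=
  prodE (prodE VcVB (singE r)) VcVE.

End DoubleAutomorphisms.

Arguments reflection_map {k G} H C d nu.
Arguments reflection_datum {k G} H C d.
Arguments twisted_reflection_datum {k G} H C d nu.
Arguments untwisted_reflection_map {k G} H C d.
Arguments hopf_aut {k G} f.
Arguments VcVB {k G} _.
Arguments VcVE {k G} _.
Arguments V_set {k G} f.
Arguments Vc_set {k G} f.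
Arguments R_set {k G} f.
Arguments VcV {k G} _.
Arguments B_set {k G} f.
Arguments E_set {k G} f.

(* Main.v *)
(* A Hopf automorphism phi of DG is a 2x2 matrix (u b; a v) of homomorphisms:
   group-likes give phi(1 x g) = b(g) x v(g), while on k^G the span of the
   W(s) E_t, the coefficients of phi(e_x x 1) dualized, is all of kG; hence the
   orthogonal idempotents E_t are central, which forces a to factor through the
   characters of Z(G) and u to be dual to an endomorphism w of G.  If v is
   bijective, phi splits as B * diagonal * E, so (iv) and (v) amount to finding
   a reflection r for which r phi, resp. phi r, has a bijective v-component.
   With phi^-1 = (u' b'; a' v') one has v v' + a b' = 1 = v' v + a' b.  Choose a
   quasi-inverse t of v (t v t = t) with tv of maximal rank: then v is an
   isomorphism from im(tv) to im(vt), and its central complementary part is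
   radical.  Cancellation of direct factors (count homomorphisms) identifies the
   complements, and stable range 1 for endomorphisms of finite abelian groups
   provides a common complement, from which the reflection is built.  In (iv)
   the radical part makes the twist nu nilpotent, which gives (ii). *)

From HB Require Import structures.
Require Import Defs.
From mathcomp Require Import all_boot all_order all_algebra.
From mathcomp Require Import all_fingroup all_solvable all_field.

Set Implicit Arguments.
Unset Strict Implicit.
Unset Printing Implicit Defensive.

Local Open Scope group_scope.

(** * Counting homomorphisms and cancellation *)

(** [G] is not abelian, so homomorphisms into it cannot be added freely. Additive arguments survive
    because [v' v] and [v v'] differ from the identity by the values of a'b and ab', which are
    central: [1 - F], written [hom_defect F], is then again a homomorphism, and idempotents split
    [G] as a direct product. On the kernel of [v t], the identity v v' + a b' = 1 together with the
    absence of fixed points of the radical part makes the component of a b' invertible. A reflection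
    needs a splitting of [G] adapted both to this pairing and to the kernel of the idempotent. The
    two splittings given by the data need not agree, which is why a common complement is required.
    Maximality of [t] is tested against every endomorphism of [G] and not only against [v'], because
    the arguments for injectivity and for nilpotency of the twist produce test maps of their own. *)

Definition is_hom (A B : finGroupType) (f : A -> B) :=
  {morph f : x y / x * y}.

Section HomBasics.

Lemma hom1 (A B : finGroupType) (f : A -> B) : is_hom f -> f 1 = 1.
Proof. by move=> fM; apply: (mulgI (f 1)); rewrite -fM !mulg1. Qed.

Lemma homV (A B : finGroupType) (f : A -> B) :
  is_hom f -> forall x, f x^-1 = (f x)^-1.
Proof. by move=> fM x; apply: (mulgI (f x)); rewrite -fM !mulgV hom1. Qed.

Lemma hom_comp (A B C : finGroupType) (f : B -> C) (g : A -> B) :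
  is_hom f -> is_hom g -> is_hom (f \o g).
Proof. by move=> fM gM x y /=; rewrite gM fM. Qed.

Lemma hom_iter (A : finGroupType) (f : A -> A) n : is_hom f -> is_hom (iter n f).
Proof. by move=> fM; elim: n => [|n IHn] x y //=; rewrite IHn fM. Qed.

Lemma hom_inj (A B : finGroupType) (f : A -> B) :
  is_hom f -> (forall x, f x = 1 -> x = 1) -> injective f.
Proof.
move=> fM f1 x y fxy; apply/eqP; rewrite eq_mulgV1; apply/eqP/f1.
by rewrite fM homV // fxy mulgV.
Qed.

(** Two iterates coincide by pigeonhole, so the iterates of index at least [i] are periodic. The
    exponent [i.+1 * p] is positive, at least [i] and divisible by the period [p], so doubling it
    changes nothing. *)
Lemma iter_idem (T : finType) (f : T -> T) :
  exists m, 0 < m /\ forall x, iter m f (iter m f x) = iter m f x.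
Proof.
pose N := #|{ffun T -> T}|.
pose F (i : 'I_N.+1) : {ffun T -> T} := [ffun x => iter i f x].
have /injectivePn[i [j ne_ij eqF]] : ~~ injectiveb F.
  by apply/injectiveP=> /leq_card; rewrite card_ord ltnn.
wlog lt_ij : i j ne_ij eqF / i < j => [IH|].
  case: (ltngtP i j) => [lt|lt|/val_inj eq]; first exact: (IH i j).
    by apply: (IH j i) => //; rewrite eq_sym.
  by rewrite eq eqxx in ne_ij.
have FE x : iter i f x = iter j f x by move/ffunP/(_ x): eqF; rewrite !ffunE.
pose p := j - i; have p_gt0 : 0 < p by rewrite subn_gt0.
have perp n x : i <= n -> iter (n + p) f x = iter n f x.
  move=> le; have -> : n + p = (n - i) + j by rewrite /p addnBA 1?ltnW // addnC addnBAC // addnC.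
  by rewrite iterD -FE -iterD subnK.
have perq q n x : i <= n -> iter (n + q * p) f x = iter n f x.
  move=> le; elim: q => [|q IHq]; first by rewrite mul0n addn0.
  by rewrite mulSn addnCA addnC perp ?IHq // (leq_trans le) ?leq_addr.
exists (i.+1 * p)%N; split=> [|x]; first by rewrite muln_gt0.
by rewrite -iterD perq // (leq_trans (leqnSn i)) ?leq_pmulr.
Qed.

End HomBasics.

(** * Homomorphisms sorted by their kernels *)

Section Counting.

Variable gT : finGroupType.
Implicit Types (A : finGroupType) (B : {set gT}).

(** The maps are finite functions on a whole type, so that they can be counted and [A] can be
    replaced by the quotient types [coset_of N]. *)
Definition homs A B : {set {ffun A -> gT}} :=
  [set f : {ffun A -> gT} | [forall x, forall y, f (x * y) == f x * f y] && [forall x, f x \in B]].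

Lemma homsP A B (f : {ffun A -> gT}) :
  reflect (is_hom f /\ forall x, f x \in B) (f \in homs A B).
Proof.
rewrite inE; apply: (iffP andP) => [[/forallP fM /forallP fB]|[fM fB]].
  by split=> // x y; apply/eqP/(forallP (fM x)).
by split; apply/forallP=> x //; apply/forallP=> y; rewrite fM.
Qed.

Definition injhoms A B : {set {ffun A -> gT}} :=
  [set f in homs A B | injectiveb f].

Definition hom_ker A (f : {ffun A -> gT}) : {set A} := [set x | f x == 1].

Lemma homs_dprod A (H K G : {group gT}) : H \x K = G ->
  #|homs A G| = (#|homs A H| * #|homs A K|)%N.
Proof.
move=> defG; have [_ GE cHK tiHK] := dprodP defG.
have sdG := dprodWsd defG.
rewrite -cardsX.
pose mulF (p : {ffun A -> gT} * {ffun A -> gT}) := [ffun x => p.1 x * p.2 x].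
have inj : {in setX (homs A H) (homs A K) &, injective mulF}.
  move=> [f g] [f' g'] /setXP[/homsP[_ /= fH] /homsP[_ gK]].
  move=> /setXP[/homsP[_ /= fH'] /homsP[_ gK']] eqF.
  have E x : f x * g x = f' x * g' x by move/ffunP/(_ x): eqF; rewrite !ffunE.
  congr (_, _); apply/ffunP=> x.
    by rewrite -(divgrMid tiHK (fH x) (gK x)) E divgrMid.
  by rewrite -(remgrMid tiHK (fH x) (gK x)) E remgrMid.
rewrite -(card_in_imset inj); apply: eq_card => f; apply/homsP/imsetP.
  case=> fM fG.
  have inHK x : f x \in H * K by rewrite GE.
  have dM x y : divgr H K (f x * f y) = divgr H K (f x) * divgr H K (f y).
    by rewrite (divgrM (sdprod_compl sdG)) ?GE // centsC.
  have rM x y : remgr H K (f x * f y) = remgr H K (f x) * remgr H K (f y).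
    have [nsH _ _ _ _] := sdprod_context sdG.
    by rewrite (remgrM (sdprod_compl sdG)) ?GE.
  exists ([ffun x => divgr H K (f x)], [ffun x => remgr H K (f x)]).
    apply/setXP; split; apply/homsP; split=> [x y|x]; rewrite !ffunE ?fM //.
      exact: mem_divgr.
    exact: mem_remgr.
  by apply/ffunP=> x; rewrite !ffunE /= -divgr_eq.
case=> [[g h] /setXP[/homsP[/= gM gH] /homsP[hM hK]] ->]; split=> [x y|x]; rewrite !ffunE /=.
  rewrite gM hM !mulgA; congr (_ * _); rewrite -!mulgA; congr (_ * _).
  by apply/esym/(centsP cHK).
by rewrite -GE mem_mulg.
Qed.

(** The universal property of the quotient, with injectivity recording that the kernel is no larger
    than [N]. *)
Lemma card_homs_ker A B (N : {group A}) : N <| [set: A] ->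
  #|[set f in homs A B | hom_ker f == N]| = #|injhoms (coset_of N) B|.
Proof.
move=> nN.
have inN x : x \in 'N(N) by apply: (subsetP (normal_norm nN)).
pose lift (g : {ffun coset_of N -> gT}) := [ffun x => g (coset N x)].
have inj : injective lift.
  move=> g h /ffunP gh; apply/ffunP=> u; have := gh (repr u).
  by rewrite !ffunE coset_reprK.
rewrite -(card_imset _ inj); apply: eq_card => f; rewrite inE.
apply/andP/imsetP => [[/homsP[fM fB] /eqP kerf]|[g]].
  have fN x : (f x == 1) = (x \in N) by rewrite -kerf inE.
  have frep x : f (repr (coset N x)) = f x.
    have /rcosetP[y Ny ->] : repr (coset N x) \in N :* x.
      by rewrite -val_coset ?inN // mem_repr_coset.
    by rewrite fM; move: Ny; rewrite -fN => /eqP->; rewrite mul1g.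
  exists [ffun u : coset_of N => f (repr u)]; last by apply/ffunP=> x; rewrite !ffunE frep.
  rewrite inE; apply/andP; split.
    apply/homsP; split=> [u v|u]; rewrite !ffunE //.
    by rewrite -{1}(coset_reprK u) -{1}(coset_reprK v) -morphM ?inN // frep fM.
  apply/injectiveP; apply: hom_inj => [u v|u]; rewrite !ffunE.
    by rewrite -{1}(coset_reprK u) -{1}(coset_reprK v) -morphM ?inN // frep fM.
  by move/eqP; rewrite fN => Nu; rewrite -(coset_reprK u) coset_id.
rewrite inE => /andP[/homsP[gM gB] /injectiveP gI] ->; split.
  by apply/homsP; split=> [x y|x]; rewrite !ffunE // morphM ?inN.
apply/eqP/setP=> x; rewrite inE ffunE -[1](hom1 gM) (inj_eq gI).
apply/eqP/idP=> [/coset_idr|/coset_id //]; apply; exact: inN.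
Qed.

Lemma hom_ker_normal A B (f : {ffun A -> gT}) : f \in homs A B ->
  exists2 N : {group A}, N <| [set: A] & hom_ker f = N.
Proof.
move=> /homsP[fM _].
have gN : group_set (hom_ker f).
  apply/group_setP; split=> [|x y]; first by rewrite inE (hom1 fM).
  by rewrite !inE fM => /eqP-> /eqP->; rewrite mulg1.
exists (Group gN) => //; apply/normalP; split; rewrite ?subsetT // => y _.
apply/setP=> x; rewrite mem_conjg !inE /conjg invgK !fM homV //.
by rewrite mulgA -eq_mulgV1 -{2}[f y]mulg1 (inj_eq (mulgI _)).
Qed.

End Counting.

(** * Cancellation of direct factors *)

Section Cancellation.

Lemma card_homs_kers (gT A : finGroupType) (B : {set gT}) :
  #|homs A B| = (#|injhoms A B| +
     \sum_(N : {set A} | N != 1%g) #|[set f in homs A B | hom_ker f == N]|)%N.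
Proof.
rewrite -sum1_card (partition_big (@hom_ker gT A) predT) //= (bigD1 1) //=.
congr (_ + _)%N; last first.
  by apply: eq_bigr => N _; rewrite -sum1_card; apply: eq_bigl => f; rewrite !inE.
rewrite sum1_card; apply: eq_card => f; rewrite [RHS]inE unfold_in /=.
case: homsP => //= -[fM _]; apply/eqP/injectiveP=> [kf|fI].
  apply: hom_inj => // x fx; have : x \in hom_ker f by rewrite inE fx.
  by rewrite kf => /set1P.
apply/setP=> x; rewrite !inE -(hom1 fM); exact: inj_eq.
Qed.

(** Lovasz's counting argument. Homomorphisms with a nontrivial kernel are injective homomorphisms
    from proper quotients, equinumerous by induction; subtracting them from equal totals leaves
    equally many injective ones. *)
Lemma eq_card_injhoms (gT1 gT2 : finGroupType) (B1 : {set gT1}) (B2 : {set gT2}) :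
  (forall A : finGroupType, #|homs A B1| = #|homs A B2|) ->
  forall A : finGroupType, #|injhoms A B1| = #|injhoms A B2|.
Proof.
move=> eqB A; have [n] := ubnP #|A|; elim: n A => // n IHn A ltAn.
apply: (@addIn (\sum_(N : {set A} | N != 1%g)
                 #|[set f in homs A B1 | hom_ker f == N]|)).
rewrite -card_homs_kers eqB card_homs_kers; congr (_ + _)%N.
apply: eq_bigr => N N1.
have normalN (gT : finGroupType) (B : {set gT}) f :
    f \in [set f in homs A B | hom_ker f == N] ->
  #|[set f in homs A B1 | hom_ker f == N]| =
  #|[set f in homs A B2 | hom_ker f == N]|.
  rewrite inE => /andP[/hom_ker_normal[M nM kf] /eqP kN].
  rewrite -kN kf !card_homs_ker //; apply/IHn.
  rewrite -ltnS (leq_trans _ ltAn) // ltnS -cardsT -(cardsT A) -quotientT.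
  by apply: ltn_quotient; rewrite ?subsetT // -kf kN.
(* [N] ranges over all subsets. If it is the kernel of a homomorphism on either side, it is normal
   and the quotient comparison applies; otherwise both classes are empty. *)
have [E1|[f /normalN //]] := set_0Vmem [set f in homs A B1 | hom_ker f == N].
have [E2|[f /normalN //]] := set_0Vmem [set f in homs A B2 | hom_ker f == N].
by rewrite E1 E2 !cards0.
Qed.

Lemma leq_homs_isog (gT1 gT2 A : finGroupType) (G1 : {group gT1}) (G2 : {group gT2}) :
  G1 \isog G2 -> #|homs A G1| <= #|homs A G2|.
Proof.
case/isogP=> phi injphi phiG.
pose F (f : {ffun A -> gT1}) := [ffun x => phi (f x)].
have injF : {in homs A G1 &, injective F}.
  move=> f g /homsP[_ fG] /homsP[_ gG] /ffunP eqF; apply/ffunP=> x.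
  by apply: (injmP injphi) => //; move: (eqF x); rewrite !ffunE.
rewrite -(card_in_imset injF); apply/subset_leq_card/subsetP=> _ /imsetP[f + ->].
move=> /homsP[fM fG]; apply/homsP; split=> [x y|x]; rewrite !ffunE.
  by rewrite fM morphM.
by rewrite -phiG mem_morphim.
Qed.

Lemma card_homs_isog (gT1 gT2 A : finGroupType) (G1 : {group gT1}) (G2 : {group gT2}) :
  G1 \isog G2 -> #|homs A G1| = #|homs A G2|.
Proof.
by move=> iso; apply/eqP; rewrite eqn_leq !leq_homs_isog // isog_sym.
Qed.

Lemma injhom_isog (gT A : finGroupType) (K : {group gT}) (f : A -> gT) :
  is_hom f -> (forall x, f x \in K) -> injective f -> #|A| = #|K| ->
  [set: A] \isog K.
Proof.
move=> fM fK fI cardK; apply/isogP; exists (Morphism (D := [set: A]) (in2W fM)).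
  by apply/injmP=> x y _ _ /= /fI.
apply/eqP; rewrite eqEcard card_injm ?cardsT ?cardK ?leqnn ?andbT //.
  by apply/subsetP=> _ /morphimP[x _ _ ->]; apply: fK.
by apply/injmP=> x y _ _ /= /fI.
Qed.

(** The inclusion of [K1] into itself is counted as an injective homomorphism, so one from [K1] into
    [K2] exists too; it is onto by cardinality. *)
Lemma isog_card_homs (gT1 gT2 : finGroupType) (K1 : {group gT1}) (K2 : {group gT2}) :
  #|K1| = #|K2| ->
  (forall A : finGroupType, #|homs A K1| = #|homs A K2|) -> K1 \isog K2.
Proof.
move=> eqK /eq_card_injhoms/(_ (subg_of K1)) eqI.
have : 0 < #|injhoms (subg_of K1) K1|.
  apply/card_gt0P; exists [ffun x => sgval x]; rewrite inE; apply/andP; split.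
    by apply/homsP; split=> [x y|x]; rewrite !ffunE //; apply: subgP.
  by apply/injectiveP=> x y; rewrite !ffunE => /val_inj.
rewrite eqI => /card_gt0P[f]; rewrite inE => /andP[/homsP[fM fK] /injectiveP fI].
apply: (isog_trans (isog_subg K1)); apply: (injhom_isog fM fK fI).
by rewrite -eqK (card_isog (isog_subg K1)) cardsT.
Qed.

(** The number of homomorphisms into [K] is the number into [G] divided by the number into [H],
    which is nonzero thanks to the trivial homomorphism. It is therefore the same on both sides, for
    every source [A]. *)
Lemma dprod_cancel (gT1 gT2 : finGroupType) (H1 K1 G1 : {group gT1})
    (H2 K2 G2 : {group gT2}) :
  H1 \x K1 = G1 -> H2 \x K2 = G2 -> G1 \isog G2 -> H1 \isog H2 ->
  K1 \isog K2.
Proof.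
move=> def1 def2 isoG isoH; apply: isog_card_homs => [|A].
  apply/eqP; rewrite -(eqn_pmul2l (cardG_gt0 H1)) (dprod_card def1).
  by rewrite (card_isog isoH) (dprod_card def2) (card_isog isoG).
have posH : 0 < #|homs A H1|.
  apply/card_gt0P; exists [ffun=> 1]; apply/homsP; split=> [x y|x]; rewrite !ffunE ?mulg1 //.
apply/eqP; rewrite -(eqn_pmul2l posH) -(homs_dprod A def1).
by rewrite (card_homs_isog A isoH) -(homs_dprod A def2) (card_homs_isog A isoG).
Qed.

End Cancellation.

(** * Central homomorphisms and quasi-inverses *)

Section CentralHoms.

Variable G : finGroupType.
Local Notation Z := ('Z([set: G])).

Lemma centerTP (z : G) : reflect (forall x, z * x = x * z) (z \in Z).
Proof.
apply: (iffP (centerP _ _)) => [[_ zc] x|zc]; first by apply: zc.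
by split=> // x _; apply: zc.
Qed.

Lemma centerTC (z x : G) : z \in Z -> z * x = x * z.
Proof. by move/centerTP. Qed.

(** The map [1 - F] in multiplicative notation; it is a homomorphism as soon as its values are
    central. *)
Definition hom_defect (F : G -> G) x := x * (F x)^-1.

Lemma hom_defectM F : is_hom F -> (forall x, hom_defect F x \in Z) ->
  is_hom (hom_defect F).
Proof.
move=> FM FZ x y; rewrite {1}/hom_defect FM invMg !mulgA -(mulgA x).
by rewrite -/(hom_defect F y) -(mulgA x) (centerTC _ (FZ y)) !mulgA.
Qed.

Lemma hom_defectK F x : hom_defect F x * F x = x.
Proof. by rewrite mulgKV. Qed.

(** The factorization of [x] into [(1 - F) x] and [F x] gives the two components. On the kernel of
    [F] the map [1 - F] is the identity, so the kernel is central. *)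
Lemma idem_dprod (F : G -> G) : is_hom F -> (forall x, F (F x) = F x) ->
  (forall x, hom_defect F x \in Z) ->
  exists I K : {group G}, [/\ I \x K = [set: G],
     forall x, (x \in I) = (F x == x) & forall x, (x \in K) = (F x == 1)].
Proof.
move=> FM FF FZ.
have gI : group_set [set x | F x == x].
  apply/group_setP; split=> [|x y]; first by rewrite inE (hom1 FM).
  by rewrite !inE FM => /eqP-> /eqP->.
have gK : group_set [set x | F x == 1].
  apply/group_setP; split=> [|x y]; first by rewrite inE (hom1 FM).
  by rewrite !inE FM => /eqP-> /eqP->; rewrite mulg1.
exists (Group gI), (Group gK); split=> [|x|x]; rewrite ?inE //.
have cKI : [set x | F x == 1] \subset 'C([set x | F x == x]).
  apply/centsP=> x; rewrite inE => /eqP Fx y _.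
  have := FZ x; rewrite /hom_defect Fx invg1 mulg1 => xZ; exact: centerTC.
have tiIK : [set x | F x == x] :&: [set x | F x == 1] = 1.
  apply/setP=> x; rewrite !inE; apply/andP/eqP=> [[/eqP Fx /eqP F1]|->].
    by rewrite -Fx F1.
  by rewrite (hom1 FM) eqxx.
rewrite dprodE //=.
apply/setP=> x; rewrite [RHS]inE; apply/mulsgP.
exists (F x) (hom_defect F x); first by rewrite inE FF.
  by rewrite inE FM homV // FF mulgV.
by rewrite -(centerTC _ (FZ x)) hom_defectK.
Qed.

End CentralHoms.

(** * Quasi-inverses of maximal rank *)

Section QuasiInverse.

Variables (G : finGroupType) (v : G -> G).
Hypothesis vM : is_hom v.
Local Notation Z := ('Z([set: G])).

(** Only [t v t = t] is asked for. The difference between [v] and [v t v] is the part of [v] that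
    the reflections have to deal with; the central defects let both idempotents split [G]. *)
Definition quasi_inv (t : G -> G) :=
  [/\ is_hom t, forall x, t (v (t x)) = t x,
      forall x, hom_defect (t \o v) x \in Z & forall x, hom_defect (v \o t) x \in Z].

(* The part of v complementary to t lies in the radical: composing it with any
   homomorphism leaves no nontrivial fixed point. *)
Definition maximal_quasi_inv (t : G -> G) := forall th : G -> G, is_hom th ->
  forall x, t (v x) = 1 -> hom_defect (t \o v) (th (v x)) = x -> x = 1.

(** Telescoping: 1 - F^(n+1) = (1 - F) F^n + (1 - F^n). *)
Lemma hom_defect_iter (F : G -> G) n x : is_hom F ->
  (forall x, hom_defect F x \in Z) -> hom_defect (iter n F) x \in Z.
Proof.
move=> FM FZ; elim: n => [|n IHn]; first by rewrite /hom_defect mulgV group1.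
have -> : hom_defect (iter n.+1 F) x = hom_defect F (iter n F x) * hom_defect (iter n F) x.
  by rewrite (centerTC _ (FZ _)) /hom_defect /= mulgA mulgKV.
by rewrite groupM.
Qed.

Lemma quasi_inv_exists (v' : G -> G) : is_hom v' ->
  (forall x, hom_defect (v' \o v) x \in Z) ->
  (forall x, hom_defect (v \o v') x \in Z) -> exists t, quasi_inv t.
Proof.
move=> v'M Z1 Z2; pose f := v' \o v.
have fM : is_hom f by apply: hom_comp.
have [m1 [m1_gt0]] := iter_idem f; case: m1 m1_gt0 => // m _ idem.
(* The exponent is [2m + 1]: then [t v = f^(2m+2) = f^(m+1)] is idempotent, and it fixes
   [t = f^(m+1) f^m v']. *)
pose t := iter (m + m.+1) f \o v'.
have tv x : t (v x) = iter m.+1 f x.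
  by rewrite /t /= -[v' (v x)]/(f x) -iterSr -addSn iterD idem.
have vt n x : v (iter n f (v' x)) = iter n.+1 (v \o v') x.
  by elim: n x => // n IHn x; rewrite [RHS]iterS -IHn.
exists t; split.
- by apply: hom_comp; first apply: hom_iter.
- by move=> x; rewrite tv [t x]/(iter (m + m.+1) f (v' x)) -iterD addnCA iterD (iterD m.+1) idem -iterD.
- move=> x; have -> : hom_defect (t \o v) x = hom_defect (iter m.+1 f) x.
    by rewrite /hom_defect -tv.
  exact: hom_defect_iter.
move=> x; have -> : hom_defect (v \o t) x = hom_defect (iter (m + m.+1).+1 (v \o v')) x.
  by rewrite /hom_defect -vt.
by apply: hom_defect_iter => //; apply: hom_comp.
Qed.

Section Facts.

Variable t : G -> G.
Hypothesis qt : quasi_inv t.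

Let tM : is_hom t. Proof. by case: qt. Qed.
Let tvt x : t (v (t x)) = t x. Proof. by case: qt. Qed.

Lemma qi_e'Z x : hom_defect (t \o v) x \in Z. Proof. by case: qt. Qed.
Lemma qi_eZ x : hom_defect (v \o t) x \in Z. Proof. by case: qt. Qed.

Lemma qi_e'M : is_hom (hom_defect (t \o v)).
Proof. by apply: hom_defectM; [apply: hom_comp|apply: qi_e'Z]. Qed.

Lemma qi_eM : is_hom (hom_defect (v \o t)).
Proof. by apply: hom_defectM; [apply: hom_comp|apply: qi_eZ]. Qed.

Lemma qi_tve' x : t (v (hom_defect (t \o v) x)) = 1.
Proof. by rewrite vM homV // tM homV //= tvt mulgV. Qed.

Lemma qi_ev x : hom_defect (v \o t) (v x) = v (hom_defect (t \o v) x).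
Proof. by rewrite vM homV. Qed.

Lemma qi_et x : hom_defect (t \o v) (t x) = 1.
Proof. by rewrite /hom_defect /= tvt mulgV. Qed.

Lemma qi_e'id x : t (v x) = 1 -> hom_defect (t \o v) x = x.
Proof. by move=> tvx; rewrite /hom_defect /= tvx invg1 mulg1. Qed.

(** A nontrivial fixed point permits a larger idempotent. A quasi-inverse [g] of the residual part
    of [v] is built by the same iteration as in [quasi_inv_exists] and added to [t]. The idempotents
    [t v] and [g v] are orthogonal, so [t + g] is again a quasi-inverse. *)
Lemma qi_improve th x0 : is_hom th -> t (v x0) = 1 ->
  hom_defect (t \o v) (th (v x0)) = x0 -> x0 != 1 ->
  exists2 t', quasi_inv t' & #|[set t (v x) | x : G]| < #|[set t' (v x) | x : G]|.
Proof.
move=> thM tvx0 fx0 nt_x0.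
pose e' := hom_defect (t \o v); pose e := hom_defect (v \o t).
have e'M : is_hom e' := qi_e'M; have eM : is_hom e := qi_eM.
pose f x := e' (th (e (v x))).
have fM : is_hom f by move=> x y; rewrite /f vM eM thM e'M.
have [m1 [m1_gt0]] := iter_idem f; case: m1 m1_gt0 => // m _ idem.
pose h x := e' (th (e x)).
have hM : is_hom h by move=> x y; rewrite /h eM thM e'M.
pose g x := iter (m + m.+1) f (h x).
have gM : is_hom g by move=> x y; rewrite /g hM hom_iter.
have tvg x : t (v (g x)) = 1.
  by rewrite /g; case: (m + m.+1) => [|n] /=; apply: qi_tve'.
have gZ x : g x \in Z by rewrite -(qi_e'id (tvg x)) qi_e'Z.
have vgZ x : v (g x) \in Z by rewrite -(qi_e'id (tvg x)) -qi_ev qi_eZ.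
pose P := iter m.+1 f; have PM : is_hom P by apply: hom_iter.
have gv x : g (v x) = P x.
  by rewrite /g -[h (v x)]/(f x) -iterSr -addSn iterD idem.
have ft x : f (t x) = 1.
  by rewrite /f /e qi_ev qi_et (hom1 vM) (hom1 thM) (hom1 e'M).
have Pt x : P (t x) = 1.
  by rewrite /P iterSr ft hom1 //; apply: hom_iter.
have Pg x : P (g x) = g x.
  by rewrite /g /P -iterD addnCA iterD (iterD m.+1) idem -iterD.
pose t' x := t x * g x.
have t'v x : t' (v x) = t (v x) * P x by rewrite /t' gv.
exists t'; first split.
- by move=> x y; rewrite /t' tM gM !mulgA -[t x * g x * _]mulgA (centerTC _ (gZ x)) !mulgA.
- by move=> x; rewrite t'v !(vM, tM, PM) tvt tvg mulg1 Pt mul1g Pg.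
- move=> x; rewrite /hom_defect (t'v x : (t' \o v) x = _) invMg mulgA (_ : x * _ = (P x)^-1 * x).
    rewrite -mulgA; apply: groupM; last exact: (qi_e'Z x).
    by rewrite groupV -gv.
  by rewrite -gv -centerTC ?groupV.
- move=> x; rewrite /hom_defect (vM _ _ : (v \o t') x = _) invMg mulgA (_ : x * _ = (v (g x))^-1 * x).
    rewrite -mulgA; apply: groupM; last exact: (qi_eZ x).
    by rewrite groupV.
  by rewrite -centerTC ?groupV.
apply: proper_card; apply/properP; split.
  apply/subsetP=> _ /imsetP[x _ ->]; apply/imsetP; exists (t (v x)) => //.
  by rewrite t'v Pt mulg1 tvt.
(* [x0] is fixed by [P] and therefore lies in the new image; being nontrivial and killed by [t v],
   it is not in the old one. *)
have fE : f x0 = x0.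
  by rewrite /f /e qi_ev (qi_e'id tvx0).
exists x0.
  apply/imsetP; exists x0 => //; rewrite t'v tvx0 mul1g /P.
  by elim: (m.+1) => //= n <-.
apply/imsetP=> -[x _ x0E]; case/eqP: nt_x0.
by rewrite -tvx0 {2}x0E tvt -x0E.
Qed.

End Facts.

Lemma maximal_quasi_inv_exists t0 : quasi_inv t0 ->
  exists2 t, quasi_inv t & maximal_quasi_inv t.
Proof.
have [n] := ubnP (#|G| - #|[set t0 (v x) | x : G]|).
elim: n t0 => // n IHn t lt_n qt.
(* Endomorphisms are quantified as finite functions, which makes failure of maximality decidable.
   Each failure enlarges the image of [t v], bounded by [G]. *)
pose bad (th : {ffun G -> G}) x := [&& [forall y, forall z, th (y * z) == th y * th z],
  t (v x) == 1, hom_defect (t \o v) (th (v x)) == x & x != 1].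
have [/existsP[th /existsP[x /and4P[thM /eqP tvx /eqP fx x1]]]|good] :=
    boolP [exists th, exists x, bad th x].
  have {}thM : is_hom th by move=> y z; apply/eqP/(forallP (forallP thM y)).
  have [t' qt' lt_t] := qi_improve qt thM tvx fx x1.
  apply: (IHn t') => //; rewrite -ltnS (leq_trans _ lt_n) // ltnS ltn_sub2l //.
  exact: leq_trans lt_t (max_card _).
exists t => // th thM x tvx fx; apply/eqP; apply: contraR good => x1.
apply/existsP; exists [ffun y => th y]; apply/existsP; exists x.
rewrite /bad tvx eqxx x1 ffunE fx eqxx !andbT /=.
by apply/forallP=> y; apply/forallP=> z; rewrite !ffunE thM.
Qed.

End QuasiInverse.

(** * Stable range *)

Lemma abelianTC (A : finGroupType) : abelian [set: A] -> forall x y : A, x * y = y * x.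
Proof. by move=> /centsP abA x y; apply: abA. Qed.

Lemma abelianTZ (A : finGroupType) : abelian [set: A] -> forall x : A, x \in 'Z([set: A]).
Proof. by move=> abA x; apply/centerTP=> y; apply: abelianTC. Qed.

Lemma abelianTCA (A : finGroupType) : abelian [set: A] ->
  forall x y z w : A, x * y * (z * w) = x * z * (y * w).
Proof.
by move=> abA x y z w; rewrite -!mulgA; congr (_ * _); rewrite !mulgA (abelianTC abA y).
Qed.

Lemma abelianTV (A : finGroupType) : abelian [set: A] ->
  forall x y : A, (x * y)^-1 = x^-1 * y^-1.
Proof. by move=> abA x y; rewrite invMg (abelianTC abA). Qed.

Lemma central_homM (A G : finGroupType) (f g : A -> G) :
  is_hom f -> is_hom g -> (forall x, g x \in 'Z([set: G])) ->
  is_hom (fun x => f x * g x).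
Proof.
move=> fM gM gZ x y; rewrite fM gM -!mulgA; congr (_ * _).
by rewrite !mulgA (centerTC _ (gZ x)).
Qed.

Lemma central_homV (A G : finGroupType) (g : A -> G) :
  is_hom g -> (forall x, g x \in 'Z([set: G])) -> is_hom (fun x => (g x)^-1).
Proof. by move=> gM gZ x y; rewrite gM invMg -centerTC // groupV gZ. Qed.

(** Injections in both directions between finite groups force equal cardinalities, so [f] already
    maps [I] onto [J]. *)
Lemma mutual_isog (X Y : finGroupType) (I : {group X}) (J : {group Y})
    (f : X -> Y) (g : Y -> X) : is_hom f -> is_hom g ->
  (forall x, x \in I -> f x \in J) -> (forall y, y \in J -> g y \in I) ->
  (forall x, x \in I -> f x = 1 -> x = 1) ->
  (forall y, y \in J -> g y = 1 -> y = 1) -> I \isog J.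
Proof.
move=> fM gM fI gJ f1 g1.
have fI2 : {in I &, {morph f : x y / x * y}} by move=> x y _ _; apply: fM.
have gJ2 : {in J &, {morph g : x y / x * y}} by move=> x y _ _; apply: gM.
pose phi := Morphism fI2; pose psi := Morphism gJ2.
have injphi : 'injm phi.
  by apply/subsetP=> x /morphpreP[Ix /set1P /= fx]; apply/set1P/f1.
have injpsi : 'injm psi.
  by apply/subsetP=> x /morphpreP[Ix /set1P /= fx]; apply/set1P/g1.
apply/isogP; exists phi => //; apply/eqP; rewrite eqEcard card_injm //.
apply/andP; split; first by apply/subsetP=> _ /morphimP[x _ Ix ->]; apply: fI.
rewrite -(card_injm injpsi) //; apply/subset_leq_card/subsetP.
by move=> _ /morphimP[x _ Ix ->]; apply: gJ.
Qed.

Section GeometricSum.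

Variables (X : finGroupType) (f : X -> X).
Hypotheses (abX : abelian [set: X]) (fM : is_hom f).

(** The endomorphism 1 + f + ... + f^(n-1), in Horner form. *)
Fixpoint geom_sum n x := if n is n'.+1 then x * f (geom_sum n' x) else 1.

Lemma geom_sumM n : is_hom (geom_sum n).
Proof.
elim: n => [|n IHn] x y /=; first by rewrite mulg1.
by rewrite IHn fM -!mulgA; congr (_ * _); rewrite !mulgA (abelianTC abX y).
Qed.

Lemma geom_sumE n x : geom_sum n x * iter n f x = x * f (geom_sum n x).
Proof.
elim: n => [|n IHn] /=; first by rewrite (hom1 fM) mulg1 mul1g.
by rewrite -mulgA -fM IHn.
Qed.

(** (1 - f)(1 + f + ... + f^(n-1)) = 1 - f^n. It makes every multiple of the Fitting projection 1 -
    F, with F an idempotent iterate of f, a multiple of 1 - f. *)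
Lemma hom_defect_geom_sum n x : hom_defect f (geom_sum n x) = hom_defect (iter n f) x.
Proof.
apply: (mulIg (f (geom_sum n x))); rewrite hom_defectK.
apply: (mulIg (iter n f x)); rewrite geom_sumE /hom_defect.
by rewrite -!mulgA; congr (_ * _); rewrite (abelianTC abX (f _)) mulKg.
Qed.

Lemma geom_sum_comm n x : f (geom_sum n x) = geom_sum n (f x).
Proof. by elim: n => [|n IHn] /=; rewrite ?hom1 // fM IHn. Qed.

Lemma geom_sum_hom_defect n x : geom_sum n (hom_defect f x) = hom_defect (iter n f) x.
Proof.
rewrite -hom_defect_geom_sum /hom_defect geom_sumM (homV (@geom_sumM n)).
by rewrite geom_sum_comm.
Qed.

End GeometricSum.

Lemma hom_prod_iter (X Y : finType) (f : X -> X) (g : Y -> Y) n p :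
  iter n (fun p : X * Y => (f p.1, g p.2)) p = (iter n f p.1, iter n g p.2).
Proof. by case: p => x y; elim: n => // n IHn; rewrite iterS IHn. Qed.

(** The map is the given isomorphism precomposed with the projection 1 - F onto [K]. *)
Lemma extend_kernel_iso (X Y : finGroupType) (F : X -> X) (K : {group X}) (L : {group Y}) :
  is_hom (hom_defect F) -> (forall x, hom_defect F x \in K) -> (forall x, x \in K -> F x = 1) ->
  K \isog L ->
  exists th : X -> Y, [/\ is_hom th, forall x, th x \in L,
    forall x, th (hom_defect F x) = th x & forall x, x \in K -> th x = 1 -> x = 1].
Proof.
move=> dM dK FK /isogP[phi /injmP injphi phiK].
have dKid x : x \in K -> hom_defect F x = x.
  by move=> /FK Fx; rewrite /hom_defect Fx invg1 mulg1.
exists (fun x => phi (hom_defect F x)); split.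
- by move=> x y; rewrite dM morphM.
- by move=> x; rewrite -phiK mem_morphim.
- by move=> x; rewrite (dKid (hom_defect F x)).
move=> x Kx; rewrite dKid // -(morph1 phi); exact: injphi.
Qed.

(* End(X) has stable range 1: from al be + (1 - al be) = 1 one gets units
   al + (1 - al be) y and be + y (1 - al be); the y are built from an isomorphism
   between the Fitting-null components of al be and be al. *)
Lemma stable_range (X Y : finGroupType) (al : Y -> X) (be : X -> Y) :
  abelian [set: X] -> abelian [set: Y] -> [set: X] \isog [set: Y] ->
  is_hom al -> is_hom be ->
  (exists2 y : Y -> X, is_hom y &
     injective (fun c => al c * hom_defect (al \o be) (y c))) /\
  (exists2 y : X -> Y, is_hom y &
     injective (fun x => be x * y (hom_defect (al \o be) x))).
Proof.
move=> abX abY isoXY alM beM.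
pose f := al \o be; pose f' := be \o al.
have fM : is_hom f by apply: hom_comp.
have f'M : is_hom f' by apply: hom_comp.
(* Iterating the product map yields one exponent that suits both [f] and [f']. *)
have [m [m_gt0 idem]] := iter_idem (fun p : X * Y => (f p.1, f' p.2)).
pose F := iter m f; pose F' := iter m f'.
have FF x : F (F x) = F x.
  by have := idem (x, 1); rewrite !hom_prod_iter => -[].
have FF' x : F' (F' x) = F' x.
  by have := idem (1, x); rewrite !hom_prod_iter => -[].
have FM : is_hom F by apply: hom_iter.
have F'M : is_hom F' by apply: hom_iter.
have alF c : al (F' c) = F (al c).
  by rewrite /F /F'; elim: m {m_gt0 idem F F' FF FF' FM F'M} => // n IHn; rewrite !iterS -IHn.
have beF x : be (F x) = F' (be x).
  by rewrite /F /F'; elim: m {m_gt0 idem F F' FF FF' FM F'M alF} => // n IHn; rewrite !iterS -IHn.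
have be1 x : be x = 1 -> F x = 1.
  rewrite /F; case: m m_gt0 {idem F F' FF FF' FM F'M alF beF} => // m _ bex.
  by rewrite iterSr /f /= bex (hom1 alM) (hom1 (hom_iter m fM)).
have al1 c : al c = 1 -> F' c = 1.
  rewrite /F'; case: m m_gt0 {idem F F' FF FF' FM F'M alF beF be1} => // m _ alc.
  by rewrite iterSr /f' /= alc (hom1 beM) (hom1 (hom_iter m f'M)).
have FZ x : hom_defect F x \in 'Z([set: X]) by apply: abelianTZ.
have F'Z x : hom_defect F' x \in 'Z([set: Y]) by apply: abelianTZ.
have dM := hom_defectM FM FZ; have d'M := hom_defectM F'M F'Z.
have [I [K [defX IE KE]]] := idem_dprod FM FF FZ.
have [I' [K' [defY I'E K'E]]] := idem_dprod F'M FF' F'Z.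
(* [be] and [al] exchange the images of [F] and [F'], and are injective there because whatever they
   kill is killed by these idempotents. *)
have isoI : I \isog I'.
  apply: (mutual_isog beM alM) => [x|y|x|y].
  - by rewrite IE I'E -beF => /eqP->.
  - by rewrite IE I'E -alF => /eqP->.
  - by rewrite IE => /eqP Fx /be1; rewrite Fx.
  by rewrite I'E => /eqP Fx /al1; rewrite Fx.
have isoK : K \isog K' := dprod_cancel defX defY isoXY isoI.
have dK x : hom_defect F x \in K by rewrite KE /hom_defect FM homV // FF mulgV.
have d'K x : hom_defect F' x \in K' by rewrite K'E /hom_defect F'M homV // FF' mulgV.
have FK x : x \in K -> F x = 1 by rewrite KE => /eqP.
have F'K x : x \in K' -> F' x = 1 by rewrite K'E => /eqP.
have dd x : hom_defect F (hom_defect F x) = hom_defect F x.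
  by rewrite {1}/hom_defect (FK _ (dK x)) invg1 mulg1.
have dd' x : hom_defect F' (hom_defect F' x) = hom_defect F' x.
  by rewrite {1}/hom_defect (F'K _ (d'K x)) invg1 mulg1.
split.
  have [th [thM thK thd th1]] := extend_kernel_iso d'M d'K F'K (isog_symr isoK).
  (* The subtracted term is chosen so that al + (1 - F) y0 = al F' + th, which is injective on each
     Fitting component. The geometric sum turns 1 - F into 1 - f. *)
  pose y0 c := th c * (al (hom_defect F' c))^-1.
  have y0M : is_hom y0.
    by move=> c d; rewrite /y0 thM d'M alM (abelianTV abX) abelianTCA.
  exists (fun c => geom_sum f m (y0 c)).
    by move=> c d; rewrite y0M geom_sumM.
  have valE c : al c * hom_defect f (geom_sum f m (y0 c)) = al (F' c) * th c.
    rewrite hom_defect_geom_sum // -/F /y0 dM homV //.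
    have -> : hom_defect F (th c) = th c by rewrite /hom_defect FK // invg1 mulg1.
    have -> : hom_defect F (al (hom_defect F' c)) = al (hom_defect F' c).
      by rewrite {1}/hom_defect -alF F'K // (hom1 alM) invg1 mulg1.
    rewrite -{1}(hom_defectK F' c) alM (abelianTC abX (al _)) -mulgA; congr (_ * _).
    by rewrite (abelianTC abX (th c)) mulKVg.
  apply: hom_inj => [c d|c].
    by rewrite !valE F'M alM thM abelianTCA.
  rewrite valE => eq1.
  have : F (al (F' c) * th c) = 1 by rewrite eq1 (hom1 FM).
  rewrite FM -alF FF' (FK _ (thK c)) mulg1 => /al1; rewrite FF' => F'c.
  move: eq1; rewrite F'c (hom1 alM) mul1g; apply: th1; by rewrite K'E F'c.
have [th [thM thK thd th1]] := extend_kernel_iso dM dK FK isoK.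
(* Mirror image of the previous choice: be + y0 (1 - F) = be F + th. *)
pose y0 x := th x * (be (hom_defect F x))^-1.
have y0M : is_hom y0.
  by move=> c d; rewrite /y0 thM dM beM (abelianTV abY) abelianTCA.
exists (fun x => y0 (geom_sum f m x)).
  by move=> c d; rewrite geom_sumM ?y0M.
have valE x : be x * y0 (geom_sum f m (hom_defect f x)) = be (F x) * th x.
  rewrite geom_sum_hom_defect // -/F /y0 thd dd.
  rewrite -{1}(hom_defectK F x) beM (abelianTC abY (be _)) -mulgA; congr (_ * _).
  by rewrite (abelianTC abY (th x)) mulKVg.
apply: hom_inj => [c d|c].
  by rewrite !valE FM beM thM abelianTCA.
rewrite valE => eq1.
have : F' (be (F c) * th c) = 1 by rewrite eq1 (hom1 F'M).
rewrite F'M -beF FF (F'K _ (thK c)) mulg1 => /be1; rewrite FF => Fc.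
move: eq1; rewrite Fc (hom1 beM) mul1g; apply: th1; by rewrite KE Fc.
Qed.

(** The kernel of [s] complements the images of both [i] and [j]; dually the image of [i2]
    complements the kernels of both [p] and [q]. With al = qi and be = pj, take s = p + z(q - qip)
    and i2 = i + (j - ipj)y. The corrections vanish on the image of i, respectively under p, while
    sj and q i2 become the two units of the stable range. *)
Lemma common_complement (G X Y : finGroupType) (p : G -> Y) (i : Y -> G)
    (q : G -> X) (j : X -> G) :
  abelian [set: X] -> abelian [set: Y] -> [set: X] \isog [set: Y] ->
  is_hom p -> is_hom i -> is_hom q -> is_hom j ->
  (forall c, i c \in 'Z([set: G])) -> (forall x, j x \in 'Z([set: G])) ->
  (forall c, p (i c) = c) -> (forall x, q (j x) = x) ->
  (exists s : G -> Y, [/\ is_hom s, forall c, s (i c) = c & injective (s \o j)]) /\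
  (exists i2 : Y -> G, [/\ is_hom i2, forall c, i2 c \in 'Z([set: G]),
     forall c, p (i2 c) = c & injective (q \o i2)]).
Proof.
move=> abX abY isoXY pM iM qM jM iZ jZ piK qjK.
have alM : is_hom (q \o i) by apply: hom_comp.
have beM : is_hom (p \o j) by apply: hom_comp.
have [[y yM yI] [z zM zI]] := stable_range abX abY isoXY alM beM.
split.
  exists (fun g => p g * z (q g * (q (i (p g)))^-1)); split.
  - move=> g h; rewrite qM pM iM qM (abelianTV abX) (abelianTCA abX) zM.
    by rewrite abelianTCA.
  - by move=> c; rewrite piK mulgV (hom1 zM) mulg1.
  by move=> x x' /=; rewrite !qjK => /zI.
pose u c := (i (p (j (y c))))^-1.
have uZ c : u c \in 'Z([set: G]) by rewrite groupV; apply: iZ.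
have uM : is_hom u by apply: central_homV => [c d|c]; rewrite ?yM ?jM ?pM ?iM.
have vM : is_hom (fun c => j (y c) * u c).
  by apply: central_homM => // c d; rewrite yM jM.
exists (fun c => i c * (j (y c) * u c)); split.
- by apply: central_homM => // c; rewrite groupM //; apply: jZ.
- by move=> c; rewrite !groupM.
- by move=> c; rewrite !pM /u homV // !piK mulgV mulg1.
by move=> c c' /=; rewrite !qM !qjK !(homV qM) => /yI.
Qed.

Import GRing.Theory.
Local Close Scope group_scope.
Local Open Scope ring_scope.

(** * Characters of finite abelian groups *)

Section CharacterTheory.

Variable k : closedFieldType.
Hypothesis char0 : [pchar k] =i pred0.

Lemma natr_neq0 n : (0 < n)%N -> n%:R != 0 :> k.
Proof. by move/pcharf0P: char0 => ->; case: n. Qed.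

(** In characteristic zero ['X^n - 1] is separable; its [n] distinct roots include a primitive
    one. *)
Lemma prim_root_exists n : (0 < n)%N -> exists z : k, n.-primitive_root z.
Proof.
move=> n_gt0; pose p : {poly k} := 'X^n - 1.
have [r Dp] := closed_field_poly_normal p.
have monp : p \is monic by apply: monicXnsubC.
rewrite (monicP monp) scale1r in Dp.
have rn1 : all n.-unity_root r.
  by apply/allP=> z; rewrite -root_prod_XsubC -Dp.
have sz_r : (n < (size r).+1)%N.
  by rewrite -(size_prod_XsubC r id) -Dp size_XnsubC.
have [|z] := hasP (has_prim_root n_gt0 rn1 _ sz_r); last by exists z.
rewrite -separable_prod_XsubC -Dp separable_Xn_sub_1 //.
exact: natr_neq0.
Qed.

(** Discrete logarithm to base [x]; outside [<[x]>] it takes the default value [#[x]]. *)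
Definition cyc_log (A : finGroupType) (x u : A) : nat :=
  index u (mkseq (fun i => x ^+ i)%g #[x]%g).

Lemma cyc_logK (A : finGroupType) (x u : A) :
  u \in <[x]>%g -> (x ^+ cyc_log x u = u)%g.
Proof.
move=> /cyclePmin[m lt_m ->]; rewrite /cyc_log.
set s := mkseq _ _.
have ms : (x ^+ m)%g \in s by apply/mapP; exists m; rewrite ?mem_iota.
have := nth_index 1%g ms; rewrite {1}/s nth_mkseq //.
by rewrite -[X in (_ < X)%N](size_mkseq (fun i => x ^+ i)%g) index_mem.
Qed.

Lemma cyc_log1 (A : finGroupType) (x : A) : cyc_log x 1%g = 0%N.
Proof.
by rewrite /cyc_log; case: #[x]%g (order_gt0 x) => // n _ /=; rewrite expg0 eqxx.
Qed.

(** The form is the product, over the cyclic factors, of z^(log u log v) with z a primitive root of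
    the order of the factor. Symmetry allows multiplicativity and nondegeneracy to be stated on one
    side only. *)
Lemma nondeg_bichar_list (A : finGroupType) (b : seq A) (G : {group A}) :
  \big[dprod/1%g]_(x <- b) <[x]>%g = G ->
  exists B : A -> A -> k,
    [/\ forall u v, B u v = B v u, B 1%g 1%g = 1,
        {in G & G & G, forall u v w, B (u * v)%g w = B u w * B v w}
      & {in G, forall u, {in G, forall v, B u v = 1} -> u = 1%g}].
Proof.
elim: b G => [|x b IHb] G.
  rewrite big_nil => <-; exists (fun _ _ => 1); split=> //.
    by move=> u v w _ _ _; rewrite mulr1.
  by move=> u /set1P.
rewrite big_cons => defG; case/dprodP: (defG) => [[K H defK defH] _ _ _].
move: defG; rewrite defH => defG.
have [B [Bsym B11 BM Bnd]] := IHb H defH.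
have [z prim_z] := prim_root_exists (order_gt0 x).
have [_ GE cHx tiX] := dprodP defG.
pose p u := divgr <[x]> H u; pose q u := remgr <[x]> H u.
have pin u : u \in G -> p u \in <[x]>%g by move=> Gu; apply: mem_divgr; rewrite GE.
have qin u : u \in G -> q u \in H by move=> Gu; apply: mem_remgr; rewrite GE.
have pqE u : (p u * q u = u)%g by rewrite /p /q -divgr_eq.
have pxy y h : y \in <[x]>%g -> h \in H -> p (y * h)%g = y.
  by move=> *; apply: divgrMid.
have qxy y h : y \in <[x]>%g -> h \in H -> q (y * h)%g = h.
  by move=> *; apply: remgrMid.
have pqM u v : u \in G -> v \in G ->
   (u * v = (p u * p v) * (q u * q v))%g.
  move=> Gu Gv; rewrite -{1}(pqE u) -{1}(pqE v) !mulgA; congr (_ * _)%g.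
  have cqp : commute (q u) (p v) by apply: (centsP cHx); [apply: qin | apply: pin].
  by rewrite -!(mulgA (p u)) -cqp !mulgA.
have pM u v : u \in G -> v \in G -> p (u * v)%g = (p u * p v)%g.
  by move=> Gu Gv; rewrite pqM // pxy // groupM ?pin ?qin.
have qM u v : u \in G -> v \in G -> q (u * v)%g = (q u * q v)%g.
  by move=> Gu Gv; rewrite pqM // qxy // groupM ?pin ?qin.
pose e u := cyc_log x (p u).
have eh h : h \in H -> e h = 0%N.
  by move=> Hh; rewrite /e -[h]mul1g pxy // cyc_log1.
have qh h : h \in H -> q h = h by move=> Hh; rewrite -{1}[h]mul1g qxy.
have qx : q x = 1%g by have := qxy x 1%g (cycle_id x) (group1 H); rewrite mulg1.
have px : p x = x by have := pxy x 1%g (cycle_id x) (group1 H); rewrite mulg1.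
have xG : x \in G by rewrite -GE; apply/mulsgP; exists x 1%g; rewrite ?cycle_id ?mulg1.
have HG h : h \in H -> h \in G.
  by move=> Hh; rewrite -GE; apply/mulsgP; exists 1%g h; rewrite ?mul1g.
have eE u : u \in G -> (x ^+ e u)%g = p u by move=> Gu; rewrite cyc_logK ?pin.
exists (fun u v => z ^+ (e u * e v) * B (q u) (q v)); split.
- by move=> u v; rewrite mulnC Bsym.
- by rewrite eh // qh // mul0n mul1r.
- move=> u v w Gu Gv Gw; rewrite qM // BM ?qin // mulrACA -exprD -mulnDl.
  congr (_ * _); apply/eqP; rewrite (eq_prim_root_expr prim_z).
  rewrite -modnMml -[in X in _ == X]modnMml; apply/eqP; congr (_ * _ %% _)%N.
  apply/eqP; rewrite -eq_expg_mod_order expgD !eE ?groupM //.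
  by rewrite pM.
move=> u Gu Bu1.
have qu1 : q u = 1%g.
  apply: Bnd; rewrite ?qin // => h Hh; have := Bu1 h (HG h Hh).
  by rewrite (eh h Hh) muln0 mul1r (qh h Hh).
rewrite -(pqE u) qu1 mulg1 -[p u](cyc_logK (pin u Gu)).
have := Bu1 x xG; rewrite qu1 qx B11 mulr1 /e px => zE.
(* The logarithm of [x] equals 1 only modulo [#[x]]: it is 0 when [x] is trivial. *)
have lx : (x ^+ cyc_log x x == x ^+ 1)%g by rewrite cyc_logK ?cycle_id.
rewrite eq_expg_mod_order in lx.
have zl : z ^+ cyc_log x x = z by apply/eqP; rewrite -{2}[z]expr1 (eq_prim_root_expr prim_z).
move: zE; rewrite mulnC exprM zl => /eqP; rewrite -(prim_order_dvd prim_z).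
by rewrite order_dvdn => /eqP.
Qed.

Lemma nondeg_bichar (A : finGroupType) : abelian [set: A] ->
  exists B : A -> A -> k,
    [/\ forall u v, B u v = B v u, forall u v w, B (u * v)%g w = B u w * B v w,
        forall u, B 1%g u = 1
      & forall u, (forall v, B u v = 1) -> u = 1%g].
Proof.
move=> /abelian_structure[b defA _].
have [B [Bsym B11 BM Bnd]] := nondeg_bichar_list (G := [set: A]%G) defA.
have {}BM u v w : B (u * v)%g w = B u w * B v w by apply: BM; rewrite inE.
exists B; split=> //; last by move=> u Bu; apply: Bnd; rewrite ?inE // => v _.
move=> u; have := BM 1%g 1%g u; rewrite mulg1 => BE.
have Bu0 : B 1%g u != 0.
  apply/eqP=> B0; have := oner_neq0 k.
  by rewrite -B11 -{1}(mulgV u) BM Bsym B0 mul0r eqxx.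
by apply: (mulfI Bu0); rewrite -BE mulr1.
Qed.

(** A sigma type, so that the character can be extracted inside definitions. *)
Lemma mk_char (A : finGroupType) (f : A -> k) :
  f 1%g = 1 -> (forall x y, f (x * y)%g = f x * f y) ->
  {c : character k A | c =1 f}.
Proof.
move=> f1 fM; have cP : is_char [ffun x => f x].
  rewrite /is_char ffunE f1 eqxx; apply/forallP=> x; apply/forallP=> y.
  by rewrite !ffunE fM.
by exists (Character cP) => x; rewrite ffunE.
Qed.

Lemma charME (A : finGroupType) (c d : character k A) x :
  (c * d)%g x = c x * d x.
Proof. by rewrite ffunE. Qed.

Lemma char1E (A : finGroupType) x : (1%g : character k A) x = 1.
Proof. by rewrite ffunE. Qed.

Lemma char_neq0 (A : finGroupType) (c : character k A) x : c x != 0.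
Proof.
apply/eqP=> c0; have := oner_neq0 k.
by rewrite -(Defs.char1 c) -(mulgV x) Defs.charM c0 mul0r eqxx.
Qed.

Lemma charVx (A : finGroupType) (c : character k A) x : c x^-1%g = (c x)^-1.
Proof.
by apply: (mulfI (char_neq0 c x)); rewrite -Defs.charM mulgV Defs.char1 divff ?char_neq0.
Qed.

Lemma charVE (A : finGroupType) (c : character k A) x : (c^-1)%g x = (c x)^-1.
Proof. by rewrite ffunE charVx. Qed.

Lemma character_abelian (A : finGroupType) : abelian [set: character k A].
Proof.
apply/centsP=> c _ d _; apply/Defs.charP=> x; by rewrite !charME mulrC.
Qed.

(** Multiplication by [c y] permutes the terms, so the sum is annihilated by [c y - 1], which is
    nonzero for a suitable [y] unless [c] is trivial. *)
Lemma sum_char (A : finGroupType) (c : character k A) :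
  \sum_x c x = (c == 1%g)%:R * #|A|%:R.
Proof.
have [->|c1] := eqVneq c 1%g.
  by rewrite (eq_bigr (fun=> 1)) => [|x _]; rewrite ?char1E // mul1r sumr_const.
have [y cy] : exists y, c y != 1.
  apply/existsP; apply: contraR c1; rewrite negb_exists => /forallP c1.
  by apply/eqP/Defs.charP=> x; rewrite char1E; apply/eqP; have := c1 x; rewrite negbK.
rewrite mul0r; apply/eqP; rewrite -(mulrI_eq0 _ (lregP _ : GRing.lreg (c y - 1))) ?subr_eq0 //.
rewrite mulrBl mul1r subr_eq0 mulr_sumr [eqbRHS](reindex_inj (mulgI y)) /=.
by apply/eqP/eq_bigr=> x _; rewrite Defs.charM.
Qed.

Lemma char_bichar_iso (A : finGroupType) : abelian [set: A] ->
  exists D : A -> character k A, {morph D : x y / (x * y)%g} /\ injective D.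
Proof.
move=> /nondeg_bichar[B [Bsym BM B1 Bnd]].
have BMr u v w : B u (v * w)%g = B u v * B u w by rewrite !(Bsym u) BM.
have B1r u : B u 1%g = 1 by rewrite Bsym.
pose D u := sval (mk_char (B1r u) (BMr u)).
have DE u x : D u x = B u x by rewrite /D; case: mk_char.
have DM : {morph D : x y / (x * y)%g}.
  by move=> u v; apply/Defs.charP=> x; rewrite charME !DE BM.
exists D; split=> // u v eqD.
apply/eqP; rewrite eq_mulgV1; apply/eqP/Bnd=> w; rewrite BM -DE eqD DE -BM.
by rewrite mulgV.
Qed.

Lemma char_separates (A : finGroupType) (x : A) : abelian [set: A] ->
  (forall c : character k A, c x = 1) -> x = 1%g.
Proof.
move=> /nondeg_bichar[B [Bsym BM B1 Bnd]] cx.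
apply: Bnd => v; rewrite Bsym.
have BMr u w : B v (u * w)%g = B v u * B v w by rewrite !(Bsym v) BM.
have B1r : B v 1%g = 1 by rewrite Bsym.
by have [c cE] := mk_char B1r BMr; rewrite -cE.
Qed.

Lemma char_injP (A : finGroupType) (x y : A) : abelian [set: A] ->
  (forall c : character k A, c x = c y) -> x = y.
Proof.
move=> abA cxy; apply/eqP; rewrite eq_mulgV1; apply/eqP/char_separates=> // c.
by rewrite Defs.charM charVx cxy divff ?char_neq0.
Qed.

Lemma sum_chars (A : finGroupType) (x : A) : abelian [set: A] ->
  \sum_(c : character k A) c x = (x == 1%g)%:R * #|{: character k A}|%:R.
Proof.
move=> abA; have [->|x1] := eqVneq x 1%g.
  by rewrite (eq_bigr (fun=> 1)) => [|c _]; rewrite ?Defs.char1 // mul1r sumr_const.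
have [d dx] : exists d : character k A, d x != 1.
  apply/existsP; apply: contraR x1; rewrite negb_exists => /forallP dx.
  apply/eqP/char_separates=> // c; apply/eqP; have := dx c; by rewrite negbK.
rewrite mul0r; apply/eqP; rewrite -(mulrI_eq0 _ (lregP _ : GRing.lreg (d x - 1))) ?subr_eq0 //.
rewrite mulrBl mul1r subr_eq0 mulr_sumr [eqbRHS](reindex_inj (mulgI d)) /=.
by apply/eqP/eq_bigr=> c _; rewrite charME.
Qed.

(** The two orthogonality relations evaluate the same double sum; characteristic zero lets the
    results be compared as natural numbers. *)
Lemma card_characters (A : finGroupType) : abelian [set: A] ->
  #|{: character k A}| = #|A|.
Proof.
move=> abA; apply/eqP.
have natI (m n : nat) : m%:R = n%:R :> k -> m = n.
  wlog lemn : m n / (m <= n)%N => [IH mn|mn].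
    by case/orP: (leq_total m n) => le; [|apply/esym]; apply: IH.
  apply/eqP; rewrite eqn_leq lemn -subn_eq0 /=; apply: contraT; rewrite -lt0n.
  by move/natr_neq0; rewrite natrB // mn subrr eqxx.
apply/eqP/natI.
transitivity (\sum_(x : A) \sum_(c : character k A) c x).
  rewrite (bigD1 (1%g : A)) //= [X in _ + X]big1 ?addr0 => [|x x1]; rewrite sum_chars //.
    by rewrite eqxx mul1r.
  by rewrite (negPf x1) mul0r.
rewrite exchange_big /=; under eq_bigr do rewrite sum_char.
rewrite -mulr_suml (bigD1 (1%g : character k A)) //= [X in _ + X]big1 => [|c c1].
  by rewrite addr0 eqxx mul1r.
by rewrite (negPf c1).
Qed.

(** Evaluations embed [A] into its bidual, which has the same cardinality. *)
Lemma char_dual_onto (A : finGroupType) (F : character k A -> k) :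
  abelian [set: A] -> F 1%g = 1 -> {morph F : c d / (c * d)%g >-> c * d} ->
  exists z, forall c, F c = c z.
Proof.
move=> abA F1 FM; have [f fE] := mk_char F1 FM.
have evM z : {morph (fun c : character k A => c z) : c d / (c * d)%g >-> c * d}.
  by move=> c d; rewrite charME.
pose ev z := sval (mk_char (char1E z) (evM z)).
have evE z c : ev z c = c z by rewrite /ev; case: mk_char.
have ev_inj : injective ev.
  by move=> x y exy; apply: char_injP => // c; rewrite -!evE exy.
have [|g _ gK] := inj_card_bij ev_inj.
  by rewrite !card_characters //; apply: character_abelian.
by exists (g f) => c; rewrite -fE -{1}(gK f) evE.
Qed.

Lemma dual_iso_bij (A : finGroupType) (D : A -> character k A) :
  abelian [set: A] -> injective D -> bijective D.
Proof. by move=> abA Dinj; apply: inj_card_bij; rewrite ?card_characters. Qed.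

Lemma char_alg_map_inj (A : finGroupType) : injective (@char_alg_map k A).
Proof.
(* The left inverse is Fourier inversion on [A]. *)
apply: (can_inj (g := fun h : vec k A =>
  [ffun c : character k A => (#|A|%:R)^-1 * \sum_x h x * c x^-1%g] : vec k _)).
move=> u; apply/ffunP=> c; rewrite ffunE.
have hE x : char_alg_map k A u x = \sum_d u d * d x.
  by rewrite linextE sum_ffunE; apply: eq_bigr => d _; rewrite !ffunE.
under eq_bigr do rewrite hE mulr_suml.
rewrite exchange_big /= (bigD1 c) //= [X in _ + X]big1 => [|d dc].
  rewrite addr0 (eq_bigr (fun=> u c)) => [|x _].
    by rewrite sumr_const -(mulr_natl (u c)) mulrA mulVf ?mul1r ?natr_neq0 //; apply/card_gt0P; exists 1%g.
  by rewrite charVx mulfK ?char_neq0.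
under eq_bigr => x _ do rewrite charVx -mulrA -charVE -(charME d c^-1%g).
by rewrite -mulr_sumr sum_char -eq_mulgV1 (negPf dc) mul0r mulr0.
Qed.

End CharacterTheory.

Local Close Scope ring_scope.
Local Open Scope group_scope.

(** * Existence of reflections *)

Lemma subg_hom (A G : finGroupType) (C : {group G}) (f : A -> G) :
  is_hom f -> (forall x, f x \in C) -> is_hom (fun x => subg C (f x)).
Proof. by move=> fM fC x y; rewrite fM subgM. Qed.

Lemma subg_one (G : finGroupType) (C : {group G}) : subg C 1 = 1.
Proof. by apply: val_inj; rewrite /= subgK. Qed.

Lemma sgval_hom (G : finGroupType) (C : {group G}) : is_hom (@sgval G C).
Proof. by move=> x y. Qed.

Lemma isog_subgT (G : finGroupType) (C : {group G}) : C \isog [set: subg_of C].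
Proof. exact: isog_subg. Qed.

Lemma abelian_subg_of (G : finGroupType) (C : {group G}) :
  abelian C -> abelian [set: subg_of C].
Proof. by rewrite (isog_abelian (isog_subg C)). Qed.

Lemma hom_inverse (A B : finGroupType) (f : A -> B) :
  is_hom f -> injective f -> #|A| = #|B| ->
  exists g : B -> A, [/\ is_hom g, cancel f g & cancel g f].
Proof.
move=> fM fI cAB; have [|g fK gK] := inj_card_bij fI; first by rewrite cAB.
by exists g; split=> // x y; apply: fI; rewrite fM !gK.
Qed.

(** An injective endomorphism [q \o j] of the finite group [X] is invertible; composing [q] with its
    inverse leaves the kernel of [q] unchanged and reduces to the case [q \o j = 1]. *)
Lemma common_complement_inj (G X Y : finGroupType) (p : G -> Y) (i : Y -> G)
    (q : G -> X) (j : X -> G) :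
  abelian [set: X] -> abelian [set: Y] -> [set: X] \isog [set: Y] ->
  is_hom p -> is_hom i -> is_hom q -> is_hom j ->
  (forall c, i c \in 'Z([set: G])) -> (forall x, j x \in 'Z([set: G])) ->
  (forall c, p (i c) = c) -> injective (q \o j) ->
  (exists s : G -> Y, [/\ is_hom s, forall c, s (i c) = c & injective (s \o j)]) /\
  (exists i2 : Y -> G, [/\ is_hom i2, forall c, i2 c \in 'Z([set: G]),
     forall c, p (i2 c) = c & injective (q \o i2)]).
Proof.
move=> abX abY isoXY pM iM qM jM iZ jZ piK qjI.
have [r [rM qjK _]] := hom_inverse (hom_comp qM jM) qjI erefl.
have [S [i2 [i2M i2Z pi2 qi2]]] := common_complement abX abY isoXY pM iM
  (hom_comp rM qM) jM iZ jZ piK qjK.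
by split=> //; exists i2; split=> // x y /= /(congr1 r) /qi2.
Qed.

(** * Transposes with respect to character groups *)

Section Pullback.

Variable k : closedFieldType.
Hypothesis char0 : [pchar k]%R =i pred0.

Definition char_pull (A B : finGroupType) (f : A -> B) (fM : is_hom f)
    (c : character k B) : character k A.
Proof.
apply: (sval (@mk_char k A (fun x => c (f x)) _ _)).
  by rewrite hom1 // Defs.char1.
by move=> x y; rewrite fM Defs.charM.
Defined.

Lemma char_pullE (A B : finGroupType) (f : A -> B) (fM : is_hom f) c x :
  char_pull fM c x = c (f x).
Proof. by rewrite /char_pull; case: mk_char. Qed.

Lemma char_pullM (A B : finGroupType) (f : A -> B) (fM : is_hom f) :
  is_hom (char_pull fM).
Proof.
by move=> c d; apply/Defs.charP=> x; rewrite charME !char_pullE charME.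
Qed.

(** A bicharacter on [E] and the dual of [A] is a homomorphism from [E] to the bidual of [A], which
    is [A]. It serves to construct transposes of homomorphisms defined on a dual group. *)
Lemma dual_hom (E A : finGroupType) (P : E -> character k A -> k) :
  abelian [set: A] -> (forall e, P e 1 = 1%R) ->
  (forall e c d, P e (c * d)%g = P e c * P e d)%R ->
  (forall e e' c, P (e * e')%g c = P e c * P e' c)%R ->
  exists j : E -> A, is_hom j /\ forall e c, P e c = c (j e).
Proof.
move=> abA P1 PM PM'.
have /fin_all_exists[j jE] e : exists z, forall c, P e c = c z.
  by apply: (char_dual_onto char0) => // c d; apply: PM.
exists j; split=> // e e'; apply: (char_injP char0) => // c.
by rewrite Defs.charM -!jE PM'.
Qed.

Lemma isog_character (A : finGroupType) : abelian [set: A] ->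
  [set: A] \isog [set: character k A].
Proof.
move=> abA; have [D [DM DI]] := char_bichar_iso char0 abA.
apply: (injhom_isog (f := D)) => // [x|]; first by rewrite inE.
by rewrite cardsT (card_characters char0).
Qed.

End Pullback.

(** * Splittings adapted to a matrix and its inverse *)

Section Core.

Variables (k : closedFieldType) (G : finGroupType).
Hypothesis char0 : [pchar k]%R =i pred0.

Local Notation Z := ('Z([set: G])).
Local Notation subgZ := (subg_of 'Z([set: G])%G).
Local Notation X := (character k subgZ).

Lemma abelian_subgZ : abelian [set: subgZ].
Proof. by apply: abelian_subg_of; apply: center_abelian. Qed.

Definition resZ : character k G -> X := char_pull (@sgval_hom G 'Z([set: G])%G).

Lemma resZE c z : resZ c z = c (sgval z).
Proof. exact: char_pullE. Qed.

Lemma resZM : is_hom resZ.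
Proof. exact: char_pullM. Qed.

Variables (v v' : G -> G) (b b' : G -> character k G) (al al' : X -> G).
Hypotheses (vM : is_hom v) (v'M : is_hom v') (bM : is_hom b) (b'M : is_hom b').
Hypotheses (alM : is_hom al) (al'M : is_hom al').
Hypotheses (alZ : forall psi, al psi \in Z) (al'Z : forall psi, al' psi \in Z).
(** The lower right entries of the matrix identities phi' phi = 1 and phi phi' = 1. *)
Hypothesis inv_l : forall y, al' (resZ (b y)) * v' (v y) = y.
Hypothesis inv_r : forall y, al (resZ (b' y)) * v (v' y) = y.

Let ex_t : exists2 t, quasi_inv v t & maximal_quasi_inv v t.
Proof.
have [y|y|t0] := quasi_inv_exists vM v'M; last exact: maximal_quasi_inv_exists.
  by rewrite /hom_defect -{1}(inv_l y) mulgK.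
by rewrite /hom_defect -{1}(inv_r y) mulgK.
Qed.

Section WithT.

Variable t : G -> G.
Hypotheses (qt : quasi_inv v t) (mt : maximal_quasi_inv v t).

Let tM : is_hom t. Proof. by case: qt. Qed.
Let tvt x : t (v (t x)) = t x. Proof. by case: qt. Qed.
Let e' := hom_defect (t \o v).
Let e := hom_defect (v \o t).
Let eM : is_hom e. Proof. exact: (qi_eM vM qt). Qed.
Let e'M : is_hom e'. Proof. exact: (qi_e'M vM qt). Qed.
Let eZ x : e x \in Z. Proof. exact: (qi_eZ qt). Qed.
Let e'Z x : e' x \in Z. Proof. exact: (qi_e'Z qt). Qed.
Let ev x : e (v x) = v (e' x). Proof. exact: qi_ev. Qed.
Let tve' x : t (v (e' x)) = 1. Proof. exact: (qi_tve' vM qt). Qed.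
Let e'id x : t (v x) = 1 -> e' x = x. Proof. exact: qi_e'id. Qed.

(** [t] and [v] restrict to injections between the images of [v t] and [t v]; cancelling these
    images from the two decompositions of [G] leaves isomorphic kernels. *)
Lemma split_groups : exists C C' : {group G},
  [/\ forall x, (x \in C) = (v (t x) == 1), forall x, (x \in C') = (t (v x) == 1)
    & C \isog C'].
Proof.
have FM : is_hom (t \o v) by apply: hom_comp.
have F'M : is_hom (v \o t) by apply: hom_comp.
have FF x : (t \o v) ((t \o v) x) = (t \o v) x by rewrite /= tvt.
have FF' x : (v \o t) ((v \o t) x) = (v \o t) x by rewrite /= tvt.
have [I' [C' [def' I'E C'E]]] := idem_dprod FM FF e'Z.
have [I [C [def IE CE]]] := idem_dprod F'M FF' eZ.
exists C, C'; split=> //; apply: (dprod_cancel def def' (isog_refl _)).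
apply: (mutual_isog tM vM) => x; rewrite ?IE ?I'E /=.
- by rewrite tvt.
- by move=> /eqP->.
- by move=> /eqP vtx tx; rewrite -vtx tx (hom1 vM).
by move=> /eqP tvx vx; rewrite -tvx vx (hom1 tM).
Qed.

(** The injective map is the [v]-component of [phi \o r], for the reflection [r] given by the
    retraction [s] and the isomorphism [D]: it keeps [v] on the kernel of [s] and replaces it by
    [al] on [C']. *)
Lemma core_row (C C' : {group G}) :
  (forall x, (x \in C) = (v (t x) == 1)) ->
  (forall x, (x \in C') = (t (v x) == 1)) -> C \isog C' ->
  exists (s : G -> subg_of C') (sM : is_hom s) (D : subg_of C' -> character k (subg_of C')),
  [/\ C' \subset Z, forall c, s (sgval c) = c, is_hom D, injective D
    & injective (fun g => v (g * (sgval (s g))^-1) *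
                          al (resZ (char_pull sM (D (s g)))))].
Proof.
move=> CE C'E isoC.
have C'e' x : x \in C' -> e' x = x by rewrite C'E => /eqP/e'id.
have e'C' x : e' x \in C' by rewrite C'E tve'.
have eC x : e x \in C by rewrite CE; apply/eqP; rewrite /e /hom_defect tM homV //= tvt mulgV (hom1 vM).
have Ce x : x \in C -> e x = x by rewrite CE /e /hom_defect /= => /eqP->; rewrite invg1 mulg1.
have vC' y : y \in C' -> v y \in C by rewrite C'E CE => /eqP->; rewrite (hom1 vM).
have C'Z y : y \in C' -> y \in Z by move/C'e' <-.
have CZ y : y \in C -> y \in Z by move/Ce <-.
have abC : abelian [set: subg_of C].
  apply: abelian_subg_of; apply/centsP=> x Cx y _; exact/centerTC/CZ.
have abC' : abelian [set: subg_of C'].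
  apply: abelian_subg_of; apply/centsP=> x Cx y _; exact/centerTC/C'Z.
have isoC's : [set: subg_of C] \isog [set: subg_of C'].
  by rewrite -(isog_transl _ (isog_subgT C)) -(isog_transr _ (isog_subgT C')).
have isoXY : [set: character k (subg_of C)] \isog [set: subg_of C'].
  by rewrite -(isog_transl _ (isog_character char0 abC)).
pose p g := subg C' (e' g); have pM : is_hom p by apply: subg_hom.
have piK (c : subg_of C') : p (sgval c) = c by rewrite /p C'e' ?sgvalK ?subgP.
pose eal psi := subg C (e (al psi)).
have ealM : is_hom eal by apply: subg_hom => [x y|//]; rewrite alM eM.
(* [eal] is the part of [al] with values in [C], and [j] is its transpose. *)
have [j0 [j0M j0E]] : exists j : character k (subg_of C) -> subgZ, is_hom j /\
    forall (eta : character k (subg_of C)) (psi : X), eta (eal psi) = psi (j eta).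
  apply: (dual_hom char0 (P := fun (eta : character k (subg_of C)) psi => eta (eal psi))) => [|eta|eta c d|eta eta' c].
  - exact: abelian_subgZ.
  - by rewrite (hom1 ealM) Defs.char1.
  - by rewrite ealM Defs.charM.
  by rewrite charME.
pose j eta := sgval (j0 eta).
have jM : is_hom j by move=> x y; rewrite /j j0M.
have /fin_all_exists[q qE] g : exists eta : character k (subg_of C),
    forall c, eta c = b' (sgval c) g.
  have [|x y|eta etaE] := mk_char (k := k) (f := fun c : subg_of C => b' (sgval c) g).
  - by rewrite (hom1 b'M) char1E.
  - by rewrite b'M charME.
  by exists eta.
have qM : is_hom q.
  by move=> g h; apply/Defs.charP=> c; rewrite charME !qE Defs.charM.
have qjI : injective (q \o j).
  (* [mu] is adjoint to [q \o j]. Since al b' + v v' = 1, an element [c] of its kernel equals [v y]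
     for [y = e' (v' c)], and this [y] is fixed by [e' v' v]; maximality of [t] makes it trivial. *)
  pose mu (c : subg_of C) := eal (resZ (b' (sgval c))).
  have muM : is_hom mu by move=> c d; rewrite /mu /= b'M resZM ealM.
  have muI : injective mu.
    apply: hom_inj => // c muc.
    have : e (al (resZ (b' (sgval c)))) = 1.
      by move/(congr1 (@sgval _ _)): muc; rewrite subgK.
    rewrite -{1}[al _](mulgK (v (v' (sgval c)))) inv_r eM homV // ev Ce ?subgP //.
    move/eqP; rewrite -eq_mulgV1 => /eqP ce.
    have y1 : e' (v' (sgval c)) = 1 by apply: (mt v'M); rewrite ?tve' // -ce.
    by apply: val_inj; rewrite /= ce y1 (hom1 vM).
  have [nu [_ _ nuK]] := hom_inverse muM muI erefl.
  apply: hom_inj; first exact: hom_comp.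
  move=> eta /= qj1; apply/Defs.charP=> c; rewrite char1E -(nuK c).
  have := congr1 (fun h : character k _ => h (nu c)) qj1.
  by rewrite char1E qE /j -resZE -j0E.
have [[s [sM si sjI]] _] := common_complement_inj (character_abelian _ _) abC' isoXY pM
  (@sgval_hom _ _) qM jM (fun c => C'Z _ (subgP c)) (fun x => subgP (j0 x)) piK qjI.
have [D [DM DI]] := char_bichar_iso char0 abC'.
exists s, sM, D; split=> //; first exact/subsetP.
(* [lam] is adjoint to the bijection [s \o j], hence identifies the dual of [C'] with [C]. *)
pose lam psi := eal (resZ (char_pull sM psi)).
have lamM : is_hom lam by move=> x y; rewrite /lam char_pullM resZM ealM.
have cardXY : #|{: character k (subg_of C)}| = #|{: subg_of C'}|.
  by rewrite -!cardsT (card_isog isoXY).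
have lamI : injective lam.
  apply: hom_inj => // psi lam1; apply/Defs.charP=> c; rewrite char1E.
  have [r [_ _ rK]] := hom_inverse (hom_comp sM jM) sjI cardXY.
  by rewrite -(rK c) /= -(char_pullE sM) /j -resZE -j0E -/(lam _) lam1 Defs.char1.
have [lv [lvM lamK lvK]] : exists g, [/\ is_hom g, cancel lam g & cancel g lam].
  apply: hom_inverse => //; rewrite (card_characters char0) //.
  by rewrite -cardXY (card_characters char0).
pose A c := al (resZ (char_pull sM (D c))).
have AM : is_hom A by move=> x y; rewrite /A DM char_pullM resZM alM.
have sZ x : sgval (s x) \in Z by apply: C'Z; apply: subgP.
pose h g := g * (sgval (s g))^-1.
have hM : is_hom h.
  by apply: central_homM => // [|x]; rewrite ?groupV //; apply: central_homV => // x y; rewrite sM.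
apply: hom_inj.
  apply: central_homM => [x y|x y|x]; last exact: alZ.
    by rewrite -!/(h _) hM vM.
  by rewrite -!/(A _) sM AM.
move=> g; rewrite -/(h g) -/(A (s g)) => eq1.
(* [vy] and [tA] come from applying [e] and [t] to [eq1], and [yE] from [s (h g) = 1]. Together they
   make [y] a fixed point of [e' th v] for the [th] below, so that maximality yields [y = 1]. *)
pose y := (e' (h g))^-1.
have C'y : y \in C' by rewrite groupV.
have vy : sgval (lam (D (s g))) = v y.
  have := congr1 e eq1; rewrite eM ev (hom1 eM) subgK // => /(canRL (mulKg _)) ->.
  by rewrite mulg1 homV.
have tA : t (v (h g)) = (t (A (s g)))^-1.
  have := congr1 t eq1; rewrite tM (hom1 tM) => /(canRL (mulgK _)) ->.
  by rewrite mul1g.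
have sh : s (h g) = 1 by rewrite /h sM homV // si mulgV.
have yE : y = (sgval (s (t (A (s g)))))^-1.
  have := sh; rewrite -{1}(hom_defectK (t \o v) (h g)) -/e' sM /= tA homV //.
  move/(congr1 (@sgval _ _)) => /= /eqP; rewrite -eq_mulgV1 => /eqP <-.
  rewrite /y; congr (_^-1).
  by rewrite -[in RHS](subgK _ (e'C' (h g))) si subgK.
pose th x := (sgval (s (t (al (resZ (char_pull sM (lv (subg C (e x)))))))))^-1.
have thM : is_hom th.
  apply: central_homV => // x z.
  by rewrite eM subgM // lvM char_pullM resZM alM tM sM.
have y1 : y = 1.
  apply: (mt thM).
    by move: C'y; rewrite C'E => /eqP.
  rewrite -/e' /th Ce ?vC' // -vy sgvalK lamK -/(A _) -yE; exact: C'e'.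
have sg1 : s g = 1.
  apply: DI; apply: lamI; rewrite (hom1 DM) (hom1 lamM).
  by apply: val_inj; rewrite /= vy y1 (hom1 vM).
have hg : h g = 1.
  have := hom_defectK (t \o v) (h g); rewrite -/e' /= tA sg1 (hom1 AM) (hom1 tM).
  by rewrite invg1 mulg1 -[e' _]invgK -/y y1 invg1.
by rewrite -[g](mulgKV (sgval (s g))) -/(h g) hg sg1 mulg1.
Qed.

(** Dual to [core_row]: instead of the retraction, the subgroup moves, to the image [C2] of another
    section [i2] of the projection onto [C]. The last two clauses give injectivity of the
    [v]-component of [r \o phi] and radicality of the block of [v] into [C2], the latter needed for
    the twist. *)
Lemma core_column (C C' : {group G}) :
  (forall x, (x \in C) = (v (t x) == 1)) ->
  (forall x, (x \in C') = (t (v x) == 1)) -> C \isog C' ->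
  exists (C2 : {group G}) (s : G -> subg_of C2) (D : subg_of C2 -> character k (subg_of C2)),
  [/\ is_hom s, forall c, s (sgval c) = c, is_hom D, injective D
    & [/\ C2 \subset Z, forall g, v g = sgval (s (v g)) ->
         (forall c : subg_of C2, b g (sgval c) = 1%R) -> g = 1
    & forall th, is_hom th -> forall c, s (v (th (sgval c))) = c -> c = 1]].
Proof.
move=> CE C'E isoC.
have C'e' x : x \in C' -> e' x = x by rewrite C'E => /eqP/e'id.
have e'C' x : e' x \in C' by rewrite C'E tve'.
have eC x : e x \in C by rewrite CE; apply/eqP; rewrite /e /hom_defect tM homV //= tvt mulgV (hom1 vM).
have Ce x : x \in C -> e x = x by rewrite CE /e /hom_defect /= => /eqP->; rewrite invg1 mulg1.
have vC' y : y \in C' -> v y \in C by rewrite C'E CE => /eqP->; rewrite (hom1 vM).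
have C'Z y : y \in C' -> y \in Z by move/C'e' <-.
have CZ y : y \in C -> y \in Z by move/Ce <-.
have abC : abelian [set: subg_of C].
  apply: abelian_subg_of; apply/centsP=> x Cx y _; exact/centerTC/CZ.
have abC' : abelian [set: subg_of C'].
  apply: abelian_subg_of; apply/centsP=> x Cx y _; exact/centerTC/C'Z.
have isoXY : [set: character k (subg_of C')] \isog [set: subg_of C].
  rewrite -(isog_transl _ (isog_character char0 abC')).
  by rewrite -(isog_transl _ (isog_subgT C')) -(isog_transr _ (isog_subgT C)) isog_sym.
pose p g := subg C (e g); have pM : is_hom p by apply: subg_hom.
have piK (c : subg_of C) : p (sgval c) = c by rewrite /p Ce ?sgvalK ?subgP.
pose eal psi := subg C' (e' (al' psi)).
have ealM : is_hom eal by apply: subg_hom => [x y|//]; rewrite al'M e'M.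
have [j0 [j0M j0E]] : exists j : character k (subg_of C') -> subgZ, is_hom j /\
    forall (eta : character k (subg_of C')) (psi : X), eta (eal psi) = psi (j eta).
  apply: (dual_hom char0 (P := fun (eta : character k (subg_of C')) psi => eta (eal psi))) => [|eta|eta c d|eta eta' c].
  - exact: abelian_subgZ.
  - by rewrite (hom1 ealM) Defs.char1.
  - by rewrite ealM Defs.charM.
  by rewrite charME.
pose j eta := sgval (j0 eta).
have jM : is_hom j by move=> x y; rewrite /j j0M.
have /fin_all_exists[q qE] g : exists eta : character k (subg_of C'),
    forall c, eta c = b (sgval c) g.
  have [|x y|eta etaE] := mk_char (k := k) (f := fun c : subg_of C' => b (sgval c) g).
  - by rewrite (hom1 bM) char1E.
  - by rewrite bM charME.
  by exists eta.
have qM : is_hom q.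
  by move=> g h; apply/Defs.charP=> c; rewrite charME !qE Defs.charM.
have qjI : injective (q \o j).
  (* Again adjoint to [q \o j]; the identity used here is al' b + v' v = 1. *)
  pose mu (c : subg_of C') := eal (resZ (b (sgval c))).
  have muM : is_hom mu by move=> c d; rewrite /mu /= bM resZM ealM.
  have muI : injective mu.
    apply: hom_inj => // c muc.
    have : e' (al' (resZ (b (sgval c)))) = 1.
      by move/(congr1 (@sgval _ _)): muc; rewrite subgK.
    rewrite -{1}[al' _](mulgK (v' (v (sgval c)))) inv_l e'M homV // C'e' ?subgP //.
    move/eqP; rewrite -eq_mulgV1 => /eqP ce.
    apply: val_inj; apply: (mt v'M) => //.
    by have := subgP c; rewrite C'E => /eqP.
  have [nu [_ _ nuK]] := hom_inverse muM muI erefl.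
  apply: hom_inj; first exact: hom_comp.
  move=> eta /= qj1; apply/Defs.charP=> c; rewrite char1E -(nuK c).
  have := congr1 (fun h : character k _ => h (nu c)) qj1.
  by rewrite char1E qE /j -resZE -j0E.
have [_ [i2 [i2M i2Z pi2 qi2I]]] := common_complement_inj (character_abelian _ _) abC isoXY pM
  (@sgval_hom _ _) qM jM (fun c => CZ _ (subgP c)) (fun x => subgP (j0 x)) piK qjI.
have i2I : injective i2 by apply: can_inj pi2.
have gC2 : group_set [set i2 c | c in [set: subg_of C]].
  apply/group_setP; split=> [|_ _ /imsetP[x _ ->] /imsetP[y _ ->]].
    by rewrite -(hom1 i2M) imset_f.
  by rewrite -i2M imset_f.
pose C2 := Group gC2.
have i2C2 c : i2 c \in C2 by rewrite imset_f.
pose s g := subg C2 (i2 (p g)).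
have sM : is_hom s by apply: subg_hom => [x y|x]; rewrite ?pM ?i2M.
have C2Z : C2 \subset Z by apply/subsetP=> _ /imsetP[c _ ->].
have abC2 : abelian [set: subg_of C2].
  apply: abelian_subg_of; apply/centsP=> x Cx y _; apply: centerTC.
  exact: (subsetP C2Z).
have [D [DM DI]] := char_bichar_iso char0 abC2.
have sgs g : sgval (s g) = i2 (p g) by rewrite subgK.
exists C2, s, D; split=> //.
  move=> c; have /imsetP[d _ cE] := subgP c.
  by apply: val_inj; rewrite /= sgs cE pi2.
have pv g : p (v g) = subg C (v (e' g)) by rewrite /p ev.
split=> // [g vg bg1|th thM c sc].
  pose y := e' g; have C'y : y \in C' by apply: e'C'.
  pose u := i2 (subg C (v y)).
  have vu : v g = u by rewrite vg sgs pv.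
  have gE : g = y * t u by rewrite -vu -[LHS](hom_defectK (t \o v) g).
  have cardXY : #|{: subg_of C'}| = #|{: character k (subg_of C)}|.
    rewrite (card_characters char0) // -(card_characters char0 abC').
    by rewrite -!cardsT (card_isog isoXY).
  (* [La] is adjoint to [q \o i2], hence bijective. Triviality of [b g] on [C2] then determines [y]
     from [t u], and so from [v y], by a homomorphism [th] to which maximality applies. *)
  pose La (y : subg_of C') := char_pull i2M (b (sgval y)).
  have LaM : is_hom La by move=> x z; rewrite /La /= bM char_pullM.
  have LaI : injective La.
    apply: hom_inj => // z La1; apply: (char_separates char0) => // eta.
    have [|r [_ _ rK]] := hom_inverse (hom_comp qM i2M) qi2I.
      by rewrite (card_characters char0) // cardXY (card_characters char0).
    rewrite -(rK eta) /= qE -(char_pullE i2M).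
    by rewrite -/(La z) La1 char1E.
  have [lv [lvM laK lvK]] := hom_inverse LaM LaI cardXY.
  pose th x := sgval (lv (char_pull i2M (b (t (i2 (subg C (e x))))))^-1).
  have thM : is_hom th.
    move=> x z; rewrite /th eM subgM // i2M tM bM char_pullM invMg.
    by rewrite (abelianTC (character_abelian k _)) lvM.
  have y1 : y = 1.
    apply: (mt thM); first by move: C'y; rewrite C'E => /eqP.
    rewrite -/e' /th (Ce (v y)) ?vC' // -/u.
    have <- : La (subg C' y) = (char_pull i2M (b (t u)))^-1.
      apply/Defs.charP=> c; rewrite charVE !char_pullE subgK //.
      have := bg1 (subg C2 (i2 c)); rewrite subgK // gE bM charME => /eqP.
      rewrite -[X in _ == X](GRing.mulVf (char_neq0 (b (t u)) (i2 c))).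
      by rewrite (inj_eq (GRing.mulIf (char_neq0 _ _))) => /eqP.
    by rewrite laK subgK // C'e'.
  have u1 : u = 1 by rewrite /u y1 (hom1 vM) subg_one (hom1 i2M).
  by rewrite gE y1 u1 (hom1 tM) mulg1.
(* A fixed [c] equals [i2 (v y)], so [y] is fixed by [e' (th i2 e) v] and maximality applies once
   more. *)
pose g0 := th (sgval c); pose y := e' g0.
have C'y : y \in C' by apply: e'C'.
have cE : sgval c = i2 (subg C (v y)) by rewrite -pv -sgs sc.
have y1 : y = 1.
  apply: (mt (th := fun x => th (i2 (subg C (e x))))) => [x z||].
  - by rewrite eM subgM // i2M thM.
  - by move: C'y; rewrite C'E => /eqP.
  by rewrite (Ce (v y)) ?vC' // -cE.
by apply: val_inj; rewrite /= cE y1 (hom1 vM) subg_one (hom1 i2M).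
Qed.

End WithT.

Lemma exists_row_reflection :
  exists (C : {group G}) (s : G -> subg_of C) (sM : is_hom s)
         (D : subg_of C -> character k (subg_of C)),
  [/\ C \subset Z, forall c, s (sgval c) = c, is_hom D, injective D
    & injective (fun g => v (g * (sgval (s g))^-1) *
                          al (resZ (char_pull sM (D (s g)))))].
Proof.
have [t qt mt] := ex_t; have [C [C' [CE C'E isoC]]] := split_groups qt.
by exists C'; apply: core_row CE C'E isoC.
Qed.

Lemma exists_column_reflection :
  exists (C : {group G}) (s : G -> subg_of C) (D : subg_of C -> character k (subg_of C)),
  [/\ is_hom s, forall c, s (sgval c) = c, is_hom D, injective D
    & [/\ C \subset Z, forall g, v g = sgval (s (v g)) ->
         (forall c : subg_of C, b g (sgval c) = 1%R) -> g = 1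
    & forall th, is_hom th -> forall c, s (v (th (sgval c))) = c -> c = 1]].
Proof.
have [t qt mt] := ex_t; have [C [C' [CE C'E isoC]]] := split_groups qt.
exact: core_column CE C'E isoC.
Qed.

End Core.

Local Close Scope group_scope.
Local Open Scope ring_scope.

(** * Coordinates *)

Lemma sum_pair (V : nmodType) (I J : finType) (F : I * J -> V) :
  \sum_p F p = \sum_x \sum_y F (x, y).
Proof. by rewrite pair_bigA; apply: eq_bigr => -[]. Qed.

Section Coordinates.

Variable k : closedFieldType.

Lemma vec_sum_delta (I : finType) (u : vec k I) : u = \sum_i u i *: delta i.
Proof.
apply/ffunP=> j; rewrite sum_ffunE (bigD1 j) //= !ffunE eqxx big1 ?addr0 => [|i ij].
  by rewrite [RHS]mulr1.
by rewrite !ffunE eq_sym (negPf ij) [LHS]mulr0.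
Qed.

Lemma lfun_coord (I J : finType) (f : 'Hom(vec k I, vec k J)) u j :
  f u j = \sum_i u i * f (delta i) j.
Proof.
rewrite {1}(vec_sum_delta u) linear_sum sum_ffunE; apply: eq_bigr => i _.
by rewrite linearZ ffunE.
Qed.

Lemma linext_coord (I J : finType) (F : I -> vec k J) u j :
  linext F u j = \sum_i u i * F i j.
Proof. by rewrite linextE sum_ffunE; apply: eq_bigr => i _; rewrite ffunE. Qed.

Lemma hopf_mul_coord (I : finType) (X : hopf_data k I) u v j :
  hopf_mul X u v j = \sum_i \sum_i' u i * v i' * basis_mul X i i' j.
Proof.
rewrite sum_ffunE; apply: eq_bigr => i _; rewrite sum_ffunE.
by apply: eq_bigr => i' _; rewrite ffunE.
Qed.

Lemma hopf_mulDl (I : finType) (X : hopf_data k I) u u' v :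
  hopf_mul X (u + u') v = hopf_mul X u v + hopf_mul X u' v.
Proof.
apply/ffunP=> j; rewrite ffunE !hopf_mul_coord -big_split; apply: eq_bigr => i _.
by rewrite -big_split; apply: eq_bigr => i' _; rewrite ffunE !mulrDl.
Qed.

Lemma hopf_mulDr (I : finType) (X : hopf_data k I) u v v' :
  hopf_mul X u (v + v') = hopf_mul X u v + hopf_mul X u v'.
Proof.
apply/ffunP=> j; rewrite ffunE !hopf_mul_coord -big_split; apply: eq_bigr => i _.
by rewrite -big_split; apply: eq_bigr => i' _; rewrite ffunE !mulrDr mulrDl.
Qed.

Lemma hopf_mulZl (I : finType) (X : hopf_data k I) a u v :
  hopf_mul X (a *: u) v = a *: hopf_mul X u v.
Proof.
apply/ffunP=> j; rewrite ffunE !hopf_mul_coord scaler_sumr; apply: eq_bigr => i _.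
by rewrite scaler_sumr; apply: eq_bigr => i' _; rewrite ffunE /GRing.scale /= !mulrA.
Qed.

Lemma hopf_mulZr (I : finType) (X : hopf_data k I) a u v :
  hopf_mul X u (a *: v) = a *: hopf_mul X u v.
Proof.
apply/ffunP=> j; rewrite ffunE !hopf_mul_coord scaler_sumr; apply: eq_bigr => i _.
rewrite scaler_sumr; apply: eq_bigr => i' _; rewrite ffunE /GRing.scale /= !mulrA.
by rewrite (mulrC (u i)).
Qed.

Lemma deltaE (I : finType) (i j : I) : (delta i : vec k I) j = (j == i)%:R.
Proof. by rewrite ffunE. Qed.

Lemma group_mulr_delta (A : finGroupType) (h : vec k A) y t :
  hopf_mul (group_alg A) h (delta y) t = h (t * y^-1)%g.
Proof.
rewrite hopf_mul_coord (bigD1 (t * y^-1)%g) //= (bigD1 y) //=.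
rewrite !deltaE eqxx mulgKV eqxx !mulr1 [X in _ + X + _]big1 ?addr0 => [|y' ne].
  rewrite big1 ?addr0 // => x ne; rewrite big1 // => y' _; rewrite !deltaE.
  case: (y' =P y) => [->|_]; last by rewrite mulr0 mul0r.
  case: (t =P _) => [tE|_]; last by rewrite mulr0.
  by case/eqP: ne; rewrite tE mulgK.
by rewrite deltaE (negPf ne) mulr0 mul0r.
Qed.

Lemma tens_delta (I J : finType) (i : I) (j : J) :
  tens (delta i) (delta j) = delta (i, j) :> vec k (I * J).
Proof. by apply/ffunP=> -[i' j']; rewrite !ffunE /= -natrM mulnb xpair_eqE. Qed.

Lemma tens_map_coord (I J : finType) (f : 'Hom(vec k I, vec k J)) U p q :
  tens_map f U (p, q) = \sum_i \sum_j U (i, j) * (f (delta i) p * f (delta j) q).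
Proof.
rewrite linext_coord pair_bigA /=; apply: eq_bigr => -[i j] _.
by rewrite ffunE.
Qed.

Lemma tens_map_tens (I J : finType) (f : 'Hom(vec k I, vec k J)) u v :
  tens_map f (tens u v) = tens (f u) (f v).
Proof.
apply/ffunP=> -[p q]; rewrite tens_map_coord [RHS]ffunE /= !lfun_coord mulr_suml.
apply: eq_bigr => i _; rewrite mulr_sumr; apply: eq_bigr => j _.
by rewrite ffunE mulrACA.
Qed.

Variable G : finGroupType.
Local Notation DG := (vec k (G * G)%type).

Lemma double_mul_coord (u v : DG) s t :
  hopf_mul (Defs.double G) u v (s, t) =
  \sum_t1 u (s, t1) * v (t1^-1 * s * t1, t1^-1 * t)%g.
Proof.
rewrite hopf_mul_coord sum_pair (bigD1 s) //= [X in _ + X]big1 ?addr0.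
  apply: eq_bigr => t1 _; rewrite (bigD1 (t1^-1 * s * t1, t1^-1 * t)%g) //=.
  rewrite !ffunE /= !mulgA !mulgV !mul1g mulgK !eqxx.
  rewrite [_ *: _]mulr1 mulr1 big1 ?addr0 // => -[x y] /= ne.
  rewrite !ffunE /=; case: eqP => [e1|]; last by rewrite scale0r mulr0.
  rewrite xpair_eqE eqxx /=; case: eqP => [e2|]; last by rewrite scaler0 mulr0.
  by case/eqP: ne; rewrite -e1 e2 !mulgA !mulVg !mul1g mulgKV.
move=> x xs; rewrite big1 // => y _; rewrite big1 // => -[x' y'] _.
by rewrite !ffunE xpair_eqE [s == x]eq_sym (negPf xs) /= scaler0 mulr0.
Qed.

Lemma double_comul_coord (u : DG) s1 t1 s2 t2 :
  hopf_comul (Defs.double G) u ((s1, t1), (s2, t2)) =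
  (t1 == t2)%:R * u ((s1 * s2)%g, t1).
Proof.
rewrite linext_coord (bigD1 ((s1 * s2)%g, t1)) //= sum_ffunE.
rewrite (bigD1 (s1, s2)) ?eqxx //= deltaE !xpair_eqE !eqxx /= eq_sym.
rewrite [X in _ * (_ + X)]big1 ?addr0 => [|[q1 q2] /andP[_]]; last first.
  rewrite deltaE => ne; case: eqP => // -[e1 e2 _].
  by case/eqP: ne; rewrite e1 e2.
rewrite mulrC big1 ?addr0 // => -[x y] ne; rewrite sum_ffunE big1 ?mulr0 //.
move=> -[q1 q2] /= /eqP qx; rewrite deltaE; case: eqP => // -[e1 e2 e3 e4].
by case/eqP: ne; rewrite -qx e1 e3 e2.
Qed.

Lemma double_counitE (u : DG) :
  hopf_counit (Defs.double G) u = \sum_t u (1%g, t).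
Proof.
rewrite /hopf_counit linextE sum_pair (bigD1 1%g) //= [X in _ + X]big1 ?addr0.
  by apply: eq_bigr => t _; rewrite eqxx [_ *: _]mulr1.
by move=> x x1; rewrite big1 // => y _; rewrite (negPf x1) scaler0.
Qed.

Lemma double_antipode_coord (u : DG) s t :
  hopf_antipode (Defs.double G) u (s, t) = u (t^-1 * s^-1 * t, t^-1)%g.
Proof.
rewrite linext_coord (bigD1 (t^-1 * s^-1 * t, t^-1)%g) //= ffunE.
rewrite xpair_eqE !invgK !invMg !invgK eqxx !mulgA mulgV mul1g mulgK eqxx mulr1.
rewrite big1 ?addr0 // => -[x y] ne; rewrite ffunE /=; case: eqP => [[e1 e2]|]; last by rewrite mulr0.
by case/eqP: ne; rewrite e1 e2 !invMg !invgK !mulgA mulgV mul1g mulgK.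
Qed.

Lemma double_one_coord s t :
  hopf_one (Defs.double (k := k) G) (s, t) = (t == 1%g)%:R.
Proof.
rewrite sum_ffunE (bigD1 s) //= ffunE xpair_eqE eqxx big1 ?addr0 // => x xs.
by rewrite ffunE xpair_eqE eq_sym (negPf xs).
Qed.

Lemma double_mul_tens (f f' : vec k G) y y' :
  hopf_mul (Defs.double G) (tens f (delta y)) (tens f' (delta y')) =
  tens [ffun s => f s * f' (y^-1 * s * y)%g : k^o] (delta (y * y')%g).
Proof.
apply/ffunP=> -[s t]; rewrite double_mul_coord (bigD1 y) //= big1 ?addr0.
  rewrite !ffunE /= eqxx mulr1 mulrA; congr (_ * (nat_of_bool _)%:R).
  by rewrite -(inj_eq (mulgI y)) mulKVg.
by move=> t1 t1y; rewrite !ffunE /= (negPf t1y) mulr0 mul0r.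
Qed.

End Coordinates.

(** * Matrix form of Hopf automorphisms *)

(** Idempotents of a field are 0 or 1; orthogonality allows at most one 1 and the sum requires one.
    Applied to families of coefficients, this extracts maps of groups from a linear map. *)
Lemma orthogonal_idempotents (k : fieldType) (T : finType) (a : T -> k) :
  (forall t1 t2, a t1 * a t2 = (t1 == t2)%:R * a t1) -> \sum_t a t = 1 ->
  exists t0, forall t, a t = (t == t0)%:R.
Proof.
move=> orth sum1.
have [t0 at0] : exists t0, a t0 != 0.
  apply/existsP; apply: contraT; rewrite negb_exists => /forallP a0.
  have := oner_neq0 k; rewrite -sum1 big1 ?eqxx // => t _.
  by apply/eqP; have := a0 t; rewrite negbK.
have a1 : a t0 = 1.
  by apply: (mulfI at0); rewrite orth eqxx mul1r mulr1.
exists t0 => t; have [->|ne] := eqVneq t t0; first by rewrite a1.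
have := orth t0 t; rewrite a1 mul1r => ->; by rewrite eq_sym (negPf ne) mul0r.
Qed.

Lemma sum_eq_mul (k : pzSemiRingType) (T : finType) (x0 : T) (F : T -> k) :
  \sum_x (x == x0)%:R * F x = F x0.
Proof.
rewrite (bigD1 x0) //= eqxx mul1r big1 ?addr0 // => x /negPf->.
by rewrite mul0r.
Qed.

Section Classification.

Variables (k : closedFieldType) (G : finGroupType).
Hypothesis char0 : [pchar k] =i pred0.

Local Notation DG := (vec k (G * G)%type).
Local Notation Z := ('Z([set: G])%g).
Local Notation subgZ := (subg_of 'Z([set: G])%G).
Local Notation X := (character k subgZ).

Local Notation dd x y := (@delta k (G * G)%type (x, y)).

(** The isotypic component of [psi] for translation by the center. The entry a factors through
    restriction to the center, so on such a function it contributes the single group element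
    [al psi] and formulas contain no sums. *)
Definition homog (psi : X) (f : vec k G) :=
  forall x (z : subgZ), f (x * sgval z)%g = f x * psi z.

(** The entry u acts on functions by composition with [w]. The field [nf_wv] expresses compatibility
    with the conjugation action: [w] inverts [v] modulo the center. *)
Record normal_form (phi : 'End(DG)) (w : G -> G) (b : G -> character k G)
    (al : X -> G) (v : G -> G) : Prop := NormalForm {
  nf_wM : is_hom w;
  nf_bM : is_hom b;
  nf_alM : is_hom al;
  nf_vM : is_hom v;
  nf_alZ : forall psi, al psi \in Z;
  nf_wZ : forall z, z \in Z -> w z \in Z;
  nf_wv : forall g, (w (v g) * g^-1)%g \in Z;
  nf_E : forall psi f y, homog psi f -> phi (tens f (delta y)) =
    tens [ffun s => f (w s) * b y s : k^o] (delta (al psi * v y)%g)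
}.

Lemma comul_delta (x y : G) : hopf_comul (Defs.double G) (delta (x, y)) =
  \sum_x1 tens (dd x1 y) (dd (x1^-1 * x)%g y).
Proof.
apply/ffunP=> -[[s1 t1] [s2 t2]]; rewrite double_comul_coord sum_ffunE.
rewrite (bigD1 s1) //= [X in _ + X]big1 ?addr0.
  rewrite !ffunE /= !xpair_eqE eqxx /= -(inj_eq (mulgI s1) s2) mulKVg.
  case: (t1 =P y) => [->|_]; rewrite ?andbF ?mulr0 ?mul0r // andbT mul1r.
  by rewrite mulrC -natrM mulnb [y == _]eq_sym.
by move=> x1 ne; rewrite !ffunE /= xpair_eqE eq_sym (negPf ne) mul0r.
Qed.

Variable phi : 'End(DG).
Hypothesis aut : hopf_aut phi.

(** * Structure constants of an automorphism *)

Let Phi (x y s t : G) : k := phi (delta (x, y)) (s, t).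

Let cm (x y s1 t1 s2 t2 : G) :
  (t1 == t2)%:R * Phi x y (s1 * s2)%g t1 =
  \sum_x1 Phi x1 y s1 t1 * Phi (x1^-1 * x)%g y s2 t2.
Proof.
case: aut => -[_ _ /(_ (delta (x, y))) cmE _ _] _.
move/ffunP/(_ ((s1, t1), (s2, t2))): cmE; rewrite double_comul_coord => ->.
rewrite comul_delta linear_sum sum_ffunE; apply: eq_bigr => x1 _.
by rewrite /= tens_map_tens ffunE.
Qed.

Let un (s t : G) : \sum_x Phi x 1%g s t = (t == 1%g)%:R.
Proof.
case: aut => -[_ /ffunP/(_ (s, t)) + _ _ _] _.
by rewrite double_one_coord linear_sum sum_ffunE => <-.
Qed.

Let cu (x y : G) : \sum_t Phi x y 1%g t = (x == 1%g)%:R.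
Proof.
case: aut => -[_ _ _ /(_ (delta (x, y))) + _] _.
rewrite double_counitE => ->; rewrite double_counitE (bigD1 y) //= big1 ?addr0.
  by rewrite deltaE xpair_eqE eqxx andbT eq_sym.
by move=> t ty; rewrite deltaE xpair_eqE (negPf ty) andbF.
Qed.

Let ml (x y x' y' s t : G) :
  (y * x' * y^-1 == x)%g%:R * Phi x (y * y')%g s t =
  \sum_t1 Phi x y s t1 * Phi x' y' (t1^-1 * s * t1)%g (t1^-1 * t)%g.
Proof.
case: aut => -[/(_ (delta (x, y)) (delta (x', y'))) + _ _ _ _] _.
move/ffunP/(_ (s, t)); rewrite double_mul_coord => <-.
rewrite -!tens_delta double_mul_tens lfun_coord sum_pair (bigD1 x) //=.
rewrite (bigD1 (y * y')%g) //= [X in _ + X]big1 => [|u ux]; last first.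
  by rewrite big1 // => u' _; rewrite !ffunE /= (negPf ux) !mul0r.
rewrite [X in _ + X + _]big1 => [|u uy]; last first.
  by rewrite !ffunE /= (negPf uy) mulr0 mul0r.
rewrite !addr0 !ffunE /= !eqxx mul1r mulr1; congr ((nat_of_bool _)%:R * _).
apply/eqP/eqP=> <-; first by rewrite !mulgA mulVg mul1g mulgKV.
by rewrite !mulgA mulgV mul1g mulgK.
Qed.

Let injc (c : G -> k) :
  (forall s t, \sum_x c x * Phi x 1%g s t = 0) -> forall x, c x = 0.
Proof.
move=> c0 x; pose u : DG := tens [ffun x => c x : k^o] (delta 1%g).
have u0 : u = 0.
  case: aut => _ /bij_inj inj; apply: inj; rewrite linear0; apply/ffunP=> -[s t].
  rewrite [RHS]ffunE -(c0 s t) lfun_coord sum_pair; apply: eq_bigr => x1 _.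
  rewrite (bigD1 1%g) //= big1 ?addr0 => [|y y1]; rewrite !ffunE /=.
    by rewrite eqxx mulr1.
  by rewrite (negPf y1) mulr0 mul0r.
by have /ffunP/(_ (x, 1%g)) := u0; rewrite !ffunE /= eqxx mulr1.
Qed.

(** * The entry from k^G to kG *)

Let E (t x : G) := Phi x 1%g 1%g t.

Let Ecm (t1 t2 x : G) : \sum_x1 E t1 x1 * E t2 (x1^-1 * x)%g = (t1 == t2)%:R * E t1 x.
Proof. by have := cm x 1%g 1%g t1 1%g t2; rewrite mulg1 => <-. Qed.

(** [cm] with either point equal to 1 computes the same coefficient by convolution from the left and
    from the right, so the difference is annihilated by all coefficients of phi on k^G. Injectivity
    makes it zero: [E t], seen in kG, is central. *)
Let Ecl (t x y : G) : E t (x * y^-1)%g = E t (y^-1 * x)%g.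
Proof.
apply/eqP; rewrite -subr_eq0; apply/eqP.
apply: (injc (c := fun y => E t (x * y^-1)%g - E t (y^-1 * x)%g)) => s t'.
under eq_bigr do rewrite mulrBl; rewrite sumrB; apply/eqP; rewrite subr_eq0.
have := cm x 1%g s t' 1%g t; rewrite mulg1 => eqR.
have := cm x 1%g 1%g t s t'; rewrite mul1g => eqL.
under [eqbRHS]eq_bigr do rewrite mulrC.
rewrite -eqR (reindex_inj (inj_comp (mulIg x) invg_inj)) /=.
under eq_bigr => u _ do rewrite invMg invgK mulKVg.
by apply/eqP; rewrite -eqL eq_sym; case: eqP => [->|_]; rewrite ?mul0r.
Qed.

Let Econj (t x g : G) : E t (g * x * g^-1)%g = E t x.
Proof. by rewrite Ecl mulKg. Qed.

Let Eidem (t x x' : G) :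
  \sum_t1 E t1 x * E (t1^-1 * t)%g x' = (x' == x)%:R * E t x.
Proof.
have := ml x 1%g x' 1%g 1%g t; rewrite mul1g invg1 !mulg1 => ->.
by apply: eq_bigr => t1 _; rewrite mulg1 mulVg.
Qed.

(** If a conjugate x' of x differs from x, then e_x e_x' = 0; conjugation invariance evaluates the
    image of this product as if x' were x, and the result is [E t x]. *)
Let EZ (t x : G) : E t x != 0 -> x \in Z.
Proof.
move=> Etx; apply/centerTP=> g; apply/eqP; rewrite eq_sym.
rewrite -(inj_eq (mulIg g^-1)%g) mulgK; apply: contraNT Etx => /negPf ne.
have := Eidem t x (g * x * g^-1)%g; rewrite ne mul0r => eq0.
have := Eidem t x x; rewrite eqxx mul1r => <-; rewrite -[X in _ == X]eq0.
by apply/eqP/eq_bigr => t1 _; rewrite Econj.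
Qed.

(** * Images of the group elements *)

Let U (g s t : G) : k := \sum_x Phi x g s t.

Let cmU (g s1 t1 s2 t2 : G) :
  U g s1 t1 * U g s2 t2 = (t1 == t2)%:R * U g (s1 * s2)%g t1.
Proof.
rewrite [RHS]mulr_sumr; under [RHS]eq_bigr do rewrite cm.
rewrite exchange_big mulr_suml; apply: eq_bigr => x1 _ /=.
rewrite -mulr_sumr; congr (_ * _).
by rewrite /U (reindex_inj (mulgI x1^-1)%g).
Qed.

Let exv : exists v : G -> G, forall g t, U g 1%g t = (t == v g)%:R.
Proof.
suff /fin_all_exists[v vE] (g : G) : exists v, forall t, U g 1%g t = (t == v)%:R.
  by exists v.
apply: orthogonal_idempotents.
  by move=> t1 t2; rewrite cmU mulg1.
rewrite exchange_big (bigD1 1%g) //= [X in _ + X]big1 ?addr0 => [|x x1].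
  by rewrite cu eqxx.
by rewrite cu (negPf x1).
Qed.

Section WithV.

Variable v : G -> G.
Hypothesis vE : forall g t, U g 1%g t = (t == v g)%:R.

Let UE (g s t : G) : U g s t = (t == v g)%:R * U g s (v g).
Proof.
have := cmU g s t 1%g (v g); rewrite vE eqxx mulr1 mulg1 => ->.
by case: eqP => [->|_]; rewrite ?mul0r.
Qed.

Let Umul (g h s t : G) :
  U (g * h)%g s t = \sum_t1 U g s t1 * U h (t1^-1 * s * t1)%g (t1^-1 * t)%g.
Proof.
transitivity (\sum_x \sum_x' \sum_t1
    Phi x g s t1 * Phi x' h (t1^-1 * s * t1)%g (t1^-1 * t)%g); last first.
  under eq_bigr do rewrite exchange_big /=.
  rewrite exchange_big /=; apply: eq_bigr => t1 _.
  by rewrite mulr_suml; apply: eq_bigr => x _; rewrite mulr_sumr.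
apply: eq_bigr => x _; under eq_bigr do rewrite -ml.
rewrite (bigD1 (g^-1 * x * g)%g) //= !mulgA mulgV mul1g mulgK eqxx mul1r.
rewrite big1 ?addr0 // => x' ne; case: eqP => [eqx|_]; last by rewrite mul0r.
by case/eqP: ne; rewrite -eqx !mulgA mulVg mul1g mulgKV.
Qed.

Let vM : is_hom v.
Proof.
move=> g h; apply/esym/eqP.
have := Umul g h 1%g (v g * v h)%g; rewrite vE (bigD1 (v g)) //= big1 ?addr0.
  rewrite mulg1 mulVg mulKg !vE !eqxx mulr1.
  by case: eqP => // _ /eqP; rewrite eq_sym oner_eq0.
by move=> t1 ne; rewrite vE (negPf ne) mul0r.
Qed.

Let exb : exists b : G -> character k G, is_hom b /\
  forall g s t, U g s t = (t == v g)%:R * b g s.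
Proof.
have /fin_all_exists[b bE] g : exists c : character k G, forall s, c s = U g s (v g).
  have [|x y|c cE] := mk_char (k := k) (f := fun s => U g s (v g)).
  - by rewrite vE eqxx.
  - by rewrite cmU eqxx mul1r.
  by exists c.
have bU g s t : U g s t = (t == v g)%:R * b g s by rewrite UE bE.
exists b; split=> // g h; apply/Defs.charP=> s; rewrite charME.
have := Umul g h s (v g * v h)%g; rewrite (bigD1 (v g)) //= big1 ?addr0.
  rewrite !bU vM mulKg !eqxx !mul1r => ->; congr (_ * _).
  by rewrite !Defs.charM mulrAC -Defs.charM mulVg Defs.char1 mul1r.
by move=> t1 ne; rewrite bU (negPf ne) !mul0r.
Qed.

Section WithB.

Variable b : G -> character k G.
Hypotheses (bM : is_hom b) (bU : forall g s t, U g s t = (t == v g)%:R * b g s).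

Let bconj g s t : b g (t^-1 * s * t)%g = b g s.
Proof. by rewrite !Defs.charM mulrAC -Defs.charM mulVg Defs.char1 mul1r. Qed.

(** Multiplicativity for e_x times g, in this order; [PhiL] uses the opposite order, and comparing
    the two gives [Phiconj]. *)
Let PhiR x g s t : Phi x g s t = Phi x 1%g s (t * (v g)^-1)%g * b g s.
Proof.
transitivity (\sum_t1 Phi x 1%g s t1 * U g (t1^-1 * s * t1)%g (t1^-1 * t)%g).
  under eq_bigr do rewrite mulr_sumr.
  rewrite exchange_big /=; under eq_bigr do rewrite -ml mul1g invg1 mulg1 mul1g.
  by rewrite sum_eq_mul.
rewrite (bigD1 (t * (v g)^-1)%g) //= big1 ?addr0 => [|t1 ne].
  by rewrite bU bconj invMg invgK mulgKV eqxx mul1r.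
rewrite bU; case: eqP => [eqv|_]; last by rewrite mul0r mulr0.
by case/eqP: ne; rewrite -eqv invMg invgK mulKVg.
Qed.

Let PhiL x g s t :
  Phi (g * x * g^-1)%g g s t = b g s * Phi x 1%g ((v g)^-1 * s * v g)%g ((v g)^-1 * t)%g.
Proof.
transitivity (\sum_t1 U g s t1 * Phi x 1%g (t1^-1 * s * t1)%g (t1^-1 * t)%g).
  under eq_bigr do rewrite mulr_suml.
  rewrite exchange_big /=; under eq_bigr => x0 _ do rewrite -ml mulg1 eq_sym.
  by rewrite sum_eq_mul.
rewrite (bigD1 (v g)) //= big1 ?addr0 => [|t1 ne]; first by rewrite bU eqxx mul1r.
by rewrite bU (negPf ne) !mul0r.
Qed.

Let Phiconj x g s t : Phi (g * x * g^-1)%g 1%g s (t * (v g)^-1)%g =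
  Phi x 1%g ((v g)^-1 * s * v g)%g ((v g)^-1 * t)%g.
Proof.
by apply: (mulIf (char_neq0 (b g) s)); rewrite -PhiR PhiL mulrC.
Qed.

Let Evconj t x g : E ((v g)^-1 * t)%g x = E (t * (v g)^-1)%g x.
Proof.
by have := Phiconj x g 1%g t; rewrite mulg1 mulVg -/(E _ _) -/(E _ _) Econj.
Qed.

(** [Evconj] covers only [t0] in the image of [v]. A preimage under phi of the basis vector at
    [(1, t0)] expresses the delta function at [t0] through translates of [E] by elements [v y]; the
    additional factors [E] are absorbed by [Eidem]. *)
Let Etconj t0 t x : E (t0^-1 * t)%g x = E (t * t0^-1)%g x.
Proof.
have [psi _ psiK] := aut.2; pose u := psi (dd 1%g t0).
have uE t' : \sum_x \sum_y u (x, y) * E (t' * (v y)^-1)%g x = (t' == t0)%:R.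
  have := psiK (dd 1%g t0); move/ffunP/(_ (1%g, t')).
  rewrite deltaE xpair_eqE eqxx /= lfun_coord sum_pair => <-.
  apply: eq_bigr => x' _; apply: eq_bigr => y _; congr (_ * _).
  by rewrite -/(Phi _ _ _ _) PhiR Defs.char1 mulr1.
transitivity (\sum_t1 (t1 == t0)%:R * E (t1^-1 * t)%g x); first by rewrite sum_eq_mul.
transitivity (\sum_t1 (t1 == t0)%:R * E (t * t1^-1)%g x); last by rewrite sum_eq_mul.
under eq_bigr do rewrite -uE mulr_suml.
under [RHS]eq_bigr do rewrite -uE mulr_suml.
rewrite exchange_big [RHS]exchange_big; apply: eq_bigr => x1 _ /=.
under eq_bigr do rewrite mulr_suml.
under [RHS]eq_bigr do rewrite mulr_suml.
rewrite exchange_big [RHS]exchange_big; apply: eq_bigr => y _ /=.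
under eq_bigr do rewrite -mulrA.
under [RHS]eq_bigr do rewrite -mulrA.
rewrite -!mulr_sumr; congr (_ * _).
rewrite (reindex_inj (mulIg (v y))) [RHS](reindex_inj (mulIg (v y))) /=.
under eq_bigr do rewrite mulgK invMg -mulgA Evconj.
under [RHS]eq_bigr do rewrite mulgK invMg mulgA.
under eq_bigr do rewrite -mulgA.
rewrite Eidem.
rewrite (reindex_inj (inj_comp (mulIg (t * (v y)^-1)%g) invg_inj)) /=.
under eq_bigr do rewrite invMg invgK mulKVg mulrC.
by rewrite Eidem [x == x1]eq_sym; case: eqP => [->|_]; rewrite ?mul0r.
Qed.

Let EtZ t x : E t x != 0 -> t \in Z.
Proof.
move=> Etx; apply/centerTP=> g; apply/eqP; rewrite eq_sym.
rewrite -(inj_eq (mulIg g^-1)%g) mulgK; apply: contraNT Etx => /negPf ne.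
have := Ecm t (g * t * g^-1)%g x; rewrite eq_sym ne mul0r => eq0.
have := Ecm t t x; rewrite eqxx mul1r => <-; rewrite -[X in _ == X]eq0.
by apply/eqP/eq_bigr => x1 _; rewrite -Etconj mulKg.
Qed.

(** * The entry from k^G to itself *)

Let W (s x : G) : k := \sum_t Phi x 1%g s t.

Let PhiW x s t : Phi x 1%g s t = \sum_x1 W s x1 * E t (x1^-1 * x)%g.
Proof.
under eq_bigr do rewrite mulr_suml.
rewrite exchange_big /=.
under eq_bigr => t1 _ do rewrite -cm mulg1.
rewrite (bigD1 t) //= eqxx mul1r big1 ?addr0 // => t1 /negPf->.
by rewrite mul0r.
Qed.

Let PhitZ x s t : Phi x 1%g s t != 0 -> t \in Z.
Proof.
rewrite PhiW => ne; have /existsP[x1 ne1] : [exists x1, E t (x1^-1 * x)%g != 0].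
  apply: contraNT ne; rewrite negb_exists => /forallP E0.
  by rewrite big1 // => x1 _; have := E0 x1; rewrite negbK => /eqP->; rewrite mulr0.
exact: EtZ ne1.
Qed.

Let Widem s x x' : W s x * W s x' = (x == x')%:R * W s x.
Proof.
rewrite mulr_suml; under eq_bigr do rewrite mulr_sumr.
transitivity (\sum_t1 \sum_t Phi x 1%g s t1 * Phi x' 1%g (t1^-1 * s * t1)%g (t1^-1 * t)%g).
  apply: eq_bigr => t1 _; rewrite (reindex_inj (mulgI t1^-1)%g) /=.
  apply: eq_bigr => t _; have [->|/PhitZ t1Z] := eqVneq (Phi x 1%g s t1) 0.
    by rewrite !mul0r.
  by rewrite -mulgA -(centerTC s t1Z) mulKg.
rewrite exchange_big /= mulr_sumr; apply: eq_bigr => t _.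
by rewrite -ml mul1g invg1 !mulg1 eq_sym.
Qed.

Let exw : exists w : G -> G, forall s x, W s x = (x == w s)%:R.
Proof.
suff /fin_all_exists[w wE] (s : G) : exists w, forall x, W s x = (x == w)%:R.
  by exists w.
apply: orthogonal_idempotents => //.
rewrite exchange_big /=; under eq_bigr do rewrite un.
by rewrite (bigD1 1%g) //= eqxx big1 ?addr0 // => t /negPf->.
Qed.

Section WithW.

Variable w : G -> G.
Hypothesis wE : forall s x, W s x = (x == w s)%:R.

Let PhiE x s t : Phi x 1%g s t = E t ((w s)^-1 * x)%g.
Proof. by rewrite PhiW; under eq_bigr do rewrite wE; rewrite sum_eq_mul. Qed.

Let wM : is_hom w.
Proof.
move=> s1 s2; apply/esym/eqP.
have : \sum_x1 W s1 x1 * W s2 (x1^-1 * (w s1 * w s2))%g = W (s1 * s2)%g (w s1 * w s2)%g.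
  under eq_bigr do rewrite mulr_suml.
  rewrite exchange_big /=; apply: eq_bigr => t1 _.
  under eq_bigr do rewrite mulr_sumr.
  rewrite exchange_big /=; under eq_bigr do rewrite -cm.
  rewrite (bigD1 t1) //= eqxx mul1r big1 ?addr0 // => t ne.
  by rewrite eq_sym (negPf ne) mul0r.
under eq_bigr do rewrite wE; rewrite sum_eq_mul mulKg !wE eqxx.
by case: eqP => // _ /eqP; rewrite oner_eq0.
Qed.

Let wconj g s : w ((v g)^-1 * s * v g)%g = (g^-1 * w s * g)%g.
Proof.
have : W ((v g)^-1 * s * v g)%g (g^-1 * w s * g)%g = W s (w s).
  rewrite /W (reindex_inj (mulgI (v g)^-1)%g) [RHS](reindex_inj (mulIg (v g)^-1)%g) /=.
  apply: eq_bigr => t _; rewrite -Phiconj; congr (Phi _ _ _ _).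
  by rewrite !mulgA mulgV mul1g mulgK.
rewrite !wE eqxx; case: eqP => // _ /eqP; by rewrite eq_sym oner_eq0.
Qed.

(** Otherwise [PhiE] and the central support of [E] would make phi vanish on the basis function at
    [g]. *)
Let wZ_cover g : exists s, ((w s)^-1 * g)%g \in Z.
Proof.
apply/existsP; apply: contraT; rewrite negb_exists => /forallP noZ.
suff /(_ g)/eqP : forall x, (x == g)%:R = 0 :> k by rewrite eqxx oner_eq0.
apply: injc => s t; rewrite sum_eq_mul PhiE.
by apply/eqP; apply: contraTT (noZ s) => /EZ ->.
Qed.

Let commw_center g : (forall s, (g * w s = w s * g)%g) -> g \in Z.
Proof.
move=> gw; apply/centerTP=> x; have [s sZ] := wZ_cover x.
rewrite -(mulKVg (w s) x); move: ((w s)^-1 * x)%g sZ => y yZ.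
by rewrite mulgA gw -!mulgA (centerTC g yZ).
Qed.

Let wZ z : z \in Z -> w z \in Z.
Proof. by move=> zZ; apply: commw_center => s; rewrite -!wM (centerTC _ zZ). Qed.

Let wv g : (w (v g) * g^-1)%g \in Z.
Proof.
apply: commw_center => s; have := wconj g s; rewrite !wM homV // => eqw.
have ws : (w s * w (v g) = w (v g) * (g^-1 * w s * g))%g.
  by rewrite -eqw !mulgA mulgV mul1g.
by rewrite [RHS]mulgA ws !mulgA mulgK.
Qed.

(** Fourier transform of [E t] on the center: idempotents for convolution become scalar idempotents,
    so for each [psi] exactly one [t] survives. *)
Let ev (psi : X) (t : G) : k := \sum_(z : subgZ) psi z * E t (sgval z).

Let sumZ (F : G -> k) : (forall x, x \notin Z -> F x = 0) ->
  \sum_x F x = \sum_(z : subgZ) F (sgval z).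
Proof.
move=> F0; rewrite (bigID (mem Z)) /= [X in _ + X]big1 // addr0.
rewrite (reindex (fun z : subgZ => sgval z)) /=; first by apply: eq_bigl => z; rewrite subgP.
exists (subg _) => [z _|x Zx]; first exact: sgvalK.
by rewrite subgK.
Qed.

Let E0 t x : x \notin Z -> E t x = 0.
Proof. by move=> xZ; apply/eqP; apply: contraNT xZ => /EZ. Qed.

Let ev_orth psi t1 t2 : ev psi t1 * ev psi t2 = (t1 == t2)%:R * ev psi t1.
Proof.
pose P (z x : subgZ) := psi (z * x)%g * (E t1 (sgval z) * E t2 (sgval x)).
transitivity (\sum_z \sum_x P z x).
  rewrite mulr_suml; apply: eq_bigr => z _; rewrite mulr_sumr.
  by apply: eq_bigr => x _; rewrite /P Defs.charM mulrACA.
transitivity (\sum_z \sum_x P x (x^-1 * z)%g).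
  rewrite [RHS]exchange_big /=; apply: eq_bigr => z _.
  by rewrite (reindex_inj (mulgI z^-1)%g).
rewrite [RHS]mulr_sumr; apply: eq_bigr => z _; rewrite mulrCA -Ecm mulr_sumr.
rewrite (sumZ (F := fun x => psi z * (E t1 x * E t2 (x^-1 * sgval z)%g))).
  by apply: eq_bigr => x _; rewrite /P mulKVg.
by move=> x /E0 ->; rewrite mul0r mulr0.
Qed.

Let exal : exists al : X -> G, forall psi t, ev psi t = (t == al psi)%:R.
Proof.
suff /fin_all_exists[al alE] (psi : X) : exists a, forall t, ev psi t = (t == a)%:R.
  by exists al.
apply: orthogonal_idempotents => //.
rewrite exchange_big /=; under eq_bigr do rewrite -mulr_sumr cu.
rewrite (bigD1 1%g) //= eqxx mulr1 Defs.char1 big1 ?addr0 // => z ne.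
rewrite (_ : sgval z == 1%g = false) ?mulr0 //; apply/negP=> /eqP z1.
by case/eqP: ne; apply: val_inj.
Qed.

Lemma classification_w : exists al, normal_form phi w b al v.
Proof.
have [al alE] := exal; exists al.
have alZ psi : al psi \in Z.
  have : ev psi (al psi) != 0 by rewrite alE eqxx oner_eq0.
  apply: contraNT => alZ; rewrite /ev big1 // => z _.
  rewrite (_ : E _ _ = 0) ?mulr0 //; apply/eqP; apply: contraNT alZ; exact: EtZ.
split=> // [psi psi'|psi f y hf].
  apply/esym/eqP.
  suff : ev (psi * psi')%g (al psi * al psi')%g = 1.
    by rewrite alE; case: eqP => // _ /eqP; rewrite eq_sym oner_eq0.
  transitivity (\sum_t1 ev psi t1 * ev psi' (t1^-1 * (al psi * al psi'))%g); last first.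
    under eq_bigr do rewrite alE.
    by rewrite sum_eq_mul mulKg alE eqxx.
  under [RHS]eq_bigr do rewrite mulr_suml.
  rewrite [RHS]exchange_big /=; apply: eq_bigr => z _.
  under [RHS]eq_bigr do rewrite mulr_sumr.
  rewrite [RHS]exchange_big /=.
  under [RHS]eq_bigr do (under eq_bigr do rewrite mulrACA; rewrite -mulr_sumr Eidem mulrCA).
  rewrite (bigD1 z) //= eqxx mul1r [X in _ + X]big1 ?addr0 ?charME // => z' ne.
  rewrite (_ : sgval z' == sgval z = false) ?mul0r //; apply/negP=> /eqP eqz.
  by case/eqP: ne; apply: val_inj.
apply/ffunP=> -[s t]; rewrite lfun_coord sum_pair [RHS]ffunE /= deltaE ffunE.
transitivity (\sum_x f x * Phi x y s t).
  apply: eq_bigr => x _; rewrite (bigD1 y) //= big1 ?addr0 => [|y' ne].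
    by rewrite ffunE /= deltaE eqxx mulr1.
  by rewrite ffunE /= deltaE (negPf ne) mulr0 mul0r.
under eq_bigr do rewrite PhiR PhiE mulrCA mulrA.
rewrite -mulr_suml (reindex_inj (mulgI (w s))) /=.
under eq_bigr do rewrite mulKg.
rewrite (sumZ (F := fun x => E (t * (v y)^-1)%g x * f (w s * x)%g)); last first.
  by move=> x /E0 ->; rewrite mul0r.
transitivity (f (w s) * ev psi (t * (v y)^-1)%g * b y s).
  congr (_ * _); rewrite /ev mulr_sumr; apply: eq_bigr => z _.
  by rewrite hf mulrC mulrA.
rewrite alE mulrAC; congr (_ * (nat_of_bool _)%:R).
by rewrite -(inj_eq (mulIg (v y))) mulgKV.
Qed.

End WithW.

Lemma classification_b : exists w al, normal_form phi w b al v.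
Proof. by have [w wE] := exw; exists w; apply: classification_w. Qed.

End WithB.

Lemma classification_v : exists w b al, normal_form phi w b al v.
Proof.
have [b [bM bU]] := exb; have [w [al nf]] := classification_b bM bU.
by exists w, b, al.
Qed.

End WithV.

Theorem hopf_aut_normal_form : exists w b al v, normal_form phi w b al v.
Proof.
have [v vE] := exv; have [w [b [al nf]]] := classification_v vE.
by exists w, b, al, v.
Qed.

End Classification.

(** * Matrix forms define Hopf morphisms *)

Section LinearMaps.

Variable k : closedFieldType.

Lemma lfun_injK (V W : vectType k) (f : 'Hom(V, W)) :
  injective f -> cancel f (f^-1)%VF.
Proof.
by move=> fI; apply: lker0_lfunK; apply/lker0P.
Qed.

Lemma lfun_bijK (V W : vectType k) (f : 'Hom(V, W)) :
  bijective f -> cancel (f^-1)%VF f.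
Proof.
move=> fB u; have [g fK gK] := fB; rewrite -(gK u).
by rewrite (lfun_injK (bij_inj fB)).
Qed.

Lemma lfun_surj_bij (V : vectType k) (f : 'End(V)) :
  (forall u, exists u', f u' = u) -> bijective f.
Proof.
move=> fS; have fI : injective f.
  apply/lker0P.
  have := limg_ker_dim f fullv; rewrite capfv.
  have -> : limg f = fullv.
    apply/vspaceP=> u; rewrite memvf; have [u' <-] := fS u.
    by apply/memv_imgP; exists u'; rewrite ?memvf.
  by move/eqP; rewrite -{2}[\dim fullv]add0n eqn_add2r dimv_eq0.
exists (f^-1)%VF; first exact: lfun_injK.
by move=> u; have [u' <-] := fS u; rewrite lfun_injK.
Qed.

Lemma lfun_vec_ext (I : finType) (W : vectType k) (f g : 'Hom(vec k I, W)) :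
  (forall i, f (delta i) = g (delta i)) -> f = g.
Proof.
move=> fg; apply/lfunP=> u; rewrite (vec_sum_delta u) !linear_sum.
by apply: eq_bigr => i _; rewrite !linearZ /= fg.
Qed.

Lemma tens_map_comp (I J L : finType) (f : 'Hom(vec k J, vec k L))
    (g : 'Hom(vec k I, vec k J)) u :
  tens_map (f \o g)%VF u = tens_map f (tens_map g u).
Proof.
suff -> : tens_map (f \o g)%VF = (tens_map f \o tens_map g)%VF by rewrite comp_lfunE.
apply: lfun_vec_ext => -[i j]; rewrite comp_lfunE -tens_delta !tens_map_tens.
by rewrite !comp_lfunE.
Qed.

Lemma tens_map_id (I : finType) u : tens_map (\1%VF : 'End(vec k I)) u = u.
Proof.
suff -> : tens_map (\1%VF : 'End(vec k I)) = \1%VF by rewrite id_lfunE.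
apply: lfun_vec_ext => -[i j].
by rewrite -tens_delta tens_map_tens !id_lfunE.
Qed.

Lemma hopf_isomorphism_comp (I J L : finType) (A : hopf_data k I) (B : hopf_data k J)
    (C : hopf_data k L) f g :
  hopf_isomorphism B C f -> hopf_isomorphism A B g -> hopf_isomorphism A C (f \o g)%VF.
Proof.
move=> [[f1 f2 f3 f4 f5] fB] [[g1 g2 g3 g4 g5] gB]; split; last first.
  by apply: (eq_bij (bij_comp fB gB)) => u; rewrite comp_lfunE.
split=> *; rewrite ?comp_lfunE ?g1 ?f1 ?g2 ?f2 ?f3 ?f4 ?f5 ?g3 ?g4 ?g5 //.
by rewrite tens_map_comp.
Qed.

Lemma hopf_isomorphism_id (I : finType) (A : hopf_data k I) :
  hopf_isomorphism A A \1%VF.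
Proof.
split; last by exists id => u; rewrite id_lfunE.
by split=> *; rewrite ?id_lfunE // tens_map_id.
Qed.

Lemma hopf_isomorphism_inv (I J : finType) (A : hopf_data k I) (B : hopf_data k J) f :
  hopf_isomorphism A B f -> hopf_isomorphism B A (f^-1)%VF.
Proof.
move=> [[f1 f2 f3 f4 f5] fB].
have fK := lfun_injK (bij_inj fB); have Kf := lfun_bijK fB.
split; last by exists f.
split.
- by move=> u v; apply: (bij_inj fB); rewrite f1 !Kf.
- by rewrite -f2 fK.
- move=> u; rewrite -{2}(Kf u) f3 -tens_map_comp.
  rewrite (_ : _ \o f = \1)%VF ?tens_map_id //.
  by apply/lfunP=> x; rewrite comp_lfunE id_lfunE fK.
- by move=> u; rewrite -f4 Kf.
by move=> u; apply: (bij_inj fB); rewrite -f5 !Kf.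
Qed.

End LinearMaps.

(** * Isotypic components and sufficiency of the matrix form *)

Section NormalForms.

Variables (k : closedFieldType) (G : finGroupType).
Hypothesis char0 : [pchar k] =i pred0.

Local Notation DG := (vec k (G * G)%type).
Local Notation Z := ('Z([set: G])%g).
Local Notation subgZ := (subg_of 'Z([set: G])%G).
Local Notation X := (character k subgZ).
Local Notation dd x y := (@delta k (G * G)%type (x, y)).

Lemma hopf_aut_comp (f g : 'End(DG)) : hopf_aut f -> hopf_aut g -> hopf_aut (f \o g)%VF.
Proof. exact: hopf_isomorphism_comp. Qed.

Lemma hopf_aut_gen (S : 'End(DG) -> Prop) f :
  (forall g, S g -> hopf_aut g) -> gen_subgroup S f -> hopf_aut f.
Proof.
move=> SA; elim=> [g /SA //||g h _ IHg _ IHh|g _ IHg].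
- exact: hopf_isomorphism_id.
- exact: hopf_aut_comp.
exact: hopf_isomorphism_inv.
Qed.

(** The component of the basis function at [x] in the isotypic part of [psi]; it is supported on the
    coset of the center through [x]. *)
Definition hcomp (psi : X) (x : G) : vec k G :=
  [ffun s => if (x^-1 * s)%g \in Z
             then (#|{: subgZ}|%:R)^-1 * psi (subg _ (x^-1 * s)%g) else 0].

Lemma cardZ_neq0 : #|{: subgZ}|%:R != 0 :> k.
Proof. by apply: natr_neq0 => //; apply/card_gt0P; exists 1%g. Qed.

Lemma hcomp_homog psi x : homog psi (hcomp psi x).
Proof.
move=> s z; rewrite !ffunE mulgA groupMr ?subgP //.
case: ifP => [sZ|_]; last by rewrite mul0r.
by rewrite subgM ?subgP // sgvalK Defs.charM mulrA.
Qed.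

Lemma sum_hcomp x : \sum_psi hcomp psi x = delta x.
Proof.
apply/ffunP=> s; rewrite sum_ffunE ffunE.
have [sZ|sZ] := boolP ((x^-1 * s)%g \in Z); last first.
  rewrite big1 => [|psi _]; last by rewrite ffunE (negPf sZ).
  case: eqP sZ => // ->; by rewrite mulVg group1.
transitivity (\sum_(psi : X) (#|{: subgZ}|%:R)^-1 * psi (subg _ (x^-1 * s)%g)).
  by apply: eq_bigr => psi _; rewrite ffunE sZ.
have abZ := @abelian_subgZ G.
rewrite -mulr_sumr (sum_chars char0) // (card_characters char0) //.
rewrite mulrCA mulVf ?cardZ_neq0 // mulr1; congr (nat_of_bool _)%:R.
apply/eqP/eqP=> [/(congr1 (@sgval _ _))|->]; last first.
  by apply: val_inj; rewrite /= mulVg subgK ?group1.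
by rewrite subgK //= => /eqP; rewrite -eq_mulVg1 => /eqP->.
Qed.

Lemma homog_expand psi f s : homog psi f -> \sum_x hcomp psi x s * f x = f s.
Proof.
move=> hf; rewrite (bigID (fun x => (x^-1 * s)%g \in Z)) /= [X in _ + X]big1 ?addr0; last first.
  by move=> x /negPf xZ; rewrite ffunE xZ mul0r.
transitivity (\sum_(z : subgZ) (#|{: subgZ}|%:R)^-1 * f s); last first.
  by rewrite sumr_const -(mulr_natl (_ * _)) mulrA mulfV ?cardZ_neq0 ?mul1r.
rewrite (reindex (fun z : subgZ => (s * (sgval z)^-1)%g)) /=.
  apply: eq_big => [z|z _]; first by rewrite invMg invgK mulgKV subgP.
  rewrite ffunE invMg invgK mulgKV subgP sgvalK -mulrA; congr (_ * _).
  by rewrite -[in RHS](mulgKV (sgval z) s) hf mulrC.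
exists (fun x => subg _ (x^-1 * s)%g) => [z _|x xZ].
  by rewrite invMg invgK mulgKV sgvalK.
by rewrite subgK // invMg invgK mulKVg.
Qed.

(** Expands the comultiplication of [f] with homogeneous functions in both tensor factors, so that
    [nf_E] applies to each. *)
Lemma homog_expandM psi f s1 s2 : homog psi f ->
  \sum_x hcomp psi x s1 * f (x * s2)%g = f (s1 * s2)%g.
Proof.
move=> hf; have := @homog_expand psi [ffun x => f (x * s2)%g] s1.
rewrite ffunE => <-; first by apply: eq_bigr => x _; rewrite [X in _ = _ * X]ffunE.
by move=> x z; rewrite !ffunE -mulgA (centerTC s2 (subgP z)) mulgA hf.
Qed.

(** An induction principle: linear identities on DG need checking only where [nf_E] applies. *)
Lemma homog_span (P : DG -> Prop) :
  P 0 -> (forall a u v, P u -> P v -> P (a *: u + v)) ->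
  (forall psi f y, homog psi f -> P (tens f (delta y))) -> forall u, P u.
Proof.
move=> P0 PD Ph u.
have Psum (I : finType) (F : I -> DG) : (forall i, P (F i)) -> P (\sum_i F i).
  move=> PF; elim/big_rec: _ => // i v _ Pv.
  by rewrite -[F i]scale1r; apply: PD.
rewrite (vec_sum_delta u); apply: (Psum) => -[x y].
rewrite -[_ *: _]addr0; apply: PD => //.
suff : P (\sum_psi tens (hcomp psi x) (delta y)).
  congr P; apply/ffunP=> -[s t]; rewrite sum_ffunE [RHS]ffunE xpair_eqE.
  have /ffunP/(_ s) := sum_hcomp x; rewrite sum_ffunE ffunE => eqx.
  under eq_bigr do rewrite ffunE /= deltaE; rewrite -mulr_suml eqx.
  by rewrite -natrM mulnb.
by apply: Psum => psi; apply/Ph/hcomp_homog.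
Qed.

Lemma homog_ext (W : vectType k) (f g : 'Hom(DG, W)) :
  (forall psi h y, homog psi h -> f (tens h (delta y)) = g (tens h (delta y))) ->
  f = g.
Proof.
move=> fg; apply/lfunP=> u; elim/homog_span: u => //; first by rewrite !linear0.
by move=> a u v; rewrite !linearP /= => -> ->.
Qed.

Lemma homog_comul psi f y : homog psi f ->
  hopf_comul (Defs.double G) (tens f (delta y)) =
  \sum_x tens (tens (hcomp psi x) (delta y)) (tens [ffun s => f (x * s)%g] (delta y)).
Proof.
move=> hf; apply/ffunP=> -[[s1 t1] [s2 t2]]; rewrite double_comul_coord sum_ffunE.
transitivity (\sum_x hcomp psi x s1 * f (x * s2)%g * ((t1 == y)%:R * (t2 == y)%:R)).
  rewrite -mulr_suml homog_expandM // !ffunE /=.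
  rewrite mulrCA; congr (_ * _).
  by case: (t1 =P y) => [->|_]; rewrite ?mulr0 ?mul0r // [y == _]eq_sym mulrC.
by apply: eq_bigr => x _; rewrite !ffunE /= mulrACA.
Qed.

Lemma hopf_mul0l (I : finType) (A : hopf_data k I) u : hopf_mul A 0 u = 0.
Proof. by rewrite -{1}(scale0r 0) hopf_mulZl scale0r. Qed.

Lemma hopf_mul0r (I : finType) (A : hopf_data k I) u : hopf_mul A u 0 = 0.
Proof. by rewrite -{1}(scale0r 0) hopf_mulZr scale0r. Qed.

Lemma normal_form_one (phi : 'End(DG)) w b al v (f : vec k G) y :
  normal_form phi w b al v -> homog (1%g : X) f ->
  phi (tens f (delta y)) = tens [ffun s => f (w s) * b y s : k^o] (delta (v y)).
Proof. by move=> nf hf; rewrite (nf_E nf y hf) (hom1 (nf_alM nf)) mul1g. Qed.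

Lemma tens_one : hopf_one (Defs.double (k := k) G) = tens [ffun=> 1 : k^o] (delta 1%g).
Proof. by apply/ffunP=> -[s t]; rewrite double_one_coord !ffunE /= mul1r. Qed.

Lemma homog_one : homog (1%g : X) [ffun=> 1 : k^o].
Proof. by move=> x z; rewrite !ffunE mulr1. Qed.

Lemma char_conj (c : character k G) x y : c (y^-1 * x * y)%g = c x.
Proof. by rewrite !Defs.charM mulrAC -Defs.charM mulVg Defs.char1 mul1r. Qed.

Lemma normal_form_hopf (phi : 'End(DG)) w b al v :
  normal_form phi w b al v -> hopf_morphism (Defs.double G) (Defs.double G) phi.
Proof.
move=> nf; have [wM bM alM vM alZ wZ wv nfE] := nf.
have conjZ a g s : a \in Z -> ((a * g)^-1 * s * (a * g) = g^-1 * s * g)%g.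
  move=> aZ; rewrite -!mulgA -!conjgE conjgM; congr (_ ^ _)%g.
  by rewrite conjgE -(centerTC _ aZ) mulKg.
(* The identity behind multiplicativity and the antipode: both [al psi] and [w (v y) * y^-1] are
   central, so they drop out of the conjugation. *)
have wg psi y s : w ((al psi * v y)^-1 * s * (al psi * v y))%g = (y^-1 * w s * y)%g.
  rewrite conjZ // !wM homV // -{1}[w (v y)](mulgKV y) -{2}[w (v y)](mulgKV y).
  by rewrite conjZ.
split.
- move=> u u'; elim/homog_span: u => [|a u1 u2|psi f y hf].
  + by rewrite !linear0 !hopf_mul0l linear0.
  + by move=> IH1 IH2; rewrite hopf_mulDl hopf_mulZl !linearP /= IH1 IH2 hopf_mulDl hopf_mulZl.
  elim/homog_span: u' => [|a u1 u2|psi' f' y' hf'].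
  + by rewrite !linear0 !hopf_mul0r linear0.
  + by move=> IH1 IH2; rewrite hopf_mulDr hopf_mulZr !linearP /= IH1 IH2 hopf_mulDr hopf_mulZr.
  rewrite double_mul_tens (nfE _ _ y hf) (nfE _ _ y' hf') double_mul_tens.
  rewrite (nfE (psi * psi')%g); last first.
    move=> x z; rewrite !ffunE mulrACA -hf; congr (_ * _).
    rewrite -hf'; congr (f' _).
    by rewrite -!mulgA (centerTC y (subgP z)) !mulgA.
  congr tens.
    apply/ffunP=> s; rewrite !ffunE wg char_conj bM charME mulrACA.
    by rewrite -!mulrA.
  congr delta; rewrite alM vM -!mulgA; congr (_ * _)%g.
  by rewrite !mulgA (centerTC _ (alZ psi')).
- rewrite !tens_one (normal_form_one _ nf homog_one) (hom1 vM); congr tens.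
  by apply/ffunP=> s; rewrite !ffunE (hom1 bM) char1E mulr1.
- elim/homog_span => [|a u1 u2|psi f y hf].
  + by rewrite !linear0.
  + by move=> IH1 IH2; rewrite !linearP /= IH1 IH2.
  rewrite (homog_comul _ hf) linear_sum /=.
  apply/ffunP=> -[[s1 t1] [s2 t2]]; rewrite sum_ffunE.
  have homf x : homog psi [ffun s => f (x * s)%g].
    by move=> s z; rewrite !ffunE mulgA hf.
  under eq_bigr => x _.
    rewrite tens_map_tens (nfE _ _ y (hcomp_homog psi x)) (nfE _ _ y (homf x)).
    over.
  set g := (al psi * v y)%g.
  transitivity (\sum_x hcomp psi x (w s1) * f (x * w s2)%g *
                  (b y s1 * b y s2 * ((t1 == g)%:R * (t2 == g)%:R))).
    rewrite -mulr_suml homog_expandM // (nfE _ _ y hf) double_comul_coord.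
    rewrite !ffunE /= wM Defs.charM -/g; case: (t1 =P g) => [->|_].
      by rewrite mulr1 mul1r [g == _]eq_sym -!mulrA mulrC -!mulrA.
    by rewrite !(mulr0, mul0r).
  apply: eq_bigr => x _; rewrite !ffunE /=.
  by rewrite [X in _ * X = _]mulrACA [LHS]mulrACA !mulrA.
- elim/homog_span => [|a u1 u2|psi f y hf].
  + by rewrite !linear0.
  + by move=> IH1 IH2; rewrite !linearP /= IH1 IH2.
  rewrite (nfE psi) // !double_counitE (bigD1 (al psi * v y)%g) //=.
  rewrite [X in _ + X]big1 ?addr0 => [|t ne].
    rewrite [RHS](bigD1 y) //= [X in _ = _ + X]big1 ?addr0 => [|t ne].
      by rewrite !ffunE /= !eqxx (hom1 wM) Defs.char1 mulr1.
    by rewrite !ffunE /= (negPf ne) mulr0.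
  by rewrite !ffunE /= (negPf ne) mulr0.
elim/homog_span => [|a u1 u2|psi f y hf].
+ by rewrite !linear0.
+ by move=> IH1 IH2; rewrite !linearP /= IH1 IH2.
have antiE h (g : G) : hopf_antipode (Defs.double G) (tens h (delta g)) =
    tens [ffun s => h (g * s^-1 * g^-1)%g : k^o] (delta g^-1%g).
  apply/ffunP=> -[s t]; rewrite double_antipode_coord !ffunE /=.
  rewrite -(inj_eq invg_inj t) invgK; case: eqP => [<-|_]; last by rewrite !mulr0.
  by rewrite invgK.
have gV : (al psi^-1 * v y^-1 = (al psi * v y)^-1)%g.
  by rewrite (homV alM) (homV vM) invMg (centerTC _ (groupVr (alZ psi))).
rewrite antiE [RHS](nfE psi^-1%g); last first.
  move=> x z; rewrite !ffunE invMg -hf; congr (f _).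
  have -> : sgval z^-1%g = (sgval z)^-1%g by [].
  move: (sgval z)^-1%g (groupVr (subgP z)) => u uZ.
  by rewrite (centerTC _ uZ) -!mulgA (centerTC _ uZ).
rewrite (nfE _ _ y hf) antiE gV; congr tens.
apply/ffunP=> s; rewrite !ffunE; congr (f _ * _).
  have := wg psi^-1%g y^-1%g s^-1%g; rewrite gV !invgK => ->.
  by rewrite (homV wM).
rewrite (homV bM) charVE -charVx.
by have := char_conj (b y) s^-1%g (al psi * v y)^-1%g; rewrite invgK => ->.
Qed.

End NormalForms.

(** * The generators V, Vc, B and E *)

Section Restriction.

Variables (k : closedFieldType) (G : finGroupType) (C : {group G}).

Definition restrict_fun (f : vec k G) : vec k (subg_of C) := [ffun z => f (sgval z)].

Lemma restrict_fun_linear : linear restrict_fun.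
Proof. by move=> a f g; apply/ffunP=> z; rewrite !ffunE. Qed.

HB.instance Definition _ := GRing.isLinear.Build k (vec k G) (vec k (subg_of C)) *:%R
  restrict_fun restrict_fun_linear.

Lemma restrictE (f : vec k G) : restrict k C f = [ffun z => f (sgval z)].
Proof. exact: (lfunE restrict_fun). Qed.

End Restriction.

Section Generators.

Variables (k : closedFieldType) (G : finGroupType).
Hypothesis char0 : [pchar k] =i pred0.

Local Notation DG := (vec k (G * G)%type).
Local Notation Z := ('Z([set: G])%g).
Local Notation subgZ := (subg_of 'Z([set: G])%G).
Local Notation X := (character k subgZ).
Local Notation dd x y := (@delta k (G * G)%type (x, y)).

Lemma linext_tens (W : vectType k) (F : G * G -> W) (f : vec k G) (y : G) :
  linext F (tens f (delta y)) = \sum_x f x *: F (x, y).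
Proof.
rewrite linextE sum_pair; apply: eq_bigr => x _.
rewrite (bigD1 y) //= !ffunE /= eqxx mulr1 big1 ?addr0 // => y' ne.
by rewrite !ffunE /= (negPf ne) mulr0 scale0r.
Qed.

Lemma sum_dd (f : vec k G) (w : G -> G) (y : G) s t : injective w ->
  (\sum_x f x *: dd (w x) y) (w s, t) = f s * (t == y)%:R.
Proof.
move=> wI; rewrite sum_ffunE (bigD1 s) //= !ffunE xpair_eqE eqxx big1 ?addr0 // => x ne.
by rewrite !ffunE xpair_eqE (inj_eq wI) eq_sym (negPf ne) scaler0.
Qed.

Lemma V_map_tens (v : {perm G}) (f : vec k G) (y : G) :
  V_map k v (tens f (delta y)) = tens [ffun s => f (v^-1%g s)] (delta (v y)).
Proof.
rewrite linext_tens; apply/ffunP=> -[s t] /=; rewrite -[s](permKV v).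
by rewrite sum_dd ?[RHS]ffunE /= ?ffunE ?permK //; apply: perm_inj.
Qed.

Lemma Vc_map_tens (v : {perm G}) (f : vec k G) (y : G) :
  Vc_map k v (tens f (delta y)) = tens [ffun s => f (v^-1%g s)] (delta y).
Proof.
rewrite linext_tens; apply/ffunP=> -[s t] /=; rewrite -[s](permKV v).
by rewrite sum_dd ?[RHS]ffunE /= ?ffunE ?permK //; apply: perm_inj.
Qed.

(** In finite dimension surjectivity suffices, and the image need only contain the spanning
    homogeneous tensors. *)
Lemma normal_form_aut (phi : 'End(DG)) w b al v : normal_form phi w b al v ->
  (forall psi f y, homog psi f -> exists u, phi u = tens f (delta y)) ->
  hopf_aut phi.
Proof.
move=> nf sur; split; first exact: (normal_form_hopf char0 nf).
apply: lfun_surj_bij => u; elim/(@homog_span k G char0): u => [|a u1 u2|psi f y hf].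
- by exists 0; rewrite linear0.
- by move=> [x1 <-] [x2 <-]; exists (a *: x1 + x2); rewrite linearP.
exact: sur hf.
Qed.

Lemma Aut_hom (v : {perm G}) : v \in Aut [set: G] -> is_hom v.
Proof. by move=> /Aut_morphic/morphicP vM x y; apply: vM; rewrite inE. Qed.

Lemma hom_Aut (v : {perm G}) : is_hom v -> v \in Aut [set: G].
Proof.
move=> vM; rewrite inE; apply/andP; split; first by apply/subsetP=> x; rewrite inE.
by apply/morphicP=> x y _ _; apply: vM.
Qed.

Lemma center_perm (v : {perm G}) z : is_hom v -> z \in Z -> v z \in Z.
Proof.
move=> vM zZ; apply/centerTP=> x; rewrite -[x](permKV v) -!vM.
by rewrite (centerTC _ zZ).
Qed.

Lemma is_hom_perm_inv (v : {perm G}) : is_hom v -> is_hom v^-1%g.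
Proof. by move=> vM x y; apply: (@perm_inj _ v); rewrite vM !permKV. Qed.

Lemma is_hom_triv (A B : finGroupType) : is_hom (fun _ : A => 1%g : B).
Proof. by move=> x y; rewrite mulg1. Qed.

Lemma V_normal_form (v : {perm G}) : v \in Aut [set: G] ->
  normal_form (V_map k v) v^-1%g (fun=> 1%g) (fun=> 1%g) v.
Proof.
move=> /Aut_hom vM; have v'M := is_hom_perm_inv vM.
split=> //; try exact: is_hom_triv.
- by move=> z; apply: center_perm.
- by move=> g; rewrite permK mulgV.
move=> psi f y _; rewrite V_map_tens mul1g; congr tens.
by apply/ffunP=> s; rewrite !ffunE mulr1.
Qed.

Lemma V_aut (f : 'End(DG)) : V_set f -> hopf_aut f.
Proof.
move=> [v vA ->]; apply: (normal_form_aut (V_normal_form vA)) => psi h y _.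
exists (tens [ffun s => h (v s)] (delta (v^-1%g y))).
rewrite V_map_tens permKV; congr tens.
by apply/ffunP=> s; rewrite !ffunE permKV.
Qed.

Lemma Vc_normal_form (v : {perm G}) : central_aut v ->
  normal_form (Vc_map k v) v^-1%g (fun=> 1%g) (fun=> 1%g) id.
Proof.
move=> [/Aut_hom vM vZ]; have v'M := is_hom_perm_inv vM.
split=> //; try exact: is_hom_triv.
- by move=> z; apply: center_perm.
- by move=> g; have := vZ (v^-1%g g); rewrite permKV -groupV invMg invgK.
move=> psi f y _; rewrite Vc_map_tens mul1g; congr tens.
by apply/ffunP=> s; rewrite !ffunE mulr1.
Qed.

Lemma Vc_aut (f : 'End(DG)) : Vc_set f -> hopf_aut f.
Proof.
move=> [v vA ->]; apply: (normal_form_aut (Vc_normal_form vA)) => psi h y _.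
exists (tens [ffun s => h (v s)] (delta y)).
rewrite Vc_map_tens; congr tens.
by apply/ffunP=> s; rewrite !ffunE permKV.
Qed.

Local Notation GG := [~: [set: G], [set: G]]%G.
Local Notation Gab := (coset_of GG).

Lemma der_norm (x : G) : x \in 'N(GG)%g.
Proof. by apply: (subsetP (der_norm 1 [set: G])); rewrite inE. Qed.

Lemma cosetGG_hom : is_hom (coset GG).
Proof. by move=> x y; rewrite morphM ?der_norm. Qed.

(** [b] inflated to [G] in both arguments. *)
Definition B_char (b : {morphism [set: Gab] >-> character k Gab}) (g : G) : character k G :=
  char_pull cosetGG_hom (b (coset GG g)).

Lemma B_charM b : is_hom (B_char b).
Proof.
by move=> x y; rewrite /B_char cosetGG_hom morphM ?inE // char_pullM.
Qed.

Lemma B_map_tens b (f : vec k G) (y : G) :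
  B_map b (tens f (delta y)) = tens [ffun s => f s * B_char b y s : k^o] (delta y).
Proof.
rewrite linext_tens; apply/ffunP=> -[s t]; rewrite sum_ffunE (bigD1 s) //= !ffunE /=.
rewrite xpair_eqE eqxx /= char_pullE big1 ?addr0 => [|x ne]; first by rewrite /GRing.scale /= !mulrA.
by rewrite !ffunE xpair_eqE eq_sym (negPf ne) !scaler0.
Qed.

Lemma char_der (c : character k G) x : x \in GG -> c x = 1.
Proof.
move=> xG.
have gK : group_set [set x | c x == 1].
  apply/group_setP; split=> [|u v]; first by rewrite inE Defs.char1.
  by rewrite !inE Defs.charM => /eqP-> /eqP->; rewrite mulr1.
have : GG \subset Group gK.
  rewrite gen_subG; apply/subsetP=> _ /imset2P[u v _ _ ->].
  by rewrite inE /commg Defs.charM charVx /conjg mulgA char_conj mulVf ?char_neq0.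
by move=> /subsetP/(_ x xG); rewrite inE => /eqP.
Qed.

Lemma char_repr (c : character k G) x : c (repr (coset GG x)) = c x.
Proof.
have /rcosetP[y Gy ->] : repr (coset GG x) \in (GG :* x)%g.
  by rewrite -val_coset ?der_norm // mem_repr_coset.
by rewrite Defs.charM (char_der _ Gy) mul1r.
Qed.

Lemma char_reprM (c : character k G) (u v : Gab) :
  c (repr (u * v)%g) = c (repr u) * c (repr v).
Proof.
rewrite -{1}(coset_reprK u) -{1}(coset_reprK v) -cosetGG_hom char_repr.
by rewrite Defs.charM.
Qed.

(** In each argument the values lie in an abelian group, so commutators are killed and evaluation at
    coset representatives is multiplicative. *)
Lemma B_char_onto (s : G -> character k G) : is_hom s ->
  exists b, forall g, B_char b g = s g.
Proof.
move=> sM.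
have /fin_all_exists[b bE] (u : Gab) : exists c : character k Gab,
    forall w, c w = s (repr u) (repr w).
  have [|x y|c cE] := mk_char (k := k) (f := fun w : Gab => s (repr u) (repr w)).
  - by rewrite -(coset_id (group1 GG)) char_repr Defs.char1.
  - by rewrite char_reprM.
  by exists c.
have colE x : exists c : character k G, forall g, c g = s g x.
  have [|y z|c cE] := mk_char (k := k) (f := fun g => s g x).
  - by rewrite (hom1 sM) char1E.
  - by rewrite sM charME.
  by exists c.
have bM : is_hom b.
  move=> u v; apply/Defs.charP=> w; rewrite charME !bE.
  by have [c cE] := colE (repr w); rewrite -!cE char_reprM.
exists (Morphism (D := [set: Gab]) (in2W bM)) => g; apply/Defs.charP=> x.
rewrite char_pullE /= bE char_repr.
by have [c cE] := colE x; rewrite -!cE char_repr.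
Qed.

Lemma B_normal_form b :
  normal_form (B_map b) id (B_char b) (fun=> 1%g) id.
Proof.
split=> //; try exact: is_hom_triv.
- exact: B_charM.
- by move=> g; rewrite mulgV.
by move=> psi f y _; rewrite B_map_tens mul1g.
Qed.

Lemma B_aut (f : 'End(DG)) : B_set f -> hopf_aut f.
Proof.
move=> [b ->]; apply: (normal_form_aut (B_normal_form b)) => psi h y _.
exists (tens [ffun s => h s * (B_char b y s)^-1 : k^o] (delta y)).
rewrite B_map_tens; congr tens.
by apply/ffunP=> s; rewrite !ffunE mulfVK ?char_neq0.
Qed.

(** On the center the translate is [f x] times the character [psi], which the inverse of
    [char_alg_map] sends to the basis element [psi]. *)
Lemma central_map_homog a psi (f : vec k G) (x : G) : homog psi f ->
  central_map a [ffun s => f (x * s)%g] = f x *: delta (sgval (a psi)).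
Proof.
move=> hf; rewrite /central_map !comp_lfunE.
have -> : restrict k 'Z([set: G])%G [ffun s => f (x * s)%g] =
          char_alg_map k subgZ (f x *: delta psi).
  rewrite linearZ /= linext_delta restrictE.
  by apply/ffunP=> z; rewrite !ffunE hf.
rewrite lfun_injK; last exact: char_alg_map_inj.
by rewrite linearZ /= linext_delta.
Qed.

Lemma E_map_tens a psi (f : vec k G) (y : G) : homog psi f ->
  E_map a (tens f (delta y)) = tens f (delta (sgval (a psi) * y)%g).
Proof.
move=> hf; rewrite linext_tens /=.
have expand x1 : f x1 *: delta (sgval (a psi)) =
    \sum_v f (x1 * v)%g *: central_map a (delta v).
  rewrite -(central_map_homog a x1 hf) [X in central_map a X](vec_sum_delta).
  by rewrite linear_sum; apply: eq_bigr => v _; rewrite linearZ /= ffunE.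
apply/ffunP=> -[s t]; rewrite sum_ffunE [RHS]ffunE /=.
transitivity (\sum_v f (s * v)%g * central_map a (delta v) (t * y^-1)%g).
  rewrite (reindex_inj (mulgI s)) /=; apply: eq_bigr => v _.
  rewrite ffunE sum_ffunE (bigD1 (s, v)) //= big1 ?addr0 => [|[q1 q2] /andP[/eqP /= qE ne]].
    by rewrite ffunE /= deltaE eqxx mul1r group_mulr_delta.
  rewrite ffunE /= deltaE; case: (s =P q1) => [sq|_]; last by rewrite mul0r.
  by case/eqP: ne; rewrite -sq in qE *; rewrite (mulgI _ _ _ qE).
have /ffunP/(_ (t * y^-1)%g) := expand s; rewrite ffunE sum_ffunE deltaE => eqS.
transitivity (f s *: (t * y^-1 == sgval (a psi))%g%:R : k^o).
  by rewrite eqS; apply: eq_bigr => v _; rewrite ffunE.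
rewrite deltaE -(inj_eq (mulIg y)) mulgKV.
by [].
Qed.

Lemma E_normal_form (a : {morphism [set: X] >-> subgZ}) :
  normal_form (E_map a) id (fun=> 1%g) (fun psi => sgval (a psi)) id.
Proof.
split=> //; try exact: is_hom_triv.
- by move=> x y; rewrite morphM ?inE.
- by move=> psi; apply: subgP.
- by move=> g; rewrite mulgV.
move=> psi f y hf; rewrite (E_map_tens a y hf); congr tens.
by apply/ffunP=> s; rewrite !ffunE mulr1.
Qed.

Lemma E_aut (f : 'End(DG)) : E_set f -> hopf_aut f.
Proof.
move=> [a ->]; apply: (normal_form_aut (E_normal_form a)) => psi h y hh.
exists (tens h (delta ((sgval (a psi))^-1 * y)%g)).
by rewrite (E_map_tens a _ hh) mulKVg.
Qed.

Lemma E_onto (e : X -> G) : is_hom e -> (forall psi, e psi \in Z) ->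
  exists a : {morphism [set: X] >-> subgZ}, forall psi, sgval (a psi) = e psi.
Proof.
move=> eM eZ; have sM := subg_hom eM eZ.
by exists (Morphism (D := [set: X]) (in2W sM)) => psi /=; rewrite subgK.
Qed.

End Generators.

(** * Reflections *)

Section Duality.

Variables (k : closedFieldType) (A : finGroupType).
Hypothesis char0 : [pchar k] =i pred0.

Lemma fun_mul_coord (u v : vec k A) x : hopf_mul (fun_alg A) u v x = u x * v x.
Proof.
rewrite hopf_mul_coord (bigD1 x) //= (bigD1 x) //= !ffunE !eqxx scale1r mulr1.
rewrite [X in _ + X + _]big1 ?addr0 => [|y ne]; last first.
  by rewrite !ffunE [x == y]eq_sym (negPf ne) scale0r mulr0.
rewrite big1 ?addr0 // => y ne; rewrite big1 // => y' _.
by rewrite !ffunE [x == y]eq_sym (negPf ne) scaler0 mulr0.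
Qed.

Lemma fun_comul_coord (u : vec k A) x y : hopf_comul (fun_alg A) u (x, y) = u (x * y)%g.
Proof.
rewrite linext_coord (bigD1 (x * y)%g) //= sum_ffunE (bigD1 (x, y)) //= deltaE eqxx.
rewrite [X in _ * (_ + X)]big1 ?addr0 => [|q /andP[_ ne]]; last first.
  by rewrite deltaE eq_sym (negPf ne).
rewrite mulr1 big1 ?addr0 // => z ne; rewrite sum_ffunE big1 ?mulr0 // => q /eqP qz.
rewrite deltaE; case: eqP => // qE; by case/eqP: ne; rewrite -qz -qE.
Qed.

Lemma fun_counitE (u : vec k A) : hopf_counit (fun_alg A) u = u 1%g.
Proof.
rewrite /hopf_counit linextE (bigD1 1%g) //= eqxx big1 ?addr0 => [|x /negPf->].
  by rewrite [LHS]mulr1.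
by rewrite scaler0.
Qed.

Lemma fun_antipode_coord (u : vec k A) x : hopf_antipode (fun_alg A) u x = u x^-1%g.
Proof.
rewrite linext_coord (bigD1 x^-1%g) //= deltaE invgK eqxx mulr1 big1 ?addr0 // => y ne.
rewrite deltaE; case: eqP => [xy|]; last by rewrite mulr0.
by case/eqP: ne; rewrite xy invgK.
Qed.

Lemma fun_one_coord x : hopf_one (fun_alg (k := k) A) x = 1.
Proof.
rewrite sum_ffunE (bigD1 x) //= deltaE eqxx big1 ?addr0 // => y ne.
by rewrite deltaE eq_sym (negPf ne).
Qed.

Lemma group_mul_delta x y :
  hopf_mul (group_alg A) (delta x) (delta y) = delta (x * y)%g :> vec k A.
Proof.
rewrite /hopf_mul (bigD1 x) //= (bigD1 y) //= !deltaE !eqxx mulr1 scale1r.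
rewrite [X in _ + X + _]big1 ?addr0 => [|y' ne]; last first.
  by rewrite [_ y']deltaE (negPf ne) mulr0 scale0r.
rewrite big1 ?addr0 // => x' ne; rewrite big1 // => y' _.
by rewrite deltaE (negPf ne) mul0r scale0r.
Qed.

Lemma lfun_inj_bij (V : vectType k) (f : 'End(V)) : injective f -> bijective f.
Proof.
move=> fI; have /lker0P k0 := fI; apply: lfun_surj_bij => u.
have : u \in limg f by rewrite (lker0_limgf k0) memvf.
by case/memv_imgP=> u' _ ->; exists u'.
Qed.

Lemma vec_span (I : finType) (P : vec k I -> Prop) : P 0 ->
  (forall a u v, P u -> P v -> P (a *: u + v)) -> (forall i, P (delta i)) ->
  forall u, P u.
Proof.
move=> P0 PD Pd u; rewrite (vec_sum_delta u); elim/big_rec: _ => // i v _ Pv.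
by apply: PD; first apply: Pd.
Qed.

(** Group-like elements go to group-like elements, and those of k^A are the characters. *)
Lemma hopf_iso_char d : hopf_isomorphism (group_alg A) (fun_alg A) d ->
  exists D : A -> character k A, [/\ is_hom D, injective D
    & forall c, d (delta c) = [ffun x => D c x : k^o]].
Proof.
move=> [[dM _ dD de _] dB].
have /fin_all_exists[D DE] c : exists e : character k A, forall x, e x = d (delta c) x.
  have [|x y|e eE] := mk_char (k := k) (f := d (delta c)); last by exists e.
    by have := de (delta c); rewrite fun_counitE /hopf_counit linext_delta.
  move/ffunP/(_ (x, y)): (dD (delta c)); rewrite fun_comul_coord => ->.
  by rewrite linext_delta /= -tens_delta tens_map_tens ffunE.
have dE c : d (delta c) = [ffun x => D c x : k^o].
  by apply/ffunP=> x; rewrite ffunE DE.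
exists D; split=> //.
  move=> x y; apply/Defs.charP=> z; rewrite charME !DE -fun_mul_coord -dM.
  by rewrite group_mul_delta.
move=> c c' eqD; have : delta c = delta c' :> vec k A.
  by apply: (bij_inj dB); rewrite !dE eqD.
move/ffunP/(_ c); rewrite !deltaE eqxx; case: eqP => // _ /eqP.
by rewrite oner_eq0.
Qed.

Lemma char_hopf_iso (D : A -> character k A) : abelian [set: A] ->
  is_hom D -> injective D -> exists d : 'Hom(vec k A, vec k A),
  hopf_isomorphism (group_alg A) (fun_alg A) d /\
  forall c, d (delta c) = [ffun x => D c x : k^o].
Proof.
move=> abA DM DI; pose d := linext (fun c => [ffun x => D c x : k^o] : vec k A).
have dE c : d (delta c) = [ffun x => D c x : k^o] by rewrite linext_delta.
exists d; split=> //; split; last first.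
  pose L : 'Hom(vec k A, vec k (character k A)) := linext (fun c => delta (D c)).
  have dL : d = (char_alg_map k A \o L)%VF.
    by apply: lfun_vec_ext => c; rewrite comp_lfunE !linext_delta.
  apply: lfun_inj_bij; rewrite dL => u v; rewrite !comp_lfunE.
  move/(char_alg_map_inj char0) => eqL; apply/ffunP=> c.
  have LE w : L w (D c) = w c.
    rewrite linext_coord (bigD1 c) //= deltaE eqxx mulr1 big1 ?addr0 // => c' ne.
    by rewrite deltaE (inj_eq DI) eq_sym (negPf ne) mulr0.
  by rewrite -!LE eqL.
split.
- move=> u v; elim/vec_span: u => [|a u1 u2|i].
  + by rewrite !linear0 !hopf_mul0l linear0.
  + by move=> IH1 IH2; rewrite hopf_mulDl hopf_mulZl !linearP /= IH1 IH2 hopf_mulDl hopf_mulZl.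
  elim/vec_span: v => [|a u1 u2|j].
  + by rewrite !linear0 !hopf_mul0r linear0.
  + by move=> IH1 IH2; rewrite hopf_mulDr hopf_mulZr !linearP /= IH1 IH2 hopf_mulDr hopf_mulZr.
  rewrite group_mul_delta !dE; apply/ffunP=> x.
  by rewrite fun_mul_coord ![in RHS]ffunE ffunE DM charME.
- by rewrite dE; apply/ffunP=> x; rewrite fun_one_coord ffunE (hom1 DM) char1E.
- elim/vec_span => [|a u1 u2|i].
  + by rewrite !linear0.
  + by move=> IH1 IH2; rewrite !linearP /= IH1 IH2.
  rewrite !dE [in RHS]/hopf_comul (linext_delta (basis_comul _)) /=.
  rewrite -tens_delta tens_map_tens !dE; apply/ffunP=> -[x y].
  by rewrite fun_comul_coord !ffunE Defs.charM.
- elim/vec_span => [|a u1 u2|i].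
  + by rewrite !linear0.
  + by move=> IH1 IH2; rewrite !linearP /= IH1 IH2.
  by rewrite fun_counitE dE ffunE Defs.char1 /hopf_counit (linext_delta (basis_counit _)).
elim/vec_span => [|a u1 u2|i].
+ by rewrite !linear0.
+ by move=> IH1 IH2; rewrite !linearP /= IH1 IH2.
rewrite [in RHS]/hopf_antipode (linext_delta (basis_antipode _)) /= !dE; apply/ffunP=> x.
by rewrite fun_antipode_coord !ffunE (homV DM) charVE charVx.
Qed.

End Duality.

Section Reflections.

Variables (k : closedFieldType) (G : finGroupType).
Hypothesis char0 : [pchar k] =i pred0.

Local Notation DG := (vec k (G * G)%type).
Local Notation Z := ('Z([set: G])%g).
Local Notation subgZ := (subg_of 'Z([set: G])%G).
Local Notation X := (character k subgZ).
Local Notation dd x y := (@delta k (G * G)%type (x, y)).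

Section Decomposition.

Variables H C : {group G}.
Hypotheses (abC : abelian C) (defG : (H \x C = [set: G])%g).

Definition projC x := subg C (remgr H C x).

Lemma dp_HC x : x \in (H * C)%g.
Proof. by have [_ -> _ _] := dprodP defG; rewrite inE. Qed.

Lemma divgrH x : divgr H C x \in H. Proof. exact/mem_divgr/dp_HC. Qed.
Lemma remgrC x : remgr H C x \in C. Proof. exact/mem_remgr/dp_HC. Qed.

Lemma projCE x : sgval (projC x) = remgr H C x.
Proof. by rewrite subgK ?remgrC. Qed.

Lemma dp_eq x : (divgr H C x * sgval (projC x))%g = x.
Proof. by rewrite projCE -divgr_eq. Qed.

Lemma dp_divgr h (c : subg_of C) : h \in H -> divgr H C (h * sgval c)%g = h.
Proof.
by move=> Hh; have [_ _ _ tiHC] := dprodP defG; rewrite divgrMid ?subgP.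
Qed.

Lemma dp_projC h (c : subg_of C) : h \in H -> projC (h * sgval c)%g = c.
Proof.
move=> Hh; have [_ _ _ tiHC] := dprodP defG.
by apply: val_inj; rewrite /= projCE remgrMid ?subgP.
Qed.

Lemma C_central : C \subset Z.
Proof.
have [_ _ cHC _] := dprodP defG.
apply/subsetP=> c Cc; apply/centerTP=> x.
have hc : commute c (divgr H C x) := centsP cHC _ Cc _ (divgrH x).
have cc : commute c (sgval (projC x)) := centsP abC _ Cc _ (subgP _).
by have := commuteM hc cc; rewrite dp_eq.
Qed.

Lemma divgr_hom : is_hom (divgr H C).
Proof.
have [_ _ cHC _] := dprodP defG.
by move=> x y; apply: (divgrM (sdprod_compl (dprodWsd defG)) cHC); rewrite inE.
Qed.

Lemma projC_hom : is_hom projC.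
Proof.
move=> x y; apply: val_inj; rewrite /= !projCE.
have [nsH _ _ _ _] := sdprod_context (dprodWsd defG).
by apply: (remgrM (sdprod_compl (dprodWsd defG))); rewrite ?inE.
Qed.

Lemma projC_sgval (c : subg_of C) : projC (sgval c) = c.
Proof. by have := dp_projC c (group1 H); rewrite mul1g. Qed.

Lemma divgr_sgval (c : subg_of C) : divgr H C (sgval c) = 1%g.
Proof. by have := dp_divgr c (group1 H); rewrite mul1g. Qed.

Lemma projC_divgr x : projC (divgr H C x) = 1%g.
Proof. by have := dp_projC 1%g (divgrH x); rewrite mulg1. Qed.

Lemma divgr_divgr x : divgr H C (divgr H C x) = divgr H C x.
Proof. by have := dp_divgr 1%g (divgrH x); rewrite mulg1. Qed.

Lemma divgr_central x : (divgr H C x * x^-1)%g \in Z.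
Proof.
have cZ : sgval (projC x) \in Z by apply: (subsetP C_central); apply: subgP.
by rewrite -{2}(dp_eq x) -(centerTC _ cZ) invMg mulKVg groupV.
Qed.

Lemma sum_dprod (V : nmodType) (F : G -> V) :
  \sum_x F x = \sum_(h : subg_of H) \sum_(c : subg_of C) F (sgval h * sgval c)%g.
Proof.
rewrite pair_bigA (reindex (fun p : subg_of H * subg_of C => (sgval p.1 * sgval p.2)%g)) //=.
exists (fun x => (subg H (divgr H C x), projC x)) => [[h c] _|x _] /=.
  by rewrite dp_divgr ?subgP // dp_projC ?subgP // sgvalK.
by rewrite subgK ?divgrH // dp_eq.
Qed.

Definition inclCZ (c : subg_of C) : subgZ := subg _ (sgval c).

Lemma inclCZE c : sgval (inclCZ c) = sgval c.
Proof. by rewrite subgK //; apply: (subsetP C_central); apply: subgP. Qed.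

Lemma inclCZ_hom : is_hom inclCZ.
Proof. by move=> x y; apply: val_inj; rewrite /= !inclCZE. Qed.

Definition resC : X -> character k (subg_of C) := char_pull inclCZ_hom.

Lemma resCE psi c : resC psi c = psi (inclCZ c).
Proof. exact: char_pullE. Qed.

Variables (D : subg_of C -> character k (subg_of C)) (Dv : character k (subg_of C) -> subg_of C).
Hypotheses (DM : is_hom D) (DK : cancel D Dv) (DvK : cancel Dv D).

Lemma DvM : is_hom Dv.
Proof. by move=> x y; apply: (can_inj DK); rewrite DM !DvK. Qed.

Section Map.

Variable d : 'Hom(vec k (subg_of C), vec k (subg_of C)).
Hypotheses (dB : bijective d) (dE : forall c, d (delta c) = [ffun x => D c x : k^o]).

Lemma reflection_map_tens nu psi (f : vec k G) (y : G) : homog psi f ->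
  reflection_map H C d nu (tens f (delta y)) =
  tens [ffun x => f (divgr H C x) * D (projC y) (projC x) : k^o]
       (delta (divgr H C y * sgval (Dv (resC psi)) * sgval (nu (projC y)))%g).
Proof.
move=> hf; rewrite linext_tens; apply/ffunP=> -[x t]; rewrite sum_ffunE sum_dprod.
set nuy := nu (projC y); set yH := subg H (divgr H C y).
pose gm (c : subg_of C) := hopf_mul (group_alg _) ((d^-1)%VF (delta c)) (delta nuy) (projC t).
(* On a coset of [C] the function [f] is a multiple of the character [resC psi], which is the image
   under [d] of the group element [Dv (resC psi)]; the inverse of [d] therefore produces one group
   element. *)
have sumc : \sum_c resC psi c * gm c = (projC t == Dv (resC psi) * nuy)%g%:R.
  transitivity ((d^-1)%VF (\sum_c resC psi c *: delta c) (projC t * nuy^-1)%g).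
    rewrite linear_sum sum_ffunE; apply: eq_bigr => c _.
    rewrite linearZ ffunE /gm /=; congr (_ * _).
    by rewrite group_mulr_delta.
  have -> : \sum_c resC psi c *: delta c = d (delta (Dv (resC psi))).
    rewrite dE DvK [RHS]vec_sum_delta; apply: eq_bigr => c _; by rewrite ffunE.
  rewrite lfun_injK; last exact: bij_inj.
  by rewrite deltaE -(inj_eq (mulIg nuy)) mulgKV.
transitivity (\sum_(h : subg_of H) (h == subg H (divgr H C x))%:R *
   (\sum_(c : subg_of C) f (sgval h) * D (projC y) (projC x) *
      (subg H (divgr H C t) == yH)%:R * (resC psi c * gm c))).
  apply: eq_bigr => h _; rewrite mulr_sumr; apply: eq_bigr => c _.
  rewrite !ffunE /= dp_divgr ?subgP // sgvalK !dE !ffunE -/(projC _) -/(projC _) -/(projC _).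
  rewrite dp_projC ?subgP // -/nuy -/yH -/(gm c).
  rewrite -(inclCZE c) hf -resCE [h == _]eq_sym /GRing.scale /=.
  rewrite -!mulrA [RHS]mulrCA; congr (_ * _).
  rewrite mulrCA; congr (_ * _); rewrite mulrCA; congr (_ * _).
  by rewrite mulrCA.
rewrite sum_eq_mul -mulr_sumr sumc subgK ?divgrH // [RHS]ffunE /= ffunE deltaE.
rewrite -mulrA -natrM mulnb; congr (_ * (nat_of_bool _)%:R).
apply/andP/eqP=> [[/eqP tH /eqP tC]|->].
  have tH' : divgr H C t = divgr H C y.
    by have := congr1 (@sgval _ _) tH; rewrite /yH !subgK ?divgrH.
  rewrite -mulgA -tH' -[X in _ = (_ * X)%g]/(sgval (Dv (resC psi) * nuy)%g).
  by rewrite -tC dp_eq.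
rewrite -mulgA -[X in (divgr H C y * X)%g]/(sgval (Dv (resC psi) * nuy)%g).
by rewrite dp_divgr ?divgrH // dp_projC ?divgrH.
Qed.

Definition refl_b (y : G) : character k G := char_pull projC_hom (D (projC y)).

Lemma refl_bE y x : refl_b y x = D (projC y) (projC x).
Proof. exact: char_pullE. Qed.

Lemma divgr_Z z : z \in Z -> divgr H C z \in Z.
Proof.
by move=> zZ; rewrite -[divgr H C z](mulgKV z) groupM ?divgr_central.
Qed.

Lemma reflection_normal_form nu :
  normal_form (reflection_map H C d nu) (divgr H C) refl_b
    (fun psi => sgval (Dv (resC psi)))
    (fun y => (divgr H C y * sgval (nu (projC y)))%g).
Proof.
have CZ (c : subg_of C) : sgval c \in Z := subsetP C_central _ (subgP c).
have nuM : is_hom (fun y => sgval (nu (projC y))).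
  by move=> x y; rewrite projC_hom morphM ?inE.
split.
- exact: divgr_hom.
- by move=> x y; rewrite /refl_b projC_hom DM char_pullM.
- by move=> x y; rewrite /resC char_pullM DvM.
- by apply: central_homM => //; apply: divgr_hom.
- by move=> psi.
- exact: divgr_Z.
- by move=> g; rewrite dp_divgr ?divgrH // divgr_central.
move=> psi f y hf; rewrite (reflection_map_tens _ _ hf); congr tens.
  by apply/ffunP=> x; rewrite !ffunE refl_bE.
by congr delta; rewrite mulgA (centerTC (divgr H C y) (CZ _)).
Qed.

Local Notation r := (untwisted_reflection_map H C d).

Lemma untwisted_tens psi (f : vec k G) (y : G) : homog psi f ->
  r (tens f (delta y)) =
  tens [ffun x => f (divgr H C x) * D (projC y) (projC x) : k^o]
       (delta (divgr H C y * sgval (Dv (resC psi)))%g).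
Proof. by move=> hf; rewrite (reflection_map_tens _ _ hf) mulg1. Qed.

(** Needed to apply the reflection formula a second time; only the restriction of the new degree to
    [C] enters that formula. *)
Lemma reflected_degree psi (f : vec k G) (y : G) : homog psi f ->
  exists psi1, homog psi1 [ffun x => f (divgr H C x) * D (projC y) (projC x) : k^o]
    /\ resC psi1 = D (projC y).
Proof.
move=> hf.
have pM : is_hom (fun z : subgZ => subg 'Z([set: G])%G (divgr H C (sgval z))).
  by apply: subg_hom => [z z'|z]; [rewrite -divgr_hom | apply/divgr_Z/subgP].
exists (char_pull pM psi * resZ (refl_b y))%g; split=> [x z|].
  rewrite !ffunE char_pullE resZE refl_bE divgr_hom projC_hom Defs.charM mulrACA.
  by rewrite -hf subgK ?divgr_Z ?subgP.
apply/Defs.charP=> c; rewrite resCE charME char_pullE resZE refl_bE inclCZE.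
rewrite divgr_sgval projC_sgval [X in psi X](_ : _ = 1%g) ?Defs.char1 ?mul1r //.
by apply: val_inj; rewrite /= subgK.
Qed.

(** The two exchanges of k^C and kC through [d] and its inverse cancel. *)
Lemma untwisted_involutive : (r \o r)%VF = \1%VF.
Proof.
apply: (homog_ext char0) => psi f y hf; rewrite comp_lfunE id_lfunE.
rewrite (untwisted_tens y hf).
have [psi1 [hf1 res1]] := reflected_degree y hf.
rewrite (untwisted_tens _ hf1) res1 DK dp_divgr ?divgrH // dp_projC ?divgrH // dp_eq.
congr tens; apply/ffunP=> x; rewrite !ffunE projC_divgr divgr_divgr Defs.char1 mulr1.
by rewrite DvK resCE -hf inclCZE dp_eq.
Qed.

Lemma untwisted_aut : hopf_aut r.
Proof.
apply: (normal_form_aut char0 (reflection_normal_form _)) => psi f y _.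
exists (r (tens f (delta y))).
have := congr1 (fun g : 'End(DG) => g (tens f (delta y))) untwisted_involutive.
by rewrite comp_lfunE id_lfunE.
Qed.

End Map.

End Decomposition.

Lemma datum_char (H C : {group G}) d : reflection_datum H C d ->
  exists D Dv, [/\ is_hom D, cancel D Dv, cancel Dv D
    & forall c, d (delta c) = [ffun x => (D c : character k (subg_of C)) x : k^o]].
Proof.
move=> [abC _ dI]; have [D [DM DI dE]] := hopf_iso_char dI.
have [Dv DK DvK] := dual_iso_bij char0 (abelian_subg_of abC) DI.
by exists D, Dv.
Qed.

(** [H] is the kernel of [s]; centrality of [C] makes the semidirect splitting direct. *)
Lemma datum_of_retraction (C : {group G}) (s : G -> subg_of C)
    (D : subg_of C -> character k (subg_of C)) :
  C \subset Z -> is_hom s -> (forall c, s (sgval c) = c) -> is_hom D -> injective D ->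
  exists (H : {group G}) (d : 'Hom(vec k (subg_of C), vec k (subg_of C))),
    [/\ reflection_datum H C d,
    forall c, d (delta c) = [ffun x => D c x : k^o] & forall x, projC H C x = s x].
Proof.
move=> CZ sM sK DM DI.
have abC : abelian C.
  apply/centsP=> x Cx y _; apply: centerTC; exact: (subsetP CZ).
pose F x := sgval (s x); have FM : is_hom F by move=> x y; rewrite /F sM.
have FF x : F (F x) = F x by rewrite /F sK.
have gH : group_set [set x | s x == 1%g].
  apply/group_setP; split=> [|x y]; first by rewrite inE (hom1 sM).
  by rewrite !inE sM => /eqP-> /eqP->; rewrite mulg1.
pose H := Group gH.
have HE x : (x \in H) = (s x == 1%g) by rewrite inE.
have Fx x : (x * (F x)^-1)%g \in H by rewrite HE sM (homV sM) sK mulgV.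
have defG : (H \x C = [set: G])%g.
  rewrite dprodE.
  - apply/setP=> x; rewrite [RHS]inE; apply/mulsgP.
    by exists (x * (F x)^-1)%g (F x); rewrite ?subgP ?mulgKV.
  - apply/centsP=> c Cc x _; apply: centerTC; exact: (subsetP CZ).
  apply/trivgP/subsetP=> x /setIP[]; rewrite HE => /eqP sx Cx; apply/set1P.
  by rewrite -(subgK _ Cx) -(sK (subg C x)) subgK // sx.
have [d [dI dE]] := char_hopf_iso char0 (abelian_subg_of abC) DM DI.
exists H, d; split=> // x.
by rewrite -{1}[x](mulgKV (F x)) (dp_projC defG).
Qed.

End Reflections.

(** * Triangular decomposition *)

Section Decompositions.

Variables (k : closedFieldType) (G : finGroupType).
Hypothesis char0 : [pchar k] =i pred0.

Local Notation DG := (vec k (G * G)%type).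
Local Notation Z := ('Z([set: G])%g).
Local Notation subgZ := (subg_of 'Z([set: G])%G).
Local Notation X := (character k subgZ).
Local Notation one := ([ffun=> 1] : vec k G).
Local Notation dd x y := (@delta k (G * G)%type (x, y)).

Lemma tens_delta_eq (f g : vec k G) (y y' : G) s :
  tens f (delta y) = tens g (delta y') -> f s != 0 -> y = y'.
Proof.
move/ffunP/(_ (s, y)); rewrite !ffunE /= eqxx mulr1 => -> .
by case: (y =P y') => // _; rewrite mulr0 eqxx.
Qed.

Lemma tens_delta_inj (f g : vec k G) (y : G) :
  tens f (delta y) = tens g (delta y) -> f = g.
Proof.
by move=> /ffunP e; apply/ffunP=> s; have := e (s, y); rewrite !ffunE /= eqxx !mulr1.
Qed.

Lemma tens_neq0 (f : vec k G) (y : G) : f != 0 -> tens f (delta y) != 0.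
Proof.
apply: contraNneq => /ffunP e; apply/eqP/ffunP=> s.
by have := e (s, y); rewrite !ffunE /= eqxx mulr1.
Qed.

Lemma nf_one (phi : 'End(DG)) w b al v y : normal_form phi w b al v ->
  phi (tens one (delta y)) = tens (val (b y) : vec k G) (delta (v y)).
Proof.
move=> nf; rewrite (normal_form_one y nf (@homog_one k G)); congr tens.
by apply/ffunP=> s; rewrite !ffunE mul1r.
Qed.

Lemma homog_char (c : character k G) : homog (resZ c) (val c : vec k G).
Proof. by move=> x z; rewrite resZE; exact: (Defs.charM c x (sgval z)). Qed.

Lemma nf_v_unique (phi : 'End(DG)) w b al v y g y' : normal_form phi w b al v ->
  phi (tens one (delta y)) = tens g (delta y') -> v y = y'.
Proof.
move=> nf; rewrite (nf_one y nf) => e; apply: (tens_delta_eq (s := 1%g) e).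
exact: char_neq0.
Qed.

Lemma hcomp1_neq0 (psi : X) : hcomp psi 1 != 0.
Proof.
apply/eqP=> /ffunP/(_ 1%g); rewrite !ffunE invg1 mulg1 group1 => /eqP.
rewrite mulf_eq0 invr_eq0 (negPf (cardZ_neq0 G char0)) /=; exact/negP/char_neq0.
Qed.

(** [al psi] can be read off only from a nonzero image, which injectivity of phi provides for
    [hcomp psi 1]. *)
Lemma nf_al_unique (phi : 'End(DG)) w b al v psi a :
  hopf_aut phi -> normal_form phi w b al v ->
  (forall f, homog psi f -> exists g, phi (tens f (delta 1%g)) = tens g (delta a)) ->
  al psi = a.
Proof.
move=> [_ /bij_inj phiI] nf /(_ _ (hcomp_homog psi 1%g))[g].
have : phi (tens (hcomp psi 1%g) (delta 1%g)) != 0.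
  by rewrite -(linear0 phi) (inj_eq phiI) tens_neq0 ?hcomp1_neq0.
rewrite (nf_E nf _ (hcomp_homog psi 1%g)) (hom1 (nf_vM nf)) mulg1 => nz e.
have [s fs] : exists s, [ffun s => hcomp psi 1%g (w s) * b 1%g s : k^o] s != 0.
  apply/existsP; apply: contraNT nz; rewrite negb_exists => /forallP h0.
  apply/eqP/ffunP=> -[s t]; have := h0 s; rewrite negbK => /eqP.
  by move=> h; rewrite [LHS]ffunE [RHS]ffunE /= h mul0r.
exact: tens_delta_eq e fs.
Qed.

Lemma diag_VcV (phi : 'End(DG)) w v : is_hom w -> is_hom v ->
  injective w -> injective v -> (forall g, (w (v g) * g^-1)%g \in Z) ->
  (forall psi f y, homog psi f ->
     phi (tens f (delta y)) = tens [ffun s => f (w s)] (delta (v y))) ->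
  VcV phi.
Proof.
move=> wM vM wI vI wv phiE.
pose pv := perm vI; pose pw := perm wI.
(* The inverse of [v \o w]: [V_map] composes functions with the inverse of [v], and [Vc_map c] then
   composes with [v \o w], leaving [w]. *)
pose c := (pw * pv)^-1%g.
have pvE x : pv x = v x by rewrite permE.
have pwE x : pw x = w x by rewrite permE.
have pvM : is_hom pv by move=> x y; rewrite !pvE vM.
have pwM : is_hom pw by move=> x y; rewrite !pwE wM.
have pwvM : is_hom (pw * pv)%g by move=> x y; rewrite !permM pwM pvM.
have cM : is_hom c := is_hom_perm_inv pwvM.
have cZ g : (c g * g^-1)%g \in Z.
  set h := c g; have -> : g = v (w h) by rewrite -[g](permKV (pw * pv)%g) permM pwE pvE.
  have e : (pw (h * (v (w h))^-1) \in Z)%g.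
    rewrite pwM (homV pwM) !pwE -groupV invMg invgK; exact: wv.
  rewrite -[X in X \in Z](permK pw); apply: center_perm e.
  exact: is_hom_perm_inv.
have -> : phi = (Vc_map k c \o V_map k pv)%VF.
  apply: (homog_ext char0) => psi f y hf; rewrite comp_lfunE V_map_tens Vc_map_tens.
  rewrite (phiE _ _ _ hf) pvE; congr tens; apply/ffunP=> s; rewrite !ffunE.
  by rewrite /c invgK permM pwE permK.
apply: gen_comp; apply: gen_mem; [left | right].
  by exists c => //; split=> //; apply: hom_Aut.
by exists pv => //; apply: hom_Aut.
Qed.

(** The two conditions on tensors force trivial [al] and trivial [b] in the normal form.
    Surjectivity of phi makes [w] injective, since otherwise two coordinates of every image would
    agree. *)
Lemma VcV_of_trivial (phi : 'End(DG)) v : hopf_aut phi -> is_hom v -> injective v ->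
  (forall psi f y, homog psi f -> exists g, phi (tens f (delta y)) = tens g (delta (v y))) ->
  (forall y, phi (tens one (delta y)) = tens one (delta (v y))) ->
  VcV phi.
Proof.
move=> aut vM vI phiv phi1.
have [w [b [al [v2 nf]]]] := hopf_aut_normal_form aut.
have v2E y : v2 y = v y by apply: (nf_v_unique nf (phi1 y)).
have b1 y s : b y s = 1.
  have := phi1 y; rewrite (nf_one y nf) v2E => /tens_delta_inj/ffunP/(_ s).
  by rewrite ffunE.
have al1 psi : al psi = 1%g.
  apply: (nf_al_unique aut nf) => f hf; have [g] := phiv psi f 1%g hf.
  by rewrite (hom1 vM) => ->; exists g.
have phiE psi f y : homog psi f -> phi (tens f (delta y)) = tens [ffun s => f (w s)] (delta (v y)).
  move=> hf; rewrite (nf_E nf y hf) al1 mul1g v2E; congr tens.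
  by apply/ffunP=> s; rewrite !ffunE b1 mulr1.
have wI : injective w.
  move=> s s' eqw; have eqphi u t : phi u (s, t) = phi u (s', t).
    elim/(@homog_span k G char0): u => [|a u1 u2|psi f y hf].
    - by rewrite linear0 !ffunE.
    - by move=> IH1 IH2; rewrite linearP !ffunE /= IH1 IH2.
    by rewrite (phiE _ _ _ hf) !ffunE /= eqw.
  have [[_ _ _ _ _] [psi _ psiK]] := aut.
  have := eqphi (psi (dd s 1%g)) 1%g; rewrite psiK !deltaE !xpair_eqE !eqxx /=.
  by case: eqP => // _ /eqP; rewrite oner_eq0.
apply: (diag_VcV (w := w) (v := v)) => //; first exact: nf_wM nf.
by move=> g; rewrite -v2E; apply: nf_wv nf g.
Qed.

(** A triangular factorization with pivot [v]: the left factor carries [b] composed with the inverse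
    of [v], the right factor carries the inverse of [v] composed with [al]. *)
Lemma triangular_decomposition (phi : 'End(DG)) w b al v :
  hopf_aut phi -> normal_form phi w b al v -> injective v ->
  exists b1 d a, [/\ VcV d, phi = (B_map b1 \o (d \o E_map a))%VF,
    forall y, B_char b1 (v y) = b y, forall psi, v (sgval (a psi)) = al psi
    & forall y, d (tens one (delta y)) = tens one (delta (v y))].
Proof.
move=> aut nf vI; have vM := nf_vM nf; have bM := nf_bM nf; have alM := nf_alM nf.
have [vi [viM vK viK]] := hom_inverse vM vI erefl.
have viZ z : z \in Z -> vi z \in Z.
  move=> zZ; apply/centerTP=> x; rewrite -[x]vK -!viM.
  by rewrite (centerTC _ zZ).
have sM : is_hom (fun g => b (vi g)) by move=> x y; rewrite viM bM.
have siM : is_hom (fun g => (b (vi g))^-1%g).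
  move=> x y; rewrite sM invMg.
  exact: (abelianTC (character_abelian k G)).
have eM : is_hom (fun psi => vi (al psi)) by move=> x y; rewrite alM viM.
have eiM : is_hom (fun psi => (vi (al psi))^-1%g).
  apply: central_homV => // psi; exact/viZ/(nf_alZ nf).
have eZ psi : vi (al psi) \in Z by apply/viZ/(nf_alZ nf).
have [b1 b1E] := B_char_onto sM; have [b0 b0E] := B_char_onto siM.
have [a aE] := E_onto eM eZ.
have [a0 a0E] := E_onto eiM (fun psi => groupVr (eZ psi)).
(* [b0] and [a0] are the inverses of the two triangular factors, so [d] is what remains of phi. *)
pose d := (B_map b0 \o (phi \o E_map a0))%VF.
have bb f y : B_map b1 (B_map b0 (tens f (delta y))) = tens f (delta y).
  rewrite !B_map_tens; congr tens; apply/ffunP=> s; rewrite !ffunE b1E b0E charVE.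
  by rewrite -mulrA mulVf ?mulr1 ?char_neq0.
have dE psi f y : homog psi f -> exists g, d (tens f (delta y)) = tens g (delta (v y)).
  move=> hf; rewrite !comp_lfunE (E_map_tens char0 _ _ hf) (nf_E nf _ hf) B_map_tens.
  by rewrite a0E vM (homV vM) viK mulKVg; eexists.
have d1 y : d (tens one (delta y)) = tens one (delta (v y)).
  rewrite !comp_lfunE (E_map_tens char0 _ _ (@homog_one k G)) morph1 mul1g.
  rewrite (nf_one y nf) B_map_tens; congr tens; apply/ffunP=> s.
  by rewrite !ffunE b0E vK charVE mulfV ?char_neq0.
have autd : hopf_aut d.
  apply: hopf_aut_comp; first by apply: (B_aut char0); exists b0.
  by apply: hopf_aut_comp => //; apply: (E_aut char0); exists a0.
exists b1, d, a; split=> //.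
- exact: VcV_of_trivial autd vM vI dE d1.
- apply: (homog_ext char0) => psi f y hf; rewrite !comp_lfunE.
  rewrite !(E_map_tens char0 _ _ hf) a0E aE mulKg (nf_E nf _ hf).
  by rewrite bb.
- by move=> y; rewrite b1E vK.
by move=> psi; rewrite aE viK.
Qed.

End Decompositions.

(** * Reflection decompositions *)

Section Bruhat.

Variables (k : closedFieldType) (G : finGroupType).
Hypothesis char0 : [pchar k] =i pred0.

Local Notation DG := (vec k (G * G)%type).
Local Notation Z := ('Z([set: G])%g).
Local Notation subgZ := (subg_of 'Z([set: G])%G).
Local Notation X := (character k subgZ).
Local Notation one := ([ffun=> 1] : vec k G).

(** Follow the group element [y]: phi sends it to the character [b y] times [v y], and that
    character is homogeneous of degree its restriction to the center, so [nf_E] applies to phi'. *)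
Lemma inverse_components (phi phi' : 'End(DG)) w b al v w' b' al' v' :
  normal_form phi w b al v -> normal_form phi' w' b' al' v' ->
  (forall u, phi' (phi u) = u) -> forall y, (al' (resZ (b y)) * v' (v y))%g = y.
Proof.
move=> nf nf' phiK y; have := phiK (tens one (delta y)).
rewrite (nf_one y nf) (nf_E nf' _ (@homog_char k G (b y))) => /esym e.
by apply/esym; apply: (tens_delta_eq (s := 1%g) e); rewrite ffunE oner_neq0.
Qed.

Definition char_res (C : {group G}) : character k G -> character k (subg_of C) :=
  char_pull (@sgval_hom G C).

Lemma char_resE C c x : char_res C c x = c (sgval x).
Proof. exact: char_pullE. Qed.

Lemma char_resM C : is_hom (char_res C).
Proof. exact: char_pullM. Qed.

Lemma resC_resZ (H C : {group G}) (abC : abelian C) (defG : (H \x C = [set: G])%g)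
    (c : character k G) : resC abC defG (resZ c) = char_res C c.
Proof.
by apply/Defs.charP=> x; rewrite resCE resZE char_resE (inclCZE abC defG).
Qed.

Lemma hopf_aut_inv_exists (phi : 'End(DG)) : hopf_aut phi ->
  exists phi' : 'End(DG), [/\ hopf_aut phi', forall u, phi' (phi u) = u & forall u, phi (phi' u) = u].
Proof.
move=> aut; exists (phi^-1)%VF; split; first exact: hopf_isomorphism_inv.
  by apply: lfun_injK; apply: bij_inj; case: aut.
by apply: lfun_bijK; case: aut.
Qed.

(** The last clauses retain what is needed to split off a twist: the block of [v] into [C] in terms
    of [b1], and its radicality. The map [th0] inverts the [v]-component of [r \o phi]. *)
Lemma column_decomposition (phi : 'End(DG)) : hopf_aut phi ->
  exists (H C : {group G}) (d : 'Hom(vec k (subg_of C), vec k (subg_of C)))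
         (D : subg_of C -> character k (subg_of C)) Dv b1 del a (v th0 : G -> G),
  [/\ reflection_datum H C d,
      [/\ is_hom D, cancel D Dv, cancel Dv D & forall c, d (delta c) = [ffun x => D c x : k^o]],
      VcV del,
      phi = (untwisted_reflection_map H C d \o (B_map b1 \o (del \o E_map a)))%VF
    & [/\ is_hom v, is_hom th0,
          forall g, projC H C (v (th0 g)) = Dv (char_res C (B_char b1 g))
        & forall th : G -> G, is_hom th -> forall c : subg_of C, projC H C (v (th (sgval c))) = c -> c = 1%g]].
Proof.
move=> aut; have [phi' [aut' phiK phi'K]] := hopf_aut_inv_exists aut.
have [w [b [al [v nf]]]] := hopf_aut_normal_form aut.
have [w' [b' [al' [v' nf']]]] := hopf_aut_normal_form aut'.
have inv_l := inverse_components nf nf' phiK.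
have inv_r := inverse_components nf' nf phi'K.
have [C [s [D [sM sK DM DI [CZ bv rad]]]]] := exists_column_reflection char0
  (nf_vM nf) (nf_vM nf') (nf_bM nf) (nf_alM nf')
  (nf_alZ nf) (nf_alZ nf') inv_l inv_r.
have [H [d [dat dE projE]]] := datum_of_retraction char0 CZ sM sK DM DI.
have [abC defG dI] := dat.
have [Dv DK DvK] := dual_iso_bij char0 (abelian_subg_of abC) DI.
have dB : bijective d by case: dI.
pose r := untwisted_reflection_map H C d.
have autr : hopf_aut r := untwisted_aut char0 abC defG DM DK DvK dB dE.
have aut2 : hopf_aut (r \o phi)%VF by apply: hopf_aut_comp.
have [w2 [b2 [al2 [v2 nf2]]]] := hopf_aut_normal_form aut2.
have v2E y : v2 y = (divgr H C (v y) * sgval (Dv (char_res C (b y))))%g.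
  apply: (nf_v_unique nf2); rewrite comp_lfunE (nf_one y nf).
  by rewrite (untwisted_tens abC defG DvK dB dE _ (@homog_char k G (b y))) resC_resZ.
have v2I : injective v2.
  apply: hom_inj (nf_vM nf2) _ => y; rewrite v2E => eq1.
  have dv : divgr H C (v y) = 1%g.
    by have := congr1 (divgr H C) eq1; rewrite dp_divgr ?divgrH // (hom1 (divgr_hom defG)).
  move: eq1; rewrite dv mul1g => Dv1.
  apply: bv => [|c]; first by rewrite -projE -[LHS](dp_eq defG) dv mul1g.
  rewrite -char_resE -[char_res C _]DvK (_ : Dv _ = 1%g) ?(hom1 DM) ?char1E //.
  exact: val_inj.
have [b1 [del [a [delV compE b1E aE del1]]]] := triangular_decomposition char0 aut2 nf2 v2I.
have phiE : phi = (r \o (B_map b1 \o (del \o E_map a)))%VF.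
  by rewrite -compE comp_lfunA (untwisted_involutive char0 abC defG DK DvK dB dE) comp_lfun1l.
have [th0 [th0M v2K th0K]] := hom_inverse (nf_vM nf2) v2I erefl.
exists H, C, d, D, Dv, b1, del, a, v, th0; split=> //; split=> //.
- exact: nf_vM nf.
- move=> g; set y := th0 g; have <- : v2 y = g by apply: th0K.
  (* Reading [v] off the new factorization: the group element becomes [v2 y], acquires the character
     [B_char b1 (v2 y)], and the reflection turns the restriction of that character to [C] into an
     element of [C]. *)
  have vE : v y = (divgr H C (v2 y) * sgval (Dv (char_res C (B_char b1 (v2 y)))))%g.
    apply: (nf_v_unique nf); rewrite phiE !comp_lfunE.
    rewrite (E_map_tens char0 _ _ (@homog_one k G)) morph1 mul1g del1 B_map_tens.
    rewrite (_ : finfun _ = val (B_char b1 (v2 y))); last first.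
      by apply/ffunP=> s0; rewrite !ffunE mul1r.
    by rewrite (untwisted_tens abC defG DvK dB dE _ (@homog_char k G _)) resC_resZ.
  by rewrite vE dp_projC ?divgrH.
by move=> th thM c; rewrite projE; apply: rad.
Qed.

Lemma gen_mono (V : vectType k) (S T : 'End(V) -> Prop) :
  (forall f, S f -> gen_subgroup T f) -> forall f, gen_subgroup S f -> gen_subgroup T f.
Proof.
move=> ST f; elim=> [g /ST //||g h _ Tg _ Th|g _ Tg].
- exact: gen_id.
- exact: gen_comp.
exact: gen_inv.
Qed.

Lemma VcV_VcVE (f : 'End(DG)) : VcV f -> VcVE f.
Proof. by move=> Vf; apply: gen_mem; left. Qed.

Lemma VcV_VcVB (f : 'End(DG)) : VcV f -> VcVB f.
Proof. by move=> Vf; apply: gen_mem; left. Qed.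

Lemma B_VcVB b : VcVB (B_map b : 'End(DG)).
Proof. by apply: gen_mem; right; exists b. Qed.

Lemma E_VcVE a : VcVE (E_map a : 'End(DG)).
Proof. by apply: gen_mem; right; exists a. Qed.

Theorem hopf_aut_reflection_left (phi : 'End(DG)) : hopf_aut phi ->
  exists (H C : {group G}) (d : 'Hom(vec k (subg_of C), vec k (subg_of C))),
    reflection_datum H C d /\
    prodE (singE (untwisted_reflection_map H C d)) (prodE B_set VcVE) phi.
Proof.
move=> /column_decomposition[H [C [d [D [Dv [b1 [del [a [v [th0 [dat _ delV phiE _]]]]]]]]]]].
exists H, C, d; split=> //; exists (untwisted_reflection_map H C d).
exists (B_map b1 \o (del \o E_map a))%VF; split=> //.
exists (B_map b1), (del \o E_map a)%VF; split=> //; first by exists b1.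
by apply: gen_comp; [apply: VcV_VcVE | apply: E_VcVE].
Qed.

Theorem hopf_aut_reflection_right (phi : 'End(DG)) : hopf_aut phi ->
  exists (H C : {group G}) (d : 'Hom(vec k (subg_of C), vec k (subg_of C))),
    reflection_datum H C d /\
    prodE (prodE VcVB E_set) (singE (untwisted_reflection_map H C d)) phi.
Proof.
move=> aut; have [phi' [aut' phiK phi'K]] := hopf_aut_inv_exists aut.
have [w [b [al [v nf]]]] := hopf_aut_normal_form aut.
have [w' [b' [al' [v' nf']]]] := hopf_aut_normal_form aut'.
have inv_l := inverse_components nf nf' phiK.
have inv_r := inverse_components nf' nf phi'K.
have [C [s [sM [D [CZ sK DM DI inj]]]]] := exists_row_reflection char0
  (nf_vM nf) (nf_vM nf') (nf_bM nf') (nf_alM nf)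
  (nf_alZ nf) (nf_alZ nf') inv_l inv_r.
have [H [d [dat dE projE]]] := datum_of_retraction char0 CZ sM sK DM DI.
have [abC defG dI] := dat.
have [Dv DK DvK] := dual_iso_bij char0 (abelian_subg_of abC) DI.
have dB : bijective d by case: dI.
pose r := untwisted_reflection_map H C d.
have autr : hopf_aut r := untwisted_aut char0 abC defG DM DK DvK dB dE.
have aut2 : hopf_aut (phi \o r)%VF by apply: hopf_aut_comp.
have [w2 [b2 [al2 [v2 nf2]]]] := hopf_aut_normal_form aut2.
(* [r] turns the group element [y] into the character pulled back from [D (s y)] times the [H]-part
   of [y]; phi is then applied to this homogeneous tensor. *)
have v2E y : v2 y = (v (y * (sgval (s y))^-1) * al (resZ (char_pull sM (D (s y)))))%g.
  apply/(nf_v_unique nf2 (g := [ffun x => D (s y) (s (w x)) * b (divgr H C y) x : k^o])).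
  rewrite comp_lfunE (untwisted_tens abC defG DvK dB dE _ (@homog_one k G)).
  have -> : Dv (resC abC defG 1%g) = 1%g.
    by apply: (can_inj DK); rewrite DvK (hom1 DM) /resC (hom1 (char_pullM _)).
  rewrite mulg1 (_ : finfun _ = val (char_pull sM (D (s y)))); last first.
    apply/ffunP=> x; rewrite !ffunE mul1r !projE.
    exact/esym/(char_pullE sM (D (s y))).
  rewrite (nf_E nf _ (@homog_char k G _)) -(centerTC _ (nf_alZ nf _)); congr tens.
    apply/ffunP=> x; rewrite !ffunE; congr (_ * _).
    exact: (char_pullE sM (D (s y))).
  by congr (delta (_ * v _)%g); rewrite -projE -{2}(dp_eq defG y) mulgK.
have v2I : injective v2.
  by move=> y y'; rewrite !v2E => /inj.
have [b1 [del [a [delV compE _ _ _]]]] := triangular_decomposition char0 aut2 nf2 v2I.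
exists H, C, d; split=> //; exists ((B_map b1 \o del) \o E_map a)%VF, r; split=> //.
  exists (B_map b1 \o del)%VF, (E_map a); split=> //; last by exists a.
  by apply: gen_comp; [apply: B_VcVB | apply: VcV_VcVB].
rewrite -comp_lfunA -compE -comp_lfunA.
by rewrite (untwisted_involutive char0 abC defG DK DvK dB dE) comp_lfun1r.
Qed.

End Bruhat.

(** * Double cosets *)

Section DoubleCosets.

Variables (k : closedFieldType) (G : finGroupType).
Hypothesis char0 : [pchar k] =i pred0.

Local Notation DG := (vec k (G * G)%type).
Local Notation Z := ('Z([set: G])%g).
Local Notation subgZ := (subg_of 'Z([set: G])%G).
Local Notation X := (character k subgZ).
Local Notation one := ([ffun=> 1] : vec k G).

Lemma B_map_comp b1 b2 b3 :
  (forall g, B_char b1 g = B_char b2 g * B_char b3 g)%g ->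
  B_map b1 = (B_map b2 \o B_map b3 :> 'End(DG))%VF.
Proof.
move=> bE; apply: (homog_ext char0) => psi f y _; rewrite comp_lfunE !B_map_tens.
congr tens; apply/ffunP=> s; rewrite !ffunE bE charME.
by rewrite [B_char b2 y s * _]mulrC mulrA.
Qed.

(** An automorphism whose second coordinate ignores the degree has a trivial right factor in its
    triangular decomposition. *)
Lemma VcVB_of_trivial_al (phi : 'End(DG)) v : hopf_aut phi -> is_hom v -> injective v ->
  (forall psi f y, homog psi f -> exists g, phi (tens f (delta y)) = tens g (delta (v y))) ->
  VcVB phi.
Proof.
move=> aut vM vI phiv; have [w [b [al [v2 nf]]]] := hopf_aut_normal_form aut.
have v2E y : v2 y = v y.
  by have [g e] := phiv _ _ y (@homog_one k G); apply: (nf_v_unique nf e).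
have v2I : injective v2 by move=> x y; rewrite !v2E => /vI.
have [b1 [d [a [dV -> _ aE _]]]] := triangular_decomposition char0 aut nf v2I.
have a1 psi : a psi = 1%g.
  apply: val_inj; apply: v2I; rewrite /= aE (hom1 (nf_vM nf)).
  apply: (nf_al_unique char0 aut nf) => f hf; have [g] := phiv psi f 1%g hf.
  by rewrite (hom1 vM) => ->; exists g.
have -> : E_map a = \1%VF.
  apply: (homog_ext char0) => psi f y hf.
  by rewrite (E_map_tens char0 _ _ hf) a1 id_lfunE mul1g.
rewrite comp_lfun1r; apply: gen_comp; first exact: B_VcVB.
exact: VcV_VcVB.
Qed.

(** The values of an idempotent iterate of [nu] are its fixed points, and this iterate has the form
    p v th on [C]; radicality makes them trivial. *)
Lemma nilpotent_of_no_fixpoint (C : {group G}) (p : G -> subg_of C) (v th0 : G -> G)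
    (nu : subg_of C -> subg_of C) : is_hom p -> is_hom v -> is_hom th0 ->
  (forall c, nu c = p (v (th0 (sgval c)))) ->
  (forall th, is_hom th -> forall c, p (v (th (sgval c))) = c -> c = 1%g) ->
  exists n, forall c, iter n nu c = 1%g.
Proof.
move=> pM vM th0M nuE rad.
have [m [m_gt0 idem]] := iter_idem nu; exists m => c.
case: m m_gt0 idem => // m _ idem.
pose u x := sgval (p (v (th0 x))).
have uM : is_hom u by move=> x y; rewrite /u th0M vM pM.
have itE n x : sgval (iter n nu x) = iter n u (sgval x).
  by elim: n => //= n IHn; rewrite -IHn /u nuE.
apply: (rad (fun x => th0 (iter m u x))).
  by move=> x y; rewrite (hom_iter m uM) th0M.
by rewrite -itE -nuE -iterS idem.
Qed.

(** In phi = r B d E the bicharacter of B is split into its block on C x C and a remainder B'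
    trivial there. Then r times the block is a twisted reflection, and r B' r belongs to the left
    factor of the double coset. *)
Theorem hopf_aut_double_coset (phi : 'End(DG)) : hopf_aut phi ->
  exists (H C : {group G}) (d : 'Hom(vec k (subg_of C), vec k (subg_of C)))
         (nu : {morphism [set: subg_of C] >-> subg_of C}),
    twisted_reflection_datum H C d nu /\ double_coset (reflection_map H C d nu) phi.
Proof.
move=> /(column_decomposition char0)[H [C [d [D [Dv [b1 [del [a [v [th0]]]]]]]]]].
move=> [dat [DM DK DvK dE] delV -> [vM th0M nuE rad]].
have [abC defG dI] := dat; have dB : bijective d by case: dI.
have pM := projC_hom defG; have hM := divgr_hom defG.
pose r := untwisted_reflection_map H C d.
have autr : hopf_aut r := untwisted_aut char0 abC defG DM DK DvK dB dE.
have rtens psi f y : homog psi f -> _ := @untwisted_tens k G H C abC defG D Dv DvK d dB dE psi f y.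
rewrite -/r in rtens.
have DvM := DvM DM DK DvK.
have bM := B_charM b1.
(* The twist is the block of the bicharacter on C x C, turned into an endomorphism of [C] by the
   inverse of [D]. *)
pose nuf (c : subg_of C) := Dv (char_res C (B_char b1 (sgval c))).
have nufM : is_hom nuf by move=> x y; rewrite /nuf /= bM char_resM DvM.
pose nu : {morphism [set: subg_of C] >-> subg_of C} := Morphism (D := [set: subg_of C]) (in2W nufM).
pose scc g := char_pull pM (char_res C (B_char b1 (sgval (projC H C g)))).
have sccM : is_hom scc.
  by move=> x y; rewrite /scc pM /= bM char_resM char_pullM.
have sccE g x : scc g x = B_char b1 (sgval (projC H C g)) (sgval (projC H C x)).
  by rewrite char_pullE char_resE.
pose s' g := (B_char b1 g * (scc g)^-1)%g.
have s'M : is_hom s'.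
  move=> x y; rewrite /s' bM sccM (abelianTV (character_abelian k G)).
  by rewrite (abelianTCA (character_abelian k G)).
have s'C (c : subg_of C) : char_res C (s' (sgval c)) = 1%g.
  apply/Defs.charP=> x; rewrite char_resE charME charVE sccE char1E.
  by rewrite !projC_sgval // mulfV ?char_neq0.
have [bcc bccE] := B_char_onto sccM; have [b' b'E] := B_char_onto s'M.
have -> : B_map b1 = (B_map b' \o B_map bcc :> 'End(DG))%VF.
  by apply: B_map_comp => g; rewrite bccE b'E mulgKV.
exists H, C, d, nu; split.
  split=> //; apply: (nilpotent_of_no_fixpoint pM vM th0M _ rad) => c.
  by rewrite nuE.
have rcc : (r \o B_map bcc)%VF = reflection_map H C d nu.
  apply: (homog_ext char0) => psi f y hf; rewrite comp_lfunE B_map_tens.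
  rewrite (reflection_map_tens abC defG DvK dB dE _ _ hf).
  rewrite (rtens (psi * resZ (B_char bcc y))%g); last first.
    by move=> x z; rewrite !ffunE hf Defs.charM resZE mulrACA.
  congr tens.
    apply/ffunP=> x; rewrite !ffunE bccE sccE projC_divgr //.
    by rewrite Defs.char1 mulr1.
  congr delta; rewrite /resC char_pullM -/(resC _ _ _) -/(resC _ _ _) DvM /= mulgA.
  suff -> : Dv (resC abC defG (resZ (B_char bcc y))) = nuf (projC H C y) by [].
  rewrite /nuf resC_resZ; congr Dv.
  by apply/Defs.charP=> c; rewrite !char_resE bccE sccE projC_sgval.
(* As [s'] is trivial on C x C, conjugation by [r] creates no entry a. The [v]-component [v3] is
   unipotent: it alters [y] by an element of [C] depending only on the [H]-part of [y]. *)
have betaV : VcVB (r \o B_map b' \o r)%VF.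
  pose v3 y := (y * sgval (Dv (char_res C (s' (divgr H C y)))))%g.
  have CZ (c : subg_of C) : sgval c \in Z := subsetP (C_central abC defG) _ (subgP c).
  have v3M : is_hom v3.
    apply: central_homM => // x y.
    by rewrite hM s'M char_resM DvM.
  have v3I : injective v3.
    apply: hom_inj => // y v31.
    have dy : divgr H C y = 1%g.
      have := congr1 (divgr H C) v31; rewrite hM (hom1 hM) divgr_sgval // mulg1.
      by [].
    move: v31; rewrite /v3 dy (hom1 s'M) (hom1 (@char_resM k G C)) (hom1 DvM).
    by rewrite mulg1.
  apply: (VcVB_of_trivial_al (v := v3)) => //.
    apply: hopf_aut_comp => //; apply: hopf_aut_comp => //.
    by apply: (B_aut char0); exists b'.
  move=> psi f y hf; rewrite !comp_lfunE (rtens _ _ _ hf) B_map_tens.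
  have [psi1 [hf1 res1]] := reflected_degree abC defG D y hf.
  set c0 := Dv _; set y1 := (_ * sgval c0)%g.
  rewrite (rtens (psi1 * resZ (B_char b' y1))%g); last first.
    move=> x z; rewrite [LHS]ffunE hf1 [X in _ = X * _]ffunE charME Defs.charM resZE.
    by rewrite mulrACA.
  eexists; congr (tens _ (delta _)).
  rewrite /resC char_pullM -/(resC _ _ _) -/(resC _ _ _) res1 resC_resZ.
  rewrite b'E /y1 s'M char_resM s'C mulg1 DvM DK dp_divgr ?divgrH //.
  by rewrite /v3 /= mulgA dp_eq.
exists ((r \o B_map b' \o r) \o reflection_map H C d nu)%VF, (del \o E_map a)%VF; split.
- by exists (r \o B_map b' \o r)%VF, (reflection_map H C d nu).
- by apply: gen_comp; [apply: VcV_VcVE | apply: E_VcVE].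
rewrite -rcc -!comp_lfunA (comp_lfunA r r) (untwisted_involutive char0 abC defG DK DvK dB dE).
by rewrite comp_lfun1l.
Qed.

Lemma untwisted_datum_aut (H C : {group G})
    (d : 'Hom(vec k (subg_of C), vec k (subg_of C))) : reflection_datum H C d ->
  hopf_aut (untwisted_reflection_map H C d).
Proof.
move=> dat; have [D [Dv [DM DK DvK dE]]] := datum_char char0 dat.
have [abC defG dI] := dat; have dB : bijective d by case: dI.
exact (untwisted_aut char0 abC defG DM DK DvK dB dE).
Qed.

Lemma R_aut (f : 'End(DG)) : R_set f -> hopf_aut f.
Proof. by move=> [H [C [d [dat ->]]]]; apply: untwisted_datum_aut. Qed.

Lemma VcV_aut (f : 'End(DG)) : VcV f -> hopf_aut f.
Proof.
by apply: hopf_aut_gen => g [/(Vc_aut char0)|/(V_aut char0)].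
Qed.

Lemma VcVB_aut (f : 'End(DG)) : VcVB f -> hopf_aut f.
Proof. by apply: hopf_aut_gen => g [/VcV_aut|/(B_aut char0)]. Qed.

Lemma VcVE_aut (f : 'End(DG)) : VcVE f -> hopf_aut f.
Proof. by apply: hopf_aut_gen => g [/VcV_aut|/(E_aut char0)]. Qed.

Theorem hopf_aut_generated (phi : 'End(DG)) : hopf_aut phi <->
  gen_subgroup (unionE (unionE (unionE (unionE V_set Vc_set) B_set) E_set) R_set) phi.
Proof.
split=> [/(hopf_aut_reflection_left char0)[H [C [d [dat [r0 [h [-> [f [g [Bf Eg ->]]] ->]]]]]]]|].
  apply: gen_comp; first by apply: gen_mem; right; exists H, C, d.
  apply: gen_comp; first by apply: gen_mem; left; left; right.
  apply: gen_mono Eg => e [|Ee]; last by apply: gen_mem; left; right.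
  by apply: gen_mono => e' [|] He; apply: gen_mem; left; left; left; [right | left].
apply: hopf_aut_gen => f [[[[/(V_aut char0)|/(Vc_aut char0)]|/(B_aut char0)]|/(E_aut char0)]|] //.
exact: R_aut.
Qed.

(** * Invariants of a double coset *)

Lemma VcVB_blocks (f : 'End(DG)) : VcVB f ->
  exists v : G -> G, [/\ is_hom v, injective v
    & forall h y, exists g, f (tens h (delta y)) = tens g (delta (v y))].
Proof.
pose P (f : 'End(DG)) := exists v : G -> G, [/\ is_hom v, injective v
  & forall h y, exists g, f (tens h (delta y)) = tens g (delta (v y))].
have Pid : P \1%VF.
  by exists id; split=> // h y; exists h; rewrite id_lfunE.
have Pcomp (f1 f2 : 'End(DG)) : P f1 -> P f2 -> P (f1 \o f2)%VF.
  move=> [v1 [v1M v1I v1E]] [v2 [v2M v2I v2E]]; exists (v1 \o v2); split.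
  - exact: hom_comp.
  - exact: inj_comp.
  move=> h y; rewrite comp_lfunE; have [g ->] := v2E h y.
  exact: v1E.
have Pinv (f1 : 'End(DG)) : hopf_aut f1 -> P f1 -> P (f1^-1)%VF.
  move=> [_ fB] [v [vM vI vE]].
  have [vi [viM vK viK]] := hom_inverse vM vI erefl.
  exists vi; split=> //; first exact: can_inj viK.
  move=> h y; set u := (f1^-1)%VF _.
  have fu : f1 u = tens h (delta y) by apply: lfun_bijK.
  pose col y' : vec k G := [ffun s => u (s, y')].
  have uE : u = \sum_y' tens (col y') (delta y').
    apply/ffunP=> -[s t]; rewrite sum_ffunE (bigD1 t) //= !ffunE /= eqxx mulr1 big1 ?addr0 //.
    by move=> t' ne; rewrite !ffunE /= eq_sym (negPf ne) mulr0.
  (* Every other column of the preimage has image zero, because [f1] sends distinct columns into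
     distinct blocks. *)
  exists (col (vi y)); rewrite {1}uE (bigD1 (vi y)) //= big1 ?addr0 // => y' ne.
  apply: (bij_inj fB); rewrite linear0; have [g gE] := vE (col y') y'.
  rewrite gE; apply/ffunP=> -[s t]; rewrite !ffunE /=.
  have [_|_] := eqVneq t (v y'); last by rewrite mulr0.
  rewrite mulr1; have := congr1 (fun w : DG => w (s, v y')) fu.
  have /negPf ne' : v y' != y by apply: contraNneq ne => <-; rewrite vK.
  rewrite [RHS]ffunE /= deltaE ne' mulr0.
  rewrite {1}uE linear_sum sum_ffunE (bigD1 y') //= gE !ffunE /= eqxx mulr1.
  rewrite big1 ?addr0 // => y2 ne2; have [g2 ->] := vE (col y2) y2.
  by rewrite !ffunE /= (inj_eq vI) eq_sym (negPf ne2) mulr0.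
have PV (f1 : 'End(DG)) : VcV f1 -> P f1.
  elim=> [g [[v vA ->]|[v vA ->]]||g g' _ Pg _ Pg'|g gV Pg].
  - by exists id; split=> // h y; rewrite Vc_map_tens; eexists.
  - exists v; split; [exact: Aut_hom | exact: perm_inj |].
    by move=> h y; rewrite V_map_tens; eexists.
  - exact: Pid.
  - exact: Pcomp.
  by apply: Pinv => //; apply: VcV_aut.
elim=> [g [/PV //|[b ->]]||g g' _ Pg _ Pg'|g gV Pg].
- by exists id; split=> // h y; rewrite B_map_tens; eexists.
- exact: Pid.
- exact: Pcomp.
by apply: Pinv => //; apply: VcVB_aut.
Qed.

Lemma VcVE_grouplike (f : 'End(DG)) : VcVE f ->
  exists v : G -> G, [/\ is_hom v, injective v
    & forall y, f (tens one (delta y)) = tens one (delta (v y))].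
Proof.
pose P (f : 'End(DG)) := exists v : G -> G, [/\ is_hom v, injective v
  & forall y, f (tens one (delta y)) = tens one (delta (v y))].
have Pid : P \1%VF by exists id; split=> // y; rewrite id_lfunE.
have Pcomp (f1 f2 : 'End(DG)) : P f1 -> P f2 -> P (f1 \o f2)%VF.
  move=> [v1 [v1M v1I v1E]] [v2 [v2M v2I v2E]]; exists (v1 \o v2); split.
  - exact: hom_comp.
  - exact: inj_comp.
  by move=> y; rewrite comp_lfunE v2E v1E.
have Pinv (f1 : 'End(DG)) : hopf_aut f1 -> P f1 -> P (f1^-1)%VF.
  move=> [_ fB] [v [vM vI vE]].
  have [vi [viM vK viK]] := hom_inverse vM vI erefl.
  exists vi; split=> //; first exact: can_inj viK.
  by move=> y; rewrite -{1}(viK y) -vE (lfun_injK (bij_inj fB)).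
have PV (f1 : 'End(DG)) : VcV f1 -> P f1.
  elim=> [g [[v vA ->]|[v vA ->]]||g g' _ Pg _ Pg'|g gV Pg].
  - exists id; split=> // y; rewrite Vc_map_tens; congr tens.
    by apply/ffunP=> s; rewrite !ffunE.
  - exists v; split; [exact: Aut_hom | exact: perm_inj |].
    move=> y; rewrite V_map_tens; congr tens.
    by apply/ffunP=> s; rewrite !ffunE.
  - exact: Pid.
  - exact: Pcomp.
  by apply: Pinv => //; apply: VcV_aut.
elim=> [g [/PV //|[a ->]]||g g' _ Pg _ Pg'|g gV Pg].
- exists id; split=> // y.
  by rewrite (E_map_tens char0 _ _ (@homog_one k G)) morph1 mul1g.
- exact: Pid.
- exact: Pcomp.
by apply: Pinv => //; apply: VcVE_aut.
Qed.

Lemma untwisted_one (H C : {group G})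
    (d : 'Hom(vec k (subg_of C), vec k (subg_of C))) y : reflection_datum H C d ->
  exists2 g : vec k G, untwisted_reflection_map H C d (tens one (delta y)) =
    tens g (delta (divgr H C y)) & g 1%g != 0.
Proof.
move=> dat; have [D [Dv [DM DK DvK dE]]] := datum_char char0 dat.
have [abC defG dI] := dat; have dB : bijective d by case: dI.
rewrite (untwisted_tens abC defG DvK dB dE _ (@homog_one k G)).
have -> : Dv (resC abC defG 1%g) = 1%g.
  by apply: (can_inj DK); rewrite DvK (hom1 DM) /resC (hom1 (char_pullM _)).
by rewrite mulg1; eexists; rewrite // !ffunE mul1r char_neq0.
Qed.

Lemma divgr_eq1 (H C : {group G}) x : (H \x C = [set: G])%g ->
  (divgr H C x == 1%g) = (x \in C).
Proof.
move=> defG; apply/eqP/idP => [d1|Cx].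
  by rewrite -(dp_eq defG x) d1 mul1g subgP.
by rewrite -(subgK _ Cx) divgr_sgval.
Qed.

Lemma double_coset_self (f : 'End(DG)) : double_coset f f.
Proof.
exists f, \1%VF; split; last by rewrite comp_lfun1r.
  by exists \1%VF, f; split=> //; [apply: gen_id | rewrite comp_lfun1l].
exact: gen_id.
Qed.

(** Compare both sides on a group element [y]. The second coordinates show that the projections onto
    [H] and [H'] agree up to automorphisms of [G], so [C'] is the preimage of [C] under [v2]. *)
Lemma double_coset_isog (H C H' C' : {group G})
    (d : 'Hom(vec k (subg_of C), vec k (subg_of C)))
    (d' : 'Hom(vec k (subg_of C'), vec k (subg_of C'))) :
  reflection_datum H C d -> reflection_datum H' C' d' ->
  double_coset (untwisted_reflection_map H C d) (untwisted_reflection_map H' C' d') ->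
  C \isog C'.
Proof.
move=> dat dat' [f [e [[be [r0 [beB r0E fE]]] eE eq']]].
have [v1 [v1M v1I v1E]] := VcVB_blocks beB.
have [v2 [v2M v2I v2E]] := VcVE_grouplike eE.
have [_ defG _] := dat; have [_ defG' _] := dat'.
have divE y : divgr H' C' y = v1 (divgr H C (v2 y)).
  have [g' e' g'1] := untwisted_one y dat'.
  have [g e1 _] := untwisted_one (v2 y) dat.
  have [g1 e2] := v1E g (divgr H C (v2 y)).
  have e3 : tens g' (delta (divgr H' C' y)) = tens g1 (delta (v1 (divgr H C (v2 y)))).
    by rewrite -e' eq' fE !comp_lfunE v2E r0E e1 e2.
  exact: tens_delta_eq e3 g'1.
have CE y : (y \in C') = (v2 y \in C).
  by rewrite -(divgr_eq1 _ defG') divE -(divgr_eq1 _ defG) -[1%g in LHS](hom1 v1M) (inj_eq v1I).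
have [vi [viM vK viK]] := hom_inverse v2M v2I erefl.
apply: (mutual_isog viM v2M) => y.
- by rewrite CE viK.
- by rewrite CE.
- by move=> _ y1; rewrite -(viK y) y1 (hom1 v2M).
by move=> _ y1; rewrite -(vK y) y1 (hom1 viM).
Qed.

(** * Change of representative in a double coset *)

Lemma prodE_double_coset (r r' : 'End(DG)) f e : VcVB f -> VcVE e ->
  r' = (f \o (r \o e))%VF -> forall phi, double_coset r' phi -> double_coset r phi.
Proof.
move=> fB eE r'E phi [g [h [[g1 [r1 [g1B -> ->]]] hE ->]]].
exists ((g1 \o f) \o r)%VF, (e \o h)%VF; split; last by rewrite r'E -!comp_lfunA.
  by exists (g1 \o f)%VF, r; split=> //; apply: gen_comp.
exact: gen_comp.
Qed.

(** Cancellation of direct factors provides an isomorphism from [H] to [H']; gluing it to the given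
    one is multiplicative because [C'] is central. *)
Lemma dprod_iso_extend (H C H' C' : {group G}) : abelian C -> abelian C' ->
  (H \x C = [set: G])%g -> (H' \x C' = [set: G])%g -> C \isog C' ->
  exists sg : {perm G}, [/\ is_hom sg, forall x, x \in H -> sg x \in H'
    & forall x, x \in C -> sg x \in C'].
Proof.
move=> abC abC' defG defG' isoC.
have isoH : H \isog H'.
  have dG := defG; have dG' := defG'; rewrite dprodC in dG; rewrite dprodC in dG'.
  exact: dprod_cancel dG dG' (isog_refl _) isoC.
have [f /injmP fI fH] := isogP isoH; have [g /injmP gI gC] := isogP isoC.
have fin x : x \in H -> f x \in H' by move=> Hx; rewrite -fH mem_morphim.
have gin x : x \in C -> g x \in C' by move=> Cx; rewrite -gC mem_morphim.
have hM := divgr_hom defG; have pM := projC_hom defG.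
pose s x := (f (divgr H C x) * g (sgval (projC H C x)))%g.
have sM : is_hom s.
  apply: central_homM => [x y|x y|x].
  - by rewrite hM morphM ?divgrH.
  - by rewrite pM morphM ?subgP.
  by apply: (subsetP (C_central abC' defG')); apply/gin/subgP.
have s_H x : x \in H -> s x = f x.
  move=> Hx; have := dp_divgr defG 1%g Hx; have := dp_projC defG 1%g Hx.
  by rewrite mulg1 /s => -> ->; rewrite morph1 mulg1.
have s_C x : x \in C -> s x = g x.
  by move=> Cx; rewrite -(subgK _ Cx) /s divgr_sgval // projC_sgval // morph1 mul1g.
have sI : injective s.
  apply: hom_inj => // x sx.
  have fx := divgrH defG x.
  have cE : g (sgval (projC H C x)) = sgval (subg C' (g (sgval (projC H C x)))).
    by rewrite (subgK _ (gin _ (subgP _))).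
  have d1 : divgr H C x = 1%g.
    apply: fI => //; rewrite morph1 -(dp_divgr defG' (subg C' (g (sgval (projC H C x)))) (fin _ fx)).
    by rewrite -cE -/(s x) sx (hom1 (divgr_hom defG')).
  move: sx; rewrite /s d1 morph1 mul1g => g1.
  rewrite -(dp_eq defG x) d1 mul1g; apply: gI => //; first exact: subgP.
  by rewrite g1 morph1.
exists (perm sI); split=> [x y|x Hx|x Cx]; rewrite !permE ?sM //.
  by rewrite s_H ?fin.
by rewrite s_C ?gin.
Qed.

(** Let [sg] carry [H] to [H'] and [C] to [C']. As r is an involution, r' = (r' sg r) r sg^-1; in
    the bracket the coordinates along [C] are exchanged twice, so it is diagonal and lies in
    [VcV]. *)
Lemma isog_double_coset (H C H' C' : {group G})
    (d : 'Hom(vec k (subg_of C), vec k (subg_of C)))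
    (d' : 'Hom(vec k (subg_of C'), vec k (subg_of C'))) :
  reflection_datum H C d -> reflection_datum H' C' d' -> C \isog C' ->
  forall phi, double_coset (untwisted_reflection_map H' C' d') phi ->
    double_coset (untwisted_reflection_map H C d) phi.
Proof.
move=> dat dat' isoC.
have autr := untwisted_datum_aut dat; have autr' := untwisted_datum_aut dat'.
have [D [Dv [DM DK DvK dE]]] := datum_char char0 dat.
have [D' [Dv' [DM' DK' DvK' dE']]] := datum_char char0 dat'.
have [abC defG dI] := dat; have [abC' defG' dI'] := dat'.
have dB : bijective d by case: dI.
have dB' : bijective d' by case: dI'.
have [sg [sgM sgH sgC]] := dprod_iso_extend abC abC' defG defG' isoC.
have sgA := hom_Aut sgM.
have sgVM := is_hom_perm_inv sgM.
have cardC := card_isog isoC.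
have sgVC x : x \in C' -> sg^-1%g x \in C.
  have -> : C' = sg @: C :> {set G}.
    apply/esym/eqP; rewrite eqEcard card_imset ?cardC ?leqnn ?andbT; last exact: perm_inj.
    by apply/subsetP=> _ /imsetP[y Cy ->]; apply: sgC.
  by move=> /imsetP[y Cy ->]; rewrite permK.
have cardH : #|H| = #|H'|.
  apply/eqP; rewrite -(eqn_pmul2r (cardG_gt0 C)) (dprod_card defG) cardC.
  by rewrite (dprod_card defG').
have sgVH x : x \in H' -> sg^-1%g x \in H.
  have -> : H' = sg @: H :> {set G}.
    apply/esym/eqP; rewrite eqEcard card_imset ?cardH ?leqnn ?andbT; last exact: perm_inj.
    by apply/subsetP=> _ /imsetP[y Hy ->]; apply: sgH.
  by move=> /imsetP[y Hy ->]; rewrite permK.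
pose r := untwisted_reflection_map H C d; pose r' := untwisted_reflection_map H' C' d'.
have tauM : is_hom (fun c' : subg_of C' => projC H C (sg^-1%g (sgval c'))).
  by move=> x y; rewrite sgVM (projC_hom defG).
pose T := char_pull tauM : character k (subg_of C) -> character k (subg_of C').
have TM : is_hom T := char_pullM tauM.
have Dv'M := DvM DM' DK' DvK'.
(* The [v]-component of r' sg r: on [H] it is [sg], and on [C] it is [D] followed by the transpose
   of the inverse of [sg] and by the inverse of [D']. *)
pose v3 y := (sg (divgr H C y) * sgval (Dv' (T (D (projC H C y)))))%g.
have CZ' (c : subg_of C') : sgval c \in Z := subsetP (C_central abC' defG') _ (subgP c).
have v3M : is_hom v3.
  apply: central_homM => // x y; first by rewrite (divgr_hom defG) sgM.
  by rewrite (projC_hom defG) DM TM Dv'M.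
have v3I : injective v3.
  apply: hom_inj => // y v31.
  have Hd := sgH _ (divgrH defG y).
  have s1 : sg (divgr H C y) = 1%g.
    rewrite -(dp_divgr defG' (Dv' (T (D (projC H C y)))) Hd) -/(v3 y) v31.
    exact: hom1 (divgr_hom defG').
  have d1 : divgr H C y = 1%g by apply: (@perm_inj _ sg); rewrite s1 (hom1 sgM).
  have T1 : T (D (projC H C y)) = 1%g.
    apply: (can_inj DvK'); rewrite (hom1 Dv'M).
    by apply: val_inj; move: v31; rewrite /v3 s1 mul1g.
  have p1 : projC H C y = 1%g.
    apply: (can_inj DK); rewrite (hom1 DM); apply/Defs.charP=> c; rewrite char1E.
    have := congr1 (fun h : character k _ => h (subg C' (sg (sgval c)))) T1.
    rewrite char1E char_pullE subgK ?sgC ?subgP // permK projC_sgval //.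
  by rewrite -(dp_eq defG y) d1 p1 mulg1.
have rtens := untwisted_tens abC defG DvK dB dE.
have rtens' := untwisted_tens abC' defG' DvK' dB' dE'.
have step psi (f : vec k G) y : homog psi f -> exists2 psi2,
    homog psi2 [ffun x => f (divgr H C (sg^-1%g x)) * D (projC H C y) (projC H C (sg^-1%g x)) : k^o]
    & resC abC' defG' psi2 = T (D (projC H C y)).
  move=> hf; have [psi1 [hf1 res1]] := reflected_degree abC defG D y hf.
  have pM : is_hom (fun z : subgZ => subg 'Z([set: G])%G (sg^-1%g (sgval z))).
    apply: subg_hom => [z z'|z]; first by rewrite -sgVM.
    by apply: center_perm => //; apply: subgP.
  exists (char_pull pM psi1).
    move=> x z; have := hf1 (sg^-1%g x) (subg _ (sg^-1%g (sgval z))).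
    rewrite subgK; last by apply: center_perm => //; apply: subgP.
    by rewrite !ffunE -sgVM char_pullE.
  apply/Defs.charP=> c; rewrite resCE !char_pullE (inclCZE abC' defG').
  rewrite -res1 resCE; congr (psi1 _); apply: val_inj.
  rewrite /= (inclCZE abC defG) subgK; last by apply: center_perm.
  by rewrite -[X in projC H C X](subgK _ (sgVC _ (subgP c))) projC_sgval // subgK // sgVC ?subgP.
have XE psi (f : vec k G) y : homog psi f ->
    (r' \o V_map k sg \o r)%VF (tens f (delta y)) =
    tens [ffun x => f (divgr H C (sg^-1%g (divgr H' C' x))) *
              D (projC H C y) (projC H C (sg^-1%g (divgr H' C' x))) *
              D' (projC H' C' (sg (divgr H C y * sgval (Dv (resC abC defG psi)))%g)) (projC H' C' x) : k^o]
         (delta (v3 y)).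
  move=> hf; rewrite !comp_lfunE (rtens _ _ _ hf) V_map_tens.
  have [psi2 hf2 res2] := step psi f y hf.
  set f2 := [ffun s => _]; have f2E : f2 = [ffun x => f (divgr H C (sg^-1%g x)) *
      D (projC H C y) (projC H C (sg^-1%g x)) : k^o] by apply/ffunP=> x; rewrite !ffunE.
  rewrite f2E (rtens' _ _ _ hf2) res2; congr (tens _ (delta _)).
    by apply/ffunP=> x; rewrite !ffunE.
  rewrite sgM -[X in (sg _ * X)%g](subgK _ (sgC _ (subgP _))).
  by rewrite dp_divgr // sgH ?divgrH.
have XV : VcV (r' \o V_map k sg \o r)%VF.
  apply: (VcV_of_trivial char0 _ v3M v3I).
  - apply: hopf_aut_comp => //; apply: hopf_aut_comp => //.
    by apply: (V_aut char0); exists sg.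
  - by move=> psi f y hf; rewrite (XE _ _ _ hf); eexists.
  move=> y; rewrite (XE _ _ _ (@homog_one k G)); congr tens.
  apply/ffunP=> x; rewrite !ffunE mul1r.
  have -> : Dv (resC abC defG 1%g) = 1%g.
    by apply: (can_inj DK); rewrite DvK (hom1 DM) /resC (hom1 (char_pullM _)).
  rewrite mulg1.
  have -> : projC H' C' (sg (divgr H C y)) = 1%g.
    have := dp_projC defG' 1%g (sgH _ (divgrH defG y)); by rewrite mulg1.
  have -> : projC H C (sg^-1%g (divgr H' C' x)) = 1%g.
    have := dp_projC defG 1%g (sgVH _ (divgrH defG' x)); by rewrite mulg1.
  by rewrite (hom1 DM') char1E Defs.char1 mulr1.
have VV : VcVE ((V_map k sg)^-1)%VF.
  apply: gen_inv; apply: VcV_VcVE; apply: gen_mem; right; by exists sg.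
apply: (prodE_double_coset (VcV_VcVB XV) VV).
have rr := untwisted_involutive char0 abC defG DK DvK dB dE.
rewrite -!comp_lfunA (comp_lfunA r r) rr comp_lfun1l.
have -> : (V_map k sg \o (V_map k sg)^-1 = \1 :> 'End(DG))%VF.
  apply/lfunP=> u; rewrite comp_lfunE id_lfunE lfun_bijK //.
  by have [] := V_aut char0 (ex_intro2 _ _ sg sgA erefl).
by rewrite comp_lfun1r.
Qed.

Theorem reflection_double_coset_eq (H C H' C' : {group G})
    (d : 'Hom(vec k (subg_of C), vec k (subg_of C)))
    (d' : 'Hom(vec k (subg_of C'), vec k (subg_of C'))) :
  reflection_datum H C d -> reflection_datum H' C' d' ->
  ((forall phi : 'End(DG), double_coset (untwisted_reflection_map H C d) phi <->
      double_coset (untwisted_reflection_map H' C' d') phi) <-> C \isog C').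
Proof.
move=> dat dat'; split=> [eqdc|isoC phi].
  by apply: (double_coset_isog dat dat'); apply/eqdc/double_coset_self.
split; last exact: isog_double_coset.
by apply: isog_double_coset => //; rewrite isog_sym.
Qed.

End DoubleCosets.

Theorem theorem4p10 (k : closedFieldType) (char0 : [pchar k] =i pred0)
    (G : finGroupType) :
  [/\ (* (i) *)
      forall phi : 'End(vec k (G * G)%type),
        hopf_aut phi <->
        gen_subgroup (unionE (unionE (unionE (unionE
          V_set Vc_set) B_set) E_set)
          R_set) phi,
      (* (ii) *)
      forall phi : 'End(vec k (G * G)%type), hopf_aut phi ->
        exists (H C : {group G})
               (d : 'Hom(vec k (subg_of C), vec k (subg_of C)))
               (nu : {morphism [set: subg_of C] >-> subg_of C}),
          twisted_reflection_datum H C d nu /\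
          double_coset (reflection_map H C d nu) phi,
      (* (iii) *)
      forall (H C H' C' : {group G})
             (d : 'Hom(vec k (subg_of C), vec k (subg_of C)))
             (d' : 'Hom(vec k (subg_of C'), vec k (subg_of C'))),
        reflection_datum H C d -> reflection_datum H' C' d' ->
        ((forall phi : 'End(vec k (G * G)%type),
            double_coset (untwisted_reflection_map H C d) phi <->
            double_coset (untwisted_reflection_map H' C' d') phi)
         <-> C \isog C'),
      (* (iv) *)
      forall phi : 'End(vec k (G * G)%type), hopf_aut phi ->
        exists (H C : {group G})
               (d : 'Hom(vec k (subg_of C), vec k (subg_of C))),
          reflection_datum H C d /\
          prodE (singE (untwisted_reflection_map H C d))
                (prodE B_set VcVE) phi
    & (* (v) *)
      forall phi : 'End(vec k (G * G)%type), hopf_aut phi ->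
        exists (H C : {group G})
               (d : 'Hom(vec k (subg_of C), vec k (subg_of C))),
          reflection_datum H C d /\
          prodE (prodE VcVB E_set)
                (singE (untwisted_reflection_map H C d)) phi].
Proof.
split.
- exact: hopf_aut_generated.
- exact: hopf_aut_double_coset.
- by move=> *; apply: reflection_double_coset_eq.
- exact: hopf_aut_reflection_left.
exact: hopf_aut_reflection_right.
Qed.
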